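(* Let $\Omega\subset\mathbb{R}^d$ ($d\ge2$) be an open, bounded, connected set with sufficiently regular (e.g. Lipschitz) boundary and let $0<\alpha<\beta$. For a fixed parameter $\sigma$, let $\{A^\varepsilon_\sigma\}_{\varepsilon>0}$ be a sequence of matrices in $M(\alpha,\beta,\Omega)$ which G-converges (as $\varepsilon\to0$) to the matrix $A^0_\sigma\in M(\alpha,\beta,\Omega)$. Let $J,L\in\mathbb{N}$, let $\Gamma_j\subset\partial\Omega$, $j=1,\dots,J$, satisfy $\Gamma_i\cap\Gamma_j=\emptyset$ for $i\ne j$, let $\phi_j\in H^{1/2}(\partial\Omega)$ with $\mathrm{supp}(\phi_j)\subseteq\Gamma_j$ for all $j=1,\dots,J$, and let $g_l\in H^{1/2}(\partial\Omega)$ for all $l=1,\dots,L$. Let $m(\sigma)\in\mathbb{R}^{JL}$ (depending on $\varepsilon$) be the vector with entries $$\tilde m_{jl}(\sigma)=\int_{\Gamma_j}(\Lambda_{A^\varepsilon_\sigma}-\Lambda_{A^0_\sigma})g_l\cdot\phi_j\,ds,\qquad j=1,\dots,J,\ l=1,\dots,L,$$ the integral being understood as the duality pairing $\langle(\Lambda_{A^\varepsilon_\sigma}-\Lambda_{A^0_\sigma})g_l,\phi_j\rangle$ between $H^{-1/2}(\partial\Omega)$ and $H^{1/2}(\partial\Omega)$. Let $C_e$ be a symmetric positive definite $JL\times JL$ matrix and $\|v\|_{C_e}^2=v^\top C_e^{-1}v$. Then $\|m(\sigma)\|_{C_e}\to0$ as $\varepsilon\to0$.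
   Context: $M(\alpha,\beta,\Omega)$ is the set of $A\in L^\infty(\Omega,\mathrm{Sym}_d)$ ($\mathrm{Sym}_d$: symmetric real $d\times d$ matrices) such that $\alpha|\xi|^2\le A(x)\xi\cdot\xi$ and $|A(x)\xi|\le\beta|\xi|$ for all $\xi\in\mathbb{R}^d$ and a.e. $x\in\Omega$. G-convergence: a sequence $\{A^\varepsilon\}_{\varepsilon>0}\subset M(\alpha,\beta,\Omega)$ G-converges to $A^0\in M(\alpha,\beta,\Omega)$ if for every $f\in H^{-1}(\Omega)$ and $g\in H^{1/2}(\partial\Omega)$ the solution $u^\varepsilon\in H^1(\Omega)$ of $-\nabla\cdot(A^\varepsilon\nabla u^\varepsilon)=f$ in $\Omega$, $u^\varepsilon=g$ on $\partial\Omega$, converges weakly in $H^1(\Omega)$ to the unique solution $u^0$ of $-\nabla\cdot(A^0\nabla u^0)=f$ in $\Omega$, $u^0=g$ on $\partial\Omega$. Dirichlet-to-Neumann map: for $B\in M(\alpha,\beta,\Omega)$, $\Lambda_B:H^{1/2}(\partial\Omega)\to H^{-1/2}(\partial\Omega)$ sends $g$ to $B\nabla u\cdot\nu|_{\partial\Omega}$, where $\nu$ is the exterior unit normal and $u\in H^1(\Omega)$ is the weak solution of $-\nabla\cdot(B\nabla u)=0$ in $\Omega$, $u=g$ on $\partial\Omega$; equivalently $\langle\Lambda_Bg,\phi\rangle=\int_\Omega B\nabla u\cdot\nabla\tilde\phi\,dx$ for every $\phi\in H^{1/2}(\partial\Omega)$ and every $\tilde\phi\in H^1(\Omega)$ with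 trace $\phi$. *)

(* Defs.v *)
From HB Require Import structures.
From mathcomp Require Import all_boot all_order all_algebra.
From mathcomp Require Import all_classical all_reals all_analysis.

Set Implicit Arguments.
Unset Strict Implicit.
Unset Printing Implicit Defensive.

Import Order.TTheory GRing.Theory Num.Theory.
Import numFieldNormedType.Exports.

Local Open Scope classical_set_scope.
Local Open Scope ring_scope.

Definition rV_display : measure_display -> measure_display.
Proof. exact. Qed.

Section rV_measurable.
Context {R : realType} {d : nat}.

Definition rV_coord (i : 'I_d) (v : 'rV[R]_d) : measurableTypeR R := v ord0 i.

Let rV_set0 : g_sigma_preimage rV_coord set0.
Proof. exact: sigma_algebra0. Qed.

Let rV_setC A : g_sigma_preimage rV_coord A -> g_sigma_preimage rV_coord (~` A).
Proof. exact: sigma_algebraC. Qed.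

Let rV_bigcup (F : _^nat) : (forall i, g_sigma_preimage rV_coord (F i)) ->
  g_sigma_preimage rV_coord (\bigcup_i (F i)).
Proof. exact: sigma_algebra_bigcup. Qed.

(* The product sigma-algebra; it coincides with the Borel sigma-algebra. *)
HB.instance Definition _ :=
  @isMeasurable.Build (rV_display default_measure_display)
  'rV[R]_d (g_sigma_preimage rV_coord) rV_set0 rV_setC rV_bigcup.

End rV_measurable.

Section rV_measurable_fun.
Context {R : realType} d (T : measurableType d).

Lemma measurable_fun_to_rV n (f : T -> 'rV[R]_n) :
  (forall i, measurable_fun setT (fun x => f x ord0 i : measurableTypeR R)) ->
  measurable_fun setT f.
Proof.
move=> mf; suff H : g_sigma_preimage (fun i => @rV_coord R n i \o f) `<=` measurable.
  by move=> _ A mA; apply: H; rewrite g_sigma_preimage_comp; exists A.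
apply: smallest_sub; first exact: sigma_algebra_measurable.
case: n => [|n] in f mf *; first by rewrite big_ord0.
rewrite -bigcup_mkord_ord; apply: bigcup_sub => i Ii.
by move=> A [B mB <-]; exact: (mf (inord i)).
Qed.

End rV_measurable_fun.

Lemma measurable_rV_coord {R : realType} n (i : 'I_n) :
  measurable_fun [set: 'rV[R]_n] (@rV_coord R n i).
Proof.
move=> _ Y mY; rewrite setTI; apply: sub_sigma_algebra => /=.
rewrite -bigcup_seq/=; exists i => /=; first by rewrite mem_index_enum.
by exists Y => //; rewrite setTI.
Qed.

Section lebesgue_rV.
Context {R : realType}.

Definition cons_rV n (p : measurableTypeR R * 'rV[R]_n) : 'rV[R]_n.+1 :=
  row_mx (\row_(_ < 1) p.1) p.2.

Definition uncons_rV n (v : 'rV[R]_n.+1) : measurableTypeR R * 'rV[R]_n :=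
  (v ord0 ord0, rsubmx (v : 'rV_(1 + n))).

Lemma cons_rVK n : cancel (@cons_rV n) (@uncons_rV n).
Proof.
move=> [x v]; rewrite /uncons_rV /cons_rV row_mxKr; congr pair.
by rewrite mxE; case: splitP => // j _; rewrite mxE.
Qed.

Lemma measurable_cons_rV n : measurable_fun setT (@cons_rV n).
Proof.
apply: measurable_fun_to_rV => i.
rewrite [X in measurable_fun _ X](_ : _ =
    fun p : measurableTypeR R * 'rV[R]_n =>
    match fintype.split (i : 'I_(1 + n)) with inl _ => p.1 | inr k => p.2 ord0 k end);
  last by apply/funext => p; rewrite mxE; case: fintype.split => // k; rewrite mxE.
case: (fintype.split _) => [_|k]; first exact: measurable_fst.
by apply: (measurableT_comp (measurable_rV_coord k)); exact: measurable_snd.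
Qed.

Lemma measurable_uncons_rV n : measurable_fun setT (@uncons_rV n).
Proof.
apply: measurable_fun_pair.
  exact: (@measurable_rV_coord R n.+1 ord0).
apply: measurable_fun_to_rV => i.
rewrite [X in measurable_fun _ X](_ : _ = @rV_coord R n.+1 (rshift 1 i));
  last by apply/funext => v; rewrite !mxE.
exact: measurable_rV_coord.
Qed.

Section step.
Variables (n : nat) (m : {sigma_finite_measure set 'rV[R]_n -> \bar R}).

Definition lebesgue_step : set 'rV[R]_n.+1 -> \bar R :=
  pushforward (lebesgue_measure \x m)%E (@cons_rV n).

Let step0 : lebesgue_step set0 = 0%E.
Proof. by rewrite /lebesgue_step /pushforward preimage_set0 measure0. Qed.

Let step_ge0 A : (0 <= lebesgue_step A)%E.
Proof. by rewrite /lebesgue_step /pushforward measure_ge0. Qed.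

Let step_sigma_additive : semi_sigma_additive lebesgue_step.
Proof.
move=> F mF tF mUF; rewrite /lebesgue_step /pushforward preimage_bigcup.
apply: measure_semi_sigma_additive.
- by move=> k; rewrite -[X in measurable X]setTI; exact: measurable_cons_rV.
- apply/trivIsetP => /= i j _ _ ij; rewrite -preimage_setI.
  by move/trivIsetP : tF => /(_ _ _ _ _ ij) ->//; rewrite preimage_set0.
- rewrite -preimage_bigcup -[X in measurable X]setTI.
  exact: measurable_cons_rV.
Qed.

HB.instance Definition _ := isMeasure.Build _ _ _ lebesgue_step
  step0 step_ge0 step_sigma_additive.

Let step_sigma_finite : sigma_finite setT lebesgue_step.
Proof.
have /sigma_finiteP[F [TF ndF Foo]] := sigma_finiteT
  (lebesgue_measure : {sigma_finite_measure set (measurableTypeR R) -> \bar R}).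
have /sigma_finiteP[G [TG ndG Goo]] := sigma_finiteT m.
have preE k : @cons_rV n @^-1` (@uncons_rV n @^-1` (F k `*` G k)) = F k `*` G k.
  by apply/funext => p; rewrite /preimage /mkset cons_rVK.
exists (fun k => @uncons_rV n @^-1` (F k `*` G k)).
  rewrite -preimage_bigcup (_ : \bigcup_k _ = setT) ?preimage_setT//.
  rewrite predeqE => -[x y]; split => // _.
  have [j _ Fj] : (\bigcup_i F i) x by rewrite -TF.
  have [k _ Gk] : (\bigcup_i G i) y by rewrite -TG.
  exists (maxn j k) => //; split => /=.
  - by move: x Fj; exact/subsetPset/ndF/leq_maxl.
  - by move: y Gk; exact/subsetPset/ndG/leq_maxr.
move=> k; have [mF Fk] := Foo k; have [mG Gk] := Goo k; split.
  rewrite -[X in measurable X]setTI; apply: measurable_uncons_rV => //.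
  exact: measurableX.
rewrite /lebesgue_step /pushforward preE product_measure1E//.
by rewrite lte_mul_pinfty// ge0_fin_numE.
Qed.

HB.instance Definition _ := Measure_isSigmaFinite.Build _ _ _ lebesgue_step
  step_sigma_finite.

End step.

(* d-dimensional Lebesgue measure, as the d-fold product of the one-dimensional
   one *)
Fixpoint lebesgue_rV (d : nat) : {sigma_finite_measure set 'rV[R]_d -> \bar R} :=
  match d with
  | 0 => \d_(0 : 'rV[R]_0)
  | n.+1 => lebesgue_step (lebesgue_rV n)
  end.

End lebesgue_rV.

Section euclidean.
Context {R : realType} {d : nat}.

Definition vdot (x y : 'rV[R]_d) : R := \sum_i x ord0 i * y ord0 i.

(* The Euclidean norm; the canonical norm of 'rV[R]_d is the sup norm, which
   has the same topology and the same bounded sets. *)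
Definition enorm (x : 'rV[R]_d) : R := Num.sqrt (vdot x x).

(* [B xi], where xi is a row vector standing for a column vector *)
Definition mxapp (B : 'M[R]_d) (xi : 'rV[R]_d) : 'rV[R]_d := xi *m B^T.

Definition ediam (A : set 'rV[R]_d) : \bar R :=
  ereal_sup [set (enorm (p.1 - p.2))%:E | p in A `*` A].

Definition hausdorff_weight (s : nat) (delta : R) (A : set 'rV[R]_d) : \bar R :=
  (if A == set0 then 0 else if ediam A <= delta%:E then ediam A ^+ s else +oo)%E.

(* The s-dimensional Hausdorff outer measure, without its normalising constant:
   below it only matters through its null sets and through convergence in L^2.
   The covers consist of Borel sets, which is not restrictive as a set and its
   closure have the same diameter. *)
Definition hausdorff (s : nat) (A : set 'rV[R]_d) : \bar R :=
  ereal_sup [set mu_ext (hausdorff_weight s delta) A |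
             delta in [set delta : R | 0 < delta]].

Let weight0 s delta : hausdorff_weight s delta set0 = 0%E.
Proof. by rewrite /hausdorff_weight eqxx. Qed.

Let weight_ge0 s delta A : (0 <= hausdorff_weight s delta A)%E.
Proof.
rewrite /hausdorff_weight; case: ifPn => // /set0P[x Ax].
case: ifPn => // _; apply: expe_ge0; apply: le_trans (_ : (enorm (x - x))%:E <= _)%E.
  by rewrite lee_fin sqrtr_ge0.
by apply: ereal_sup_ubound; exists (x, x).
Qed.

Let hausdorff0 s : hausdorff s set0 = 0%E.
Proof.
apply/eqP; rewrite eq_le; apply/andP; split.
  by apply: ge_ereal_sup => _ [e _ <-]; rewrite mu_ext0.
by apply: ereal_sup_ubound; exists 1 => //=; rewrite mu_ext0.
Qed.

Let hausdorff_ge0 s A : (0 <= hausdorff s A)%E.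
Proof.
apply: (@le_trans _ _ (mu_ext (hausdorff_weight s 1) A)); first exact: mu_ext_ge0.
by apply: ereal_sup_ubound; exists 1 => //=.
Qed.

Let le_hausdorff s : {homo hausdorff s : A B / A `<=` B >-> (A <= B)%E}.
Proof.
move=> A B AB; apply: ge_ereal_sup => _ [e e0 <-].
apply: (@le_trans _ _ (mu_ext (hausdorff_weight s e) B)); first exact: le_mu_ext.
by apply: ereal_sup_ubound; exists e.
Qed.

Let hausdorff_sigma_subadditive s : sigma_subadditive (hausdorff s).
Proof.
move=> F; apply: ge_ereal_sup => _ [e e0 <-].
apply: le_trans (mu_ext_sigma_subadditive (@weight_ge0 s e) F) _.
apply: lee_nneseries => [i _ _|i _]; first exact: mu_ext_ge0.
by apply: ereal_sup_ubound; exists e.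
Qed.

HB.instance Definition _ s := isOuterMeasure.Build R 'rV[R]_d (hausdorff s)
  (hausdorff0 s) (hausdorff_ge0 s) (@le_hausdorff s)
  (@hausdorff_sigma_subadditive s).

Definition surface_outer : {outer_measure set 'rV[R]_d -> \bar R} :=
  hausdorff d.-1.

(* The surface measure of hypersurfaces of R^d *)
Definition surface_measure :
    {measure set (caratheodory_type surface_outer) -> \bar R} :=
  surface_outer.

Definition partial (i : 'I_d) (f : 'rV[R]_d -> R) : 'rV[R]_d -> R :=
  fun x => 'D_(delta_mx ord0 i) f x.

(* C^infinity: all iterated partial derivatives are differentiable, hence
   continuous. *)
Definition smooth (f : 'rV[R]_d -> R) : Prop :=
  forall (s : seq 'I_d) (x : 'rV[R]_d), differentiable (foldr partial f s) x.

End euclidean.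

Section sobolev.
Context {R : realType} {d : nat}.
Implicit Types (Omega : set 'rV[R]_d) (u v w g phi : 'rV[R]_d -> R)
  (B : 'rV[R]_d -> 'M[R]_d) (l : ('rV[R]_d -> R) -> R).

Local Notation leb := (@lebesgue_rV R d).
Local Notation surf := (@surface_measure R d).

Definition bd Omega : set 'rV[R]_d := closure Omega `\` interior Omega.

(* Near each boundary point Omega is, in a suitable direction nu, the strict
   epigraph of a Lipschitz function of the component orthogonal to nu. *)
Definition lipschitz_boundary Omega : Prop :=
  forall x0, bd Omega x0 ->
  exists (nu : 'rV[R]_d) (gamma : 'rV[R]_d -> R) (r k : R),
  [/\ enorm nu = 1, 0 < r,
      forall y z, `|gamma y - gamma z| <= k * enorm (y - z) &
      forall x, enorm (x - x0) < r ->
        (Omega x <-> gamma (x - vdot x nu *: nu) < vdot x nu)].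

Definition test_function Omega (z : 'rV[R]_d -> R) : Prop :=
  smooth z /\
  exists K, [/\ compact K, K `<=` Omega & forall x, ~ K x -> z x = 0].

Definition L2 Omega u : Prop :=
  measurable_fun Omega u /\ leb.-integrable Omega (fun x => (u x ^+ 2)%:E).

(* Elements of function spaces are represented by Borel functions on R^d of
   which only the restriction to Omega matters; the notions below do not
   distinguish Borel functions that are equal almost everywhere in Omega. *)
Definition is_weak_gradient Omega u (G : 'rV[R]_d -> 'rV[R]_d) : Prop :=
  (forall i, L2 Omega (fun x => G x ord0 i)) /\
  forall (i : 'I_d) z, test_function Omega z ->
    \int[leb]_(x in Omega) (u x * partial i z x) =
    - \int[leb]_(x in Omega) (G x ord0 i * z x).

Definition H1 Omega : set ('rV[R]_d -> R) :=
  [set u | L2 Omega u /\ exists G, is_weak_gradient Omega u G].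

(* The weak gradient of an element of H1 (unique almost everywhere) *)
Definition wgrad Omega u : 'rV[R]_d -> 'rV[R]_d :=
  xget (fun=> 0) [set G | is_weak_gradient Omega u G].

Definition H1norm Omega u : R :=
  Num.sqrt (\int[leb]_(x in Omega) (u x ^+ 2) +
            \int[leb]_(x in Omega) (enorm (wgrad Omega u x) ^+ 2)).

(* H^1_0, the closure of the test functions in H1 *)
Definition H10 Omega : set ('rV[R]_d -> R) :=
  [set v | H1 Omega v /\ forall e : R, 0 < e ->
     exists z, test_function Omega z /\ H1norm Omega (v \- z) < e].

(* l is a bounded linear functional on the subspace V of H1. *)
Definition bounded_functional Omega (V : set ('rV[R]_d -> R)) l : Prop :=
  (forall (a : R) u v, V u -> V v -> l (a \*o u \+ v) = a * l u + l v) /\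
  exists C : R, forall u, V u -> `|l u| <= C * H1norm Omega u.

(* H^{-1}, the dual of H^1_0 *)
Definition Hm1 Omega : set (('rV[R]_d -> R) -> R) :=
  [set l | bounded_functional Omega (H10 Omega) l].

(* The graph of the trace operator on H1, the closure (in H^1 x L^2 of the
   boundary) of the restriction of functions smooth up to the boundary.  Values
   of g outside of the boundary are irrelevant.  For a bounded Lipschitz domain
   every u has a trace, unique up to null sets of the boundary, and u has trace
   0 iff it is in H^1_0. *)
Definition is_trace Omega u g : Prop :=
  [/\ H1 Omega u,
      measurable_fun (bd Omega : set (caratheodory_type (@surface_outer R d))) g &
      exists w : nat -> 'rV[R]_d -> R,
      [/\ forall n, smooth (w n),
          H1norm Omega (u \- w n) @[n --> \oo] --> (0 : R) &
          (\int[surf]_(x in bd Omega) ((w n x - g x) ^+ 2)%:E)%E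
            @[n --> \oo] --> (0 : \bar R)%E]].

(* H^{1/2} of the boundary, the range of the trace operator *)
Definition Hhalf Omega : set ('rV[R]_d -> R) :=
  [set g | exists u, is_trace Omega u g].

(* The essential support of a function on the boundary *)
Definition bsupp Omega phi : set 'rV[R]_d :=
  [set x | bd Omega x /\ forall U, nbhs x U ->
     hausdorff d.-1 (bd Omega `&` U `&` [set y | phi y != 0]) <> 0%E].

(* M(alpha, beta, Omega); essential boundedness follows from the upper bound. *)
Definition coef_class (alpha beta : R) Omega : set ('rV[R]_d -> 'M[R]_d) :=
  [set B : 'rV[R]_d -> 'M[R]_d |
    (forall i j, measurable_fun Omega (fun x => B x i j)) /\
    {ae leb, forall x, Omega x ->
      (B x)^T = B x /\
      forall xi : 'rV[R]_d,
        alpha * enorm xi ^+ 2 <= vdot (mxapp (B x) xi) xi /\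
        enorm (mxapp (B x) xi) <= beta * enorm xi}].

Definition energy Omega B u v : R :=
  \int[leb]_(x in Omega)
    vdot (mxapp (B x) (wgrad Omega u x)) (wgrad Omega v x).

(* u is a weak solution of - div (B grad u) = f in Omega with trace g. *)
Definition weak_solution Omega B l g u : Prop :=
  is_trace Omega u g /\ forall v, H10 Omega v -> energy Omega B u v = l v.

Definition H1_weak_cvg Omega (u : R -> 'rV[R]_d -> R) u0 : Prop :=
  forall l, bounded_functional Omega (H1 Omega) l ->
    l (u eps) @[eps --> 0^'+] --> l u0.

Definition G_cvg Omega (A : R -> 'rV[R]_d -> 'M[R]_d)
    (A0 : 'rV[R]_d -> 'M[R]_d) : Prop :=
  forall (f : ('rV[R]_d -> R) -> R) g, Hm1 Omega f -> Hhalf Omega g ->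
  forall (u : R -> 'rV[R]_d -> R) u0,
    (forall eps, 0 < eps -> weak_solution Omega (A eps) f g (u eps)) ->
    weak_solution Omega A0 f g u0 ->
    H1_weak_cvg Omega u u0.

(* The weak solution of - div (B grad u) = 0 with trace g, and a lifting of phi
   to H1.  Both exist, and the former is unique as an element of H1, when B is
   in some M(alpha, beta, Omega) and g, phi are in Hhalf Omega. *)
Definition dirichlet_solution Omega B g : 'rV[R]_d -> R :=
  xget (fun=> 0) [set u | weak_solution Omega B (fun=> 0) g u].

Definition lifting Omega phi : 'rV[R]_d -> R :=
  xget (fun=> 0) [set w | is_trace Omega w phi].

(* The Dirichlet-to-Neumann map: [dtn Omega B g] is the conormal derivative
   B grad u . nu as an element of H^{-1/2}, i.e., as a functional on H^{1/2}.
   Its value at phi does not depend on the lifting of phi, two liftings being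
   equal modulo H^1_0. *)
Definition dtn Omega B g : ('rV[R]_d -> R) -> R :=
  fun phi => energy Omega B (dirichlet_solution Omega B g) (lifting Omega phi).

End sobolev.

Section weighted_norm.
Context {R : realType} {n : nat}.

Definition pos_def (C : 'M[R]_n) : Prop :=
  forall v : 'rV[R]_n, v != 0 -> 0 < (v *m C *m v^T) ord0 ord0.

(* v is a row vector, so that v C^-1 v^T is the quadratic form of C^-1 at v. *)
Definition weighted_norm (C : 'M[R]_n) (v : 'rV[R]_n) : R :=
  Num.sqrt ((v *m invmx C *m v^T) ord0 ord0).

End weighted_norm.

(* Main.v *)
Require Import Defs.
From mathcomp Require Import all_boot all_order all_algebra.
From mathcomp Require Import all_classical all_reals all_analysis.
From mathcomp Require Import measurable_realfun ring lra.

Set Implicit Arguments.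
Unset Strict Implicit.
Unset Printing Implicit Defensive.

Import Order.TTheory GRing.Theory Num.Theory.
Import numFieldNormedType.Exports.

Local Open Scope classical_set_scope.
Local Open Scope ring_scope.

(** For families u^eps, u^0 of solutions with the same data, the flux defect
    p_eps = A^eps grad u^eps - A^0 grad u^0 has div p_eps = 0 and is bounded in
    L^2, and <(Lambda_eps - Lambda_0) g, phi> is the integral of p_eps . grad W
    for one fixed lifting W of phi.  So it suffices that p_eps converges weakly
    to 0 in L^2.

    If v^eps is another such family, the div-curl lemma (Rellich's theorem
    applied to psi (v^eps - v^0)) and the symmetry of A^eps show that the
    trilinear quantity T(psi; u, v) = int psi p^u_eps . grad v^0 is symmetric in
    u and v up to a vanishing error.  A test function b is the limit v^0 of the
    solutions with right-hand side - div (A^0 grad b).  On test functions,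
    div p_eps = 0 gives T(a; b, c) = - T(c; b, a), and a form that is symmetric
    in one pair of arguments and antisymmetric in another one is zero; hence
    T(a; b, c) -> 0.  By density and symmetry T(a; u, c) -> 0 for every family u
    and all test functions a, c, and the fields a grad c span all the products
    chi a e_i. *)

(** * Square-integrable functions *)

(** G-convergence speaks of solutions only, while the flux is a product of two factors that converge
    weakly at best, so that its limit cannot be read off from the definition. A usual remedy
    extracts a subsequence of fluxes and identifies its limit; here everything stays along the
    filter [0^'+]. Two tools allow this: uniform boundedness yields the H^1 bounds, and Rellich's
    theorem is an inequality, the squared L^2 norm being at most finitely many squared coefficients
    plus [eta] times the squared gradient, which turns weak into strong convergence at once.
    Although the Dirichlet-to-Neumann map only involves f = 0, G-convergence is used for general
    right-hand sides: this makes every test function the limit of a family of solutions. All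
    products are localised by test functions, so that Rellich's inequality is applied in H^1_0. The
    vanishing of T(a; b, c) is algebra: the product of two distinct transpositions of three letters
    has order 3, so applying both alternately, three times each, leads back to T(a; b, c) with the
    sign (-1)^3. *)

Section square_integrable.
Context d (T : measurableType d) (R : realType).
Variables (mu : {measure set T -> \bar R}) (D : set T).
Hypothesis mD : measurable D.
Implicit Types f g h : T -> R.

(** For the Lebesgue measure on R^d this is convertible to [L2], so that facts about [H1] and
    [is_weak_gradient] are read as facts about [sqint] without translation. *)
Definition sqint f : Prop :=
  measurable_fun D f /\ mu.-integrable D (fun x => (f x ^+ 2)%:E).

Definition l2dot f g : R := \int[mu]_(x in D) (f x * g x).

Local Notation ip := l2dot.

Lemma integrable_le f g : measurable_fun D f ->
  (forall x, D x -> `|f x| <= g x) ->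
  mu.-integrable D (EFin \o g) -> mu.-integrable D (EFin \o f).
Proof.
move=> mf fg ig; apply: le_integrable ig => //; first exact/measurable_EFinP.
by move=> x Dx /=; rewrite lee_fin (le_trans (fg x Dx)) // ler_norm.
Qed.

Lemma integrable_add f g : mu.-integrable D (EFin \o f) ->
  mu.-integrable D (EFin \o g) -> mu.-integrable D (EFin \o (fun x => f x + g x)).
Proof. by move=> i j; exact: (integrableD mD i j). Qed.

Lemma integrable_scale k f : mu.-integrable D (EFin \o f) ->
  mu.-integrable D (EFin \o (fun x => k * f x)).
Proof. by move=> i; exact: (integrableZl mD k i). Qed.

Lemma sqint_mul f g : sqint f -> sqint g ->
  mu.-integrable D (EFin \o (fun x => f x * g x)).
Proof.
move=> [mf f2] [mg g2].
apply: (@integrable_le _ (fun x => f x ^+ 2 + g x ^+ 2)).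
- exact: measurable_funM.
- move=> x _; rewrite ler_norml; apply/andP; split;
  have := sqr_ge0 (f x - g x); have := sqr_ge0 (f x + g x); nra.
- exact: integrable_add.
Qed.

Lemma sqint_lin a b f g : sqint f -> sqint g -> sqint (fun x => a * f x + b * g x).
Proof.
move=> sf sg; have [mf f2] := sf; have [mg g2] := sg.
have m : measurable_fun D (fun x => a * f x + b * g x).
  by apply: measurable_funD; apply: measurable_funM.
split => //.
apply: (@integrable_le _ (fun x => (2 * a ^+ 2) * f x ^+ 2 + (2 * b ^+ 2) * g x ^+ 2)).
- exact: measurable_funX.
- move=> x _; rewrite ger0_norm ?sqr_ge0//.
  have := sqr_ge0 (a * f x - b * g x); nra.
- by apply: integrable_add; apply: integrable_scale.
Qed.

Lemma eq_sqint f g : f =1 g -> sqint f -> sqint g.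
Proof. by move=> /funext ->. Qed.

Lemma sqintD f g : sqint f -> sqint g -> sqint (fun x => f x + g x).
Proof.
by move=> sf sg; apply: eq_sqint (sqint_lin 1 1 sf sg) => x; rewrite !mul1r.
Qed.

Lemma sqintB f g : sqint f -> sqint g -> sqint (fun x => f x - g x).
Proof.
by move=> sf sg; apply: eq_sqint (sqint_lin 1 (-1) sf sg) => x; rewrite mul1r mulN1r.
Qed.

Lemma sqint0 : sqint (fun=> 0).
Proof.
split; first exact: measurable_cst.
rewrite (_ : (fun _ => _) = cst 0%E); first exact: integrable0.
by apply/funext => x; rewrite expr0n.
Qed.

Lemma sqintZ a f : sqint f -> sqint (fun x => a * f x).
Proof.
by move=> sf; apply: eq_sqint (sqint_lin a 0 sf sqint0) => x; rewrite mulr0 addr0.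
Qed.

Lemma sqint_dom f g : measurable_fun D f -> (forall x, D x -> `|f x| <= `|g x|) ->
  sqint g -> sqint f.
Proof.
move=> mf fg [mg g2]; split => //.
apply: (@integrable_le _ (fun x => g x ^+ 2)) => //.
- exact: measurable_funX.
- move=> x Dx; rewrite ger0_norm ?sqr_ge0// -[leLHS]real_normK ?num_real//.
  by rewrite -[leRHS]real_normK ?num_real// lerXn2r ?nnegrE// fg.
Qed.

Lemma sqint_bounded_mul K f h : measurable_fun D h ->
  (forall x, D x -> `|h x| <= K) -> sqint f -> sqint (fun x => h x * f x).
Proof.
move=> mh hK sf; apply: (@sqint_dom _ (fun x => K * f x)).
- by apply: measurable_funM => //; case: sf.
- move=> x Dx; rewrite !normrM ler_wpM2r// (le_trans (hK x Dx))// ler_norm//.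
- exact: sqintZ.
Qed.

Lemma ipC f g : ip f g = ip g f.
Proof. by rewrite /ip; under eq_Rintegral do rewrite mulrC. Qed.

Lemma ip_linl a b f g h : sqint f -> sqint g -> sqint h ->
  ip (fun x => a * f x + b * g x) h = a * ip f h + b * ip g h.
Proof.
move=> sf sg sh; rewrite /ip.
under eq_Rintegral do rewrite mulrDl -!mulrA.
rewrite RintegralD//; [|exact/integrable_scale/sqint_mul..].
by rewrite !RintegralZl//; exact: sqint_mul.
Qed.

Lemma ip_linr a b f g h : sqint f -> sqint g -> sqint h ->
  ip h (fun x => a * f x + b * g x) = a * ip h f + b * ip h g.
Proof. by move=> sf sg sh; rewrite ipC ip_linl// !(ipC h). Qed.

Lemma eq_ip f f' g g' : f =1 f' -> g =1 g' -> ip f g = ip f' g'.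
Proof. by move=> /funext -> /funext ->. Qed.

Lemma ip0l h : ip (fun=> 0) h = 0.
Proof.
rewrite /ip; under eq_Rintegral do rewrite mul0r.
by rewrite /Rintegral integral0.
Qed.

Lemma ipDl f g h : sqint f -> sqint g -> sqint h ->
  ip (fun x => f x + g x) h = ip f h + ip g h.
Proof.
move=> sf sg sh; have := ip_linl 1 1 sf sg sh; rewrite !mul1r => <-.
by apply: eq_ip => // x; rewrite !mul1r.
Qed.

Lemma ipBl f g h : sqint f -> sqint g -> sqint h ->
  ip (fun x => f x - g x) h = ip f h - ip g h.
Proof.
move=> sf sg sh; have := ip_linl 1 (-1) sf sg sh; rewrite mul1r mulN1r => <-.
by apply: eq_ip => // x; rewrite mul1r mulN1r.
Qed.

Lemma ipZl a f h : sqint f -> sqint h -> ip (fun x => a * f x) h = a * ip f h.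
Proof.
move=> sf sh; have := ip_linl a 0 sf sqint0 sh; rewrite ip0l mulr0 addr0 => <-.
by apply: eq_ip => // x; ring.
Qed.

Lemma ipDr f g h : sqint f -> sqint g -> sqint h ->
  ip h (fun x => f x + g x) = ip h f + ip h g.
Proof. by move=> sf sg sh; rewrite ipC ipDl// !(ipC h). Qed.

Lemma ipBr f g h : sqint f -> sqint g -> sqint h ->
  ip h (fun x => f x - g x) = ip h f - ip h g.
Proof. by move=> sf sg sh; rewrite ipC ipBl// !(ipC h). Qed.

Lemma ipZr a f h : sqint f -> sqint h -> ip h (fun x => a * f x) = a * ip h f.
Proof. by move=> sf sh; rewrite ipC ipZl// !(ipC h). Qed.

Lemma ip_ge0 f : 0 <= ip f f.
Proof. by apply: Rintegral_ge0 => x _; rewrite -expr2 sqr_ge0. Qed.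

Lemma ipE f : ip f f = \int[mu]_(x in D) (f x ^+ 2).
Proof. by rewrite /ip; under eq_Rintegral do rewrite -expr2. Qed.

Lemma ipEFin f : sqint f -> ((ip f f)%:E = \int[mu]_(x in D) (f x ^+ 2)%:E)%E.
Proof.
move=> [mf f2]; rewrite ipE /Rintegral fineK//; exact: integrable_fin_num.
Qed.

Lemma le_ip f g : sqint f -> sqint g ->
  (forall x, D x -> f x ^+ 2 <= g x ^+ 2) -> ip f f <= ip g g.
Proof.
by move=> [mf f2] [mg g2] fg; rewrite !ipE; apply: le_Rintegral.
Qed.

End square_integrable.

(** The common core of the Cauchy-Schwarz inequalities for [ip], for [vip] and for the form of
    [riesz], and of the estimate of the first variation in [riesz]. *)
Lemma discriminant_le (R : realType) (p q r : R) : 0 <= p -> 0 <= q ->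
  (forall t, 0 <= p + 2 * t * r + t ^+ 2 * q) -> r ^+ 2 <= p * q.
Proof.
move=> p0 q0 H; have [q00|q_neq0] := eqVneq q 0.
  suff -> : r = 0 by rewrite expr0n/= q00 mulr0.
  apply/eqP/negP => /negP r0.
  (* If q = 0, the affine function of t takes the value -1 at this point. *)
  have := H (- (p + 1) / (2 * r)); rewrite q00 mulr0 addr0.
  suff -> : p + 2 * (- (p + 1) / (2 * r)) * r = -1 by lra.
  by field.
have qgt0 : 0 < q by rewrite lt_def q_neq0.
have := H (- r / q).
have -> : p + 2 * (- r / q) * r + (- r / q) ^+ 2 * q = p - r ^+ 2 / q.
  by field; rewrite gt_eqF.
by rewrite subr_ge0 ler_pdivrMr.
Qed.

Section square_integrable2.
Context d (T : measurableType d) (R : realType).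
Variables (mu : {measure set T -> \bar R}) (D : set T).
Hypothesis mD : measurable D.
Implicit Types f g h : T -> R.
Local Notation sqint := (sqint mu D).
Local Notation ip := (l2dot mu D).

Lemma ip_expand a b f g : sqint f -> sqint g ->
  ip (fun x => a * f x + b * g x) (fun x => a * f x + b * g x) =
  a ^+ 2 * ip f f + 2 * a * b * ip f g + b ^+ 2 * ip g g.
Proof.
move=> sf sg; have s := sqint_lin mD a b sf sg.
rewrite ip_linl// !ip_linr//.
by rewrite (ipC _ _ g f); ring.
Qed.

Lemma cauchy_schwarz f g : sqint f -> sqint g -> ip f g ^+ 2 <= ip f f * ip g g.
Proof.
move=> sf sg; apply: discriminant_le; [exact: ip_ge0..|] => t.
have := ip_ge0 mu D (fun x => 1 * f x + t * g x); rewrite ip_expand// expr1n mul1r.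
by rewrite mulr1.
Qed.

Lemma ip_eq0 f g : sqint f -> sqint g -> ip f f = 0 -> ip f g = 0.
Proof.
move=> sf sg f0; have := cauchy_schwarz sf sg; rewrite f0 mul0r => H.
by apply/eqP; rewrite -sqrf_eq0 eq_le H sqr_ge0.
Qed.

Lemma norm_ip f g : sqint f -> sqint g ->
  `|ip f g| <= Num.sqrt (ip f f) * Num.sqrt (ip g g).
Proof.
move=> sf sg; rewrite -sqrtrM ?ip_ge0// -sqrtr_sqr.
by rewrite ler_wsqrtr// cauchy_schwarz.
Qed.

(** By the parallelogram identity. It serves as a triangle inequality for squared distances; its
    factor 2 is the reason for tolerances such as e / 4 later on. *)
Lemma ip_sub_le f g h : sqint f -> sqint g -> sqint h ->
  ip (fun x => f x - h x) (fun x => f x - h x) <=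
  2 * ip (fun x => f x - g x) (fun x => f x - g x) +
  2 * ip (fun x => g x - h x) (fun x => g x - h x).
Proof.
move=> sf sg sh.
have sfg := sqintB mD sf sg; have sgh := sqintB mD sg sh.
have -> : ip (fun x => f x - h x) (fun x => f x - h x) =
   ip (fun x => 1 * (f x - g x) + 1 * (g x - h x))
      (fun x => 1 * (f x - g x) + 1 * (g x - h x)).
  by apply: eq_ip => x; rewrite !mul1r; ring.
have := ip_ge0 mu D (fun x => 1 * (f x - g x) + (-1) * (g x - h x)).
rewrite !ip_expand//.
have := ip_ge0 mu D (fun x => f x - g x); lra.
Qed.

End square_integrable2.

(** * Completeness of L^2, minimisation of quadratic functionals, uniform boundedness *)

Section fast.
Variable R : realType.

Lemma fast_cvg (u : nat -> R) (c : R) :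
  (forall k, `|u k.+1 - u k| <= c * 2^-1 ^+ k) ->
  exists l, forall n, `|u n - l| <= 2 * c * 2^-1 ^+ n.
Proof.
move=> uc.
have c0 : 0 <= c by have := le_trans (normr_ge0 _) (uc 0); rewrite expr0 mulr1.
have half0 k : 0 <= 2^-1 ^+ k :> R by rewrite exprn_ge0.
(* The bound is the exact partial sum of the geometric series rather than its total, which lets the
   induction on [m] close. *)
have step n m : `|u n - u (n + m)%N| <= 2 * c * (2^-1 ^+ n - 2^-1 ^+ (n + m)).
  elim: m => [|m IH]; first by rewrite addn0 !subrr normr0 mulr0.
  rewrite addnS; apply: le_trans (ler_distD (u (n + m)%N) _ _) _.
  have := uc (n + m)%N; rewrite (distrC (u (n + m).+1)) exprS; lra.
have bnd n m : `|u n - u (n + m)%N| <= 2 * c * 2^-1 ^+ n.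
  apply: le_trans (step n m) _.
  by rewrite ler_wpM2l// ?mulr_ge0// gerDl oppr_le0.
have geo : (2 * c * 2^-1 ^+ n) @[n --> \oo] --> (0 : R).
  by apply: cvg_geometric; rewrite ger0_norm//; lra.
have cu : cvgn u.
  apply/cauchy_cvgP/cauchy_exP => e e0.
  have /cvgr0Pnorm_lt/(_ e e0) [N _ NP] := geo.
  exists (u N); exists N => //= n /= Nn.
  rewrite /ball /= -(subnKC Nn); apply: le_lt_trans (bnd _ _) _.
  by have := NP N (leqnn N); apply: le_lt_trans; exact: ler_norm.
exists (limn u) => n.
have : (fun m => `|u n - u m|) @ \oo --> `|u n - limn u|.
  by apply: cvg_norm; apply: cvgB; [exact: cvg_cst|].
move=> /cvgr_to_le; apply; near=> m.
have nm : (n <= m)%N by near: m; exists n.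
by rewrite -(subnKC nm); exact: bnd.
Unshelve. all: by end_near. Qed.

End fast.

Section completeness.
Context d (T : measurableType d) (R : realType).
Variables (mu : {measure set T -> \bar R}) (D : set T).
Hypothesis mD : measurable D.
Local Notation sqint := (sqint mu D).
Local Notation ip := (l2dot mu D).
Local Notation dist f g := (ip (fun x => f x - g x) (fun x => f x - g x)).

(* The sum S of the series of 4^k (g_(k+1) - g_k)^2 is integrable, and
   |g_k - l| <= 2^(1-k) sqrt S almost everywhere. *)
Lemma sqint_fast_complete (g : nat -> T -> R) : (forall n, sqint (g n)) ->
  (forall n, dist (g n.+1) (g n) <= 16^-1 ^+ n) ->
  exists l, sqint l /\ forall e : R, 0 < e -> exists N, forall n, (N <= n)%N -> dist (g n) l <= e.
Proof.
move=> sg fastg.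
have q0 k : 0 <= 4^-1 ^+ k :> R by rewrite exprn_ge0.
have p0 k : 0 <= 4 ^+ k :> R by rewrite exprn_ge0.
(* The decay 16^-k is split: 4^k 16^-k = 4^-k is still summable, and dividing by the weight 4^k
   leaves a pointwise rate 2^-k for the increments. *)
pose F k x := (4 ^+ k * (g k.+1 x - g k x) ^+ 2)%:E.
have F0 k x : (0 <= F k x)%E by rewrite lee_fin mulr_ge0 ?sqr_ge0.
have sgg k := sqintB mD (sg k.+1) (sg k).
have mF k : measurable_fun D (F k).
  apply/measurable_EFinP/measurable_funM => //.
  by apply: measurable_funX; case: (sgg k).
pose S x := (\sum_(k <oo) F k x)%E.
have S0 x : (0 <= S x)%E by apply: nneseries_ge0.
have mS : measurable_fun D S by apply: ge0_emeasurable_sum.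
have FS k x : (F k x <= S x)%E.
  have /= := @nneseries_lim_ge R (F ^~ x) xpredT 0%N k.+1 (fun k _ _ => F0 k x).
  by apply: le_trans; rewrite big_nat_recr//= leeDr// sume_ge0.
have iS : mu.-integrable D S.
  apply/integrableP; split => //.
  under eq_integral do rewrite gee0_abs//.
  rewrite integral_nneseries//.
  apply: (@le_lt_trans _ _ (\sum_(k <oo) (4^-1 ^+ k)%:E)%E).
    apply: lee_nneseries => k _ => [_|]; first exact: integral_ge0.
    rewrite /F; under eq_integral do rewrite EFinM.
    rewrite ge0_integralZl//; last 2 first.
    - by apply/measurable_EFinP/measurable_funX; case: (sgg k).
    - by move=> x _; rewrite lee_fin sqr_ge0.
    rewrite -(ipEFin mD (sgg k)) -EFinM lee_fin.
    apply: (@le_trans _ _ (4 ^+ k * 16^-1 ^+ k)); first by rewrite ler_wpM2l.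
    by rewrite -exprMn (_ : 4 * 16^-1 = 4^-1 :> R)//; field.
  rewrite (_ : \big[_/_]_(_ <= _ <oo | _) _ = (4 / 3)%:E)%E ?ltry//.
  apply/cvg_lim => //.
  rewrite (_ : (fun n => _) = EFin \o series (geometric 1 4^-1)); last first.
    apply/funext => n /=; rewrite /series/= -sumEFin.
    by apply: eq_bigr => i _; rewrite mul1r.
  apply: cvg_EFin; first exact: nearW.
  rewrite (_ : 4 / 3 = 1 * (1 - 4^-1)^-1 :> R); last by field.
  by apply: cvg_geometric_series; rewrite ger0_norm//; lra.
have ratio x k : S x \is a fin_num ->
    `|g k.+1 x - g k x| <= Num.sqrt (fine (S x)) * 2^-1 ^+ k.
  move=> Sx; have := FS k x; rewrite -[leRHS](fineK Sx) lee_fin => H.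
  have -> : 2^-1 ^+ k = Num.sqrt (4^-1 ^+ k) :> R.
    rewrite (_ : 4^-1 = 2^-1 ^+ 2 :> R); last by field.
    by rewrite -exprM mulnC exprM sqrtr_sqr ger0_norm// exprn_ge0.
  rewrite -sqrtr_sqr -sqrtrM ?fine_ge0//; apply: ler_wsqrtr => //=.
  apply: (@le_trans _ _ (4 ^+ k * (g k.+1 x - g k x) ^+ 2 * 4^-1 ^+ k)).
    by rewrite mulrAC -exprMn divff// expr1n mul1r.
  by rewrite ler_wpM2r.
(* Where [S] is infinite, which is a null set in [D], the limit is set to [g 0%N x]; thus on all of
   [D] the function [l] is a pointwise limit of measurable functions, the [h k] below. *)
have lim_ex x : exists l, (S x \is a fin_num ->
     forall n, `|g n x - l| <= 2 * Num.sqrt (fine (S x)) * 2^-1 ^+ n) /\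
     (S x \isn't a fin_num -> l = g 0%N x).
  case: (boolP (S x \is a fin_num)) => Sx; last by exists (g 0%N x).
  have [l Hl] := fast_cvg (fun k => ratio x k Sx).
  by exists l.
have [l Hl] := choice lim_ex.
have Hl2 x n : S x \is a fin_num ->
    (g n x - l x) ^+ 2 <= 4 * fine (S x) * 4^-1 ^+ n.
  move=> Sx; have [/(_ Sx n) H _] := Hl x.
  rewrite -real_normK ?num_real//.
  apply: le_trans (_ : (2 * Num.sqrt (fine (S x)) * 2^-1 ^+ n) ^+ 2 <= _).
    by rewrite lerXn2r ?nnegrE// !mulr_ge0 ?sqrtr_ge0 ?exprn_ge0.
  rewrite !exprMn sqr_sqrtr ?fine_ge0//.
  rewrite -exprM mulnC exprM (_ : 2^-1 ^+ 2 = 4^-1 :> R); last by field.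
  by rewrite (_ : 2 ^+ 2 = 4 :> R)//; ring.
pose s x := fine (S x).
have mfin : measurable_fun D (fun x => S x < +oo)%E.
  by apply: measurable_fun_lte.
have ml : measurable_fun D l.
  pose h k x := if (S x < +oo)%E then g k x else g 0%N x.
  apply: (@measurable_fun_cvg _ _ _ _ h).
    move=> k; apply: (measurable_fun_if mD mfin).
      by apply: measurable_funS (sg k).1 => // x [].
    by apply: measurable_funS (sg 0%N).1 => // x [].
  move=> x Dx; rewrite /h; case: (boolP (S x < +oo)%E) => Sx.
    have {}Sx : S x \is a fin_num by rewrite ge0_fin_numE.
    have geo : (2 * Num.sqrt (s x) * 2^-1 ^+ n) @[n --> \oo] --> (0 : R).
  by apply: cvg_geometric; rewrite ger0_norm//; lra.
    apply/subr_cvg0/cvgr0Pnorm_lt => e e0.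
    move/cvgr0Pnorm_lt : geo => /(_ e e0); apply: filterS => n.
    by apply: le_lt_trans; apply: le_trans ((Hl x).1 Sx n) _; rewrite ler_norm.
  rewrite ((Hl x).2 _); first exact: cvg_cst.
  by rewrite ge0_fin_numE.
have is_ : mu.-integrable D (EFin \o s).
  have ms : measurable_fun D s by apply: measurableT_comp.
  apply: le_integrable iS => //; first exact/measurable_EFinP.
  move=> x Dx /=; rewrite gee0_abs// ger0_norm ?fine_ge0//.
  by rewrite /s; case: (S x) (S0 x) => //= r r0; rewrite leey.
(* [l] is reached through its difference with [g 0%N], whose square is at most 4 S by [Hl2] at n =
   0. *)
have sd0 : sqint (fun x => g 0%N x - l x).
  split; first by apply: measurable_funB => //; case: (sg 0%N).
  apply: (@integrable_le _ _ _ _ _ mD _ (fun x => 4 * s x)).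
  - by apply: measurable_funX; apply: measurable_funB => //; case: (sg 0%N).
  - move=> x Dx; rewrite ger0_norm ?sqr_ge0//.
    case: (boolP (S x \is a fin_num)) => Sx.
      by have := Hl2 x 0%N Sx; rewrite expr0 mulr1.
    by rewrite ((Hl x).2 Sx) subrr expr0n/= mulr_ge0// fine_ge0.
  - exact: integrable_scale.
have sl : sqint l.
  by apply: eq_sqint (sqintB mD (sg 0%N) sd0) => x; ring.
exists l; split => //.
have bnd n : dist (g n) l <= 4 * (\int[mu]_(x in D) s x) * 4^-1 ^+ n.
  have sn := sqintB mD (sg n) sl.
  rewrite -lee_fin ipEFin//.
  have -> : 4 * (\int[mu]_(x in D) s x) * 4^-1 ^+ n =
      \int[mu]_(x in D) (4 * 4^-1 ^+ n * s x).
    by rewrite RintegralZl//; ring.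
  rewrite {1}/Rintegral fineK; last first.
    by apply: integrable_fin_num => //; exact: integrable_scale.
  apply: ae_ge0_le_integral => //.
  - by move=> x _; rewrite lee_fin sqr_ge0.
  - by apply/measurable_EFinP/measurable_funX; case: sn.
  - by move=> x _; rewrite lee_fin !mulr_ge0// fine_ge0.
  - apply/measurable_EFinP/measurable_funM => //.
    by apply: measurableT_comp.
  have := integrable_ae mD iS; apply: filterS => x H Dx.
  by rewrite lee_fin mulrAC; exact: Hl2 (H Dx).
have geo : (4 * (\int[mu]_(x in D) s x) * 4^-1 ^+ n) @[n --> \oo] --> (0 : R).
  by apply: cvg_geometric; rewrite ger0_norm//; lra.
move=> e e0; have /cvgr0Pnorm_lt/(_ e e0) [N _ NP] := geo.
exists N => n /NP H; apply: le_trans (bnd n) _; apply: le_trans (ler_norm _) _; exact: ltW.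
Qed.

Lemma sqint_complete (f : nat -> T -> R) : (forall n, sqint (f n)) ->
  (forall e : R, 0 < e -> exists N, forall m n, (N <= m)%N -> (N <= n)%N ->
     dist (f m) (f n) <= e) ->
  exists l, sqint l /\ forall e : R, 0 < e -> exists N, forall n, (N <= n)%N -> dist (f n) l <= e.
Proof.
move=> sf cf.
have /choice[N HN] (k : nat) : exists N, forall m n, (N <= m)%N -> (N <= n)%N ->
    dist (f m) (f n) <= 16^-1 ^+ k.
  by apply: cf; rewrite exprn_gt0.
(* Summing the thresholds gives indices that dominate [N k], are nondecreasing and are at least
   [k]. *)
pose idx k := (\sum_(i < k.+1) (N i).+1)%N.
have Nidx k : (N k <= idx k)%N by rewrite /idx big_ord_recr/= (leq_trans (leqnSn _))// leq_addl.
have idxS k : (idx k <= idx k.+1)%N by rewrite /idx [leqRHS]big_ord_recr leq_addr.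
have [|l [sl Hl]] := @sqint_fast_complete (fun k => f (idx k)) (fun k => sf _).
  by move=> k; apply: HN => //; exact: leq_trans (idxS k).
exists l; split => // e e0.
have e4 : 0 < e / 4 by rewrite divr_gt0.
have [N1 HN1] := cf _ e4; have [N2 HN2] := Hl _ e4.
have idx_ge k : (k <= idx k)%N.
  elim: k => // k IH; apply: (@leq_trans (idx k + 1)%N); first by rewrite addn1.
  by rewrite /idx [leqRHS]big_ord_recr/= leq_add2l.
exists N1 => n N1n; set j := maxn N1 N2.
have := ip_sub_le mD (sf n) (sf (idx j)) sl.
have := HN1 n (idx j) N1n (leq_trans (leq_maxl _ _) (idx_ge j)).
have := HN2 j (leq_maxr _ _).
lra.
Qed.

End completeness.

Lemma le0_of_small (R : realType) (x K : R) : 0 <= K ->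
  (forall e, 0 < e -> x <= K * e) -> x <= 0.
Proof.
move=> K0 H; rewrite leNgt; apply/negP => x0.
have K1 : 0 < K + 1 by lra.
have := H (x / 2 / (K + 1)).
rewrite !divr_gt0// => /(_ isT) /[!mulrA].
rewrite ler_pdivlMr//; nra.
Qed.

Lemma inv_nat_lt (R : realType) (e : R) : 0 < e ->
  exists N, forall n, (N <= n)%N -> n.+1%:R^-1 <= e.
Proof.
move=> e0; have HN := truncnS_gt e^-1; set N := (Num.truncn _).+1 in HN.
exists N => n Nn; rewrite -(invrK e) lef_pV2 ?posrE ?invr_gt0//.
by apply: ltW; apply: lt_le_trans HN _; rewrite ler_nat ltnW.
Qed.

(* [lin a u b v] stands for [a u + b v]; only a linear combination operation is
   needed, so that the lemma applies to representatives of classes of functions. *)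
Section riesz.
Variables (R : realType) (X : Type) (lin : R -> X -> R -> X -> X) (V : set X).
Variables (B : X -> X -> R) (F : X -> R) (C : R) (v0 : X).
Hypothesis V0 : V v0.
Hypothesis Vlin : forall a u b v, V u -> V v -> V (lin a u b v).
Hypothesis Bsym : forall u v, V u -> V v -> B u v = B v u.
Hypothesis Blin : forall a u b v w, V u -> V v -> V w ->
  B (lin a u b v) w = a * B u w + b * B v w.
Hypothesis Bge0 : forall u, V u -> 0 <= B u u.
Hypothesis Flin : forall a u b v, V u -> V v ->
  F (lin a u b v) = a * F u + b * F v.
Hypothesis Fbnd : forall u, V u -> F u ^+ 2 <= C * B u u.
Hypothesis C0 : 0 <= C.
Local Notation dist u v := (B (lin 1 u (-1) v) (lin 1 u (-1) v)).
Hypothesis complete : forall s : nat -> X, (forall n, V (s n)) ->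
  (forall e : R, 0 < e -> exists N, forall m n, (N <= m)%N -> (N <= n)%N ->
     dist (s m) (s n) <= e) ->
  exists l, V l /\ forall e : R, 0 < e -> exists N, forall n, (N <= n)%N ->
     dist (s n) l <= e.

Let Bexp a u b v : V u -> V v -> B (lin a u b v) (lin a u b v) =
  a ^+ 2 * B u u + 2 * a * b * B u v + b ^+ 2 * B v v.
Proof.
move=> Vu Vv; rewrite Blin ?(Bsym _ (Vlin _ _ _ _))//; [|exact: Vlin..].
rewrite !Blin// (Bsym Vv Vu); ring.
Qed.

(** The functional J is minimised. A minimising sequence is Cauchy by the parallelogram identity,
    near-minimality bounds its first variation in the direction v, and this bound passes to the
    limit. *)
Lemma riesz : exists u, V u /\ forall v, V v -> B u v = F v.
Proof.
pose J u := B u u - 2 * F u.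
(* From F^2 <= C B and the inequality between the means of C and B, 2 F <= C + B. *)
have Jlb u : V u -> - C <= J u.
  move=> Vu; have := Fbnd Vu; have := Bge0 Vu; rewrite /J => b0 Fb.
  have : F u <= (C + B u u) / 2.
    rewrite leNgt; apply/negP => H.
    have : ((C + B u u) / 2) ^+ 2 < F u ^+ 2.
      by rewrite ltr_pXn2r ?nnegrE//; move: C0; lra.
    have := sqr_ge0 (C - B u u); nra.
  lra.
pose E := [set J u | u in V].
have hE : has_inf E.
  split; first by exists (J v0); exists v0.
  by exists (- C) => _ [u Vu <-]; exact: Jlb.
have Jm u : V u -> inf E <= J u.
  by move=> Vu; apply: ge_inf; [case: hE|exists u].
have /choice[s Hs] (n : nat) : exists u, V u /\ J u < inf E + n.+1%:R^-1.
  have [|_ [u Vu <-] Hu] := @inf_adherent _ E n.+1%:R^-1 _ hE.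
    by rewrite invr_gt0.
  by exists u.
have Vs n := (Hs n).1.
have [|l [Vl Hl]] := complete Vs.
  move=> e e0; have e4 : 0 < e / 4 by lra.
  have [N HN] := inv_nat_lt e4; exists N => m n Nm Nn.
  (* Parallelogram identity: the squared distance is 2 J (s m) + 2 J (s n) - 4 J (midpoint), hence
     at most 2 (x + y) with x, y <= e / 4. *)
  have := Jm _ (Vlin 2^-1 2^-1 (Vs m) (Vs n)).
  have := (Hs m).2; have := (Hs n).2; have := HN _ Nm; have := HN _ Nn.
  rewrite /J !Bexp ?Flin//.
  set x := m.+1%:R^-1; set y := n.+1%:R^-1.
  nra.
exists l; split => // v Vv.
(* As [s n] minimises J up to 1 / (n + 1), J (s n + t v) - J (s n) + 1 / (n + 1) is a nonnegative
   quadratic polynomial in t. *)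
have crit n : (B (s n) v - F v) ^+ 2 <= n.+1%:R^-1 * B v v.
  apply: discriminant_le; [by rewrite invr_ge0|exact: Bge0|] => t.
  have := Jm _ (Vlin 1 t (Vs n) Vv); have := (Hs n).2.
  rewrite /J Bexp ?Flin//.
  by set x := n.+1%:R^-1; nra.
have CS u : V u -> B u v ^+ 2 <= B u u * B v v.
  move=> Vu; apply: discriminant_le; [exact: Bge0..|] => t.
  have := Bge0 (Vlin 1 t Vu Vv); rewrite Bexp//; nra.
apply/eqP; rewrite -subr_eq0 -sqrf_eq0 eq_le sqr_ge0 andbT.
apply: (@le0_of_small _ _ (4 * B v v)); first by rewrite mulr_ge0// Bge0.
move=> e e0; have [N HN] := inv_nat_lt e0; have [M HM] := Hl _ e0.
pose n := maxn N M.
have := HN n (leq_maxl _ _); have := HM n (leq_maxr _ _).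
have := crit n; have := CS _ (Vlin 1 (-1) (Vs n) Vl); rewrite Blin//.
have := Bge0 Vv; have := Bge0 (Vlin 1 (-1) (Vs n) Vl).
set x := n.+1%:R^-1; set D := B (lin _ _ _ _) _ => D0 b0 h1 h2 h3 h4.
have : D * B v v <= e * B v v by rewrite ler_wpM2r.
have : x * B v v <= e * B v v by rewrite ler_wpM2r.
have := sqr_ge0 ((B (s n) v - F v) + (B (s n) v - B l v)).
nra.
Qed.

End riesz.

Section uniform_boundedness.
Context d (T : measurableType d) (R : realType).
Variables (mu : {measure set T -> \bar R}) (D : set T).
Hypothesis mD : measurable D.
Local Notation sqint := (sqint mu D).
Local Notation ip := (l2dot mu D).
Local Notation dist f g := (ip (fun x => f x - g x) (fun x => f x - g x)).

Lemma ipBC f g : dist f g = dist g f.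
Proof.
by rewrite /ip; apply: eq_Rintegral => x _; ring.
Qed.

(* Sokal's version of the gliding hump argument. *)
Lemma uniform_boundedness (G : nat -> T -> R) : (forall n, sqint (G n)) ->
  (forall y, sqint y -> exists M, forall n, `|ip (G n) y| <= M) ->
  exists C, forall n, ip (G n) (G n) <= C.
Proof.
move=> sG bG; apply: contrapT => nC.
(* Norms above 8^(k+1) against steps of length 4^-(k+1): step k contributes 4^-(k+1) [t k] to the
   pairing with [G (nk k)], the later steps together take away at most two thirds of it, and the
   remaining third exceeds 2^(k+1) / 3. *)
have /choice[nk Hnk] (k : nat) : exists n, 8 ^+ k.+1 < Num.sqrt (ip (G n) (G n)).
  apply: contrapT => H; apply: nC; exists ((8 ^+ k.+1) ^+ 2) => n.
  rewrite leNgt; apply/negP => K; apply: H; exists n.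
  rewrite -[X in X < _]ger0_norm ?exprn_ge0// -sqrtr_sqr ltr_sqrt//.
  by apply: le_lt_trans K; rewrite sqr_ge0.
pose t k := Num.sqrt (ip (G (nk k)) (G (nk k))).
have t0 k : 0 < t k by apply: lt_trans (Hnk k); rewrite exprn_gt0.
have tt k : ip (G (nk k)) (G (nk k)) = t k ^+ 2.
  by rewrite sqr_sqrtr// ip_ge0.
(* The sign makes the new term reinforce the pairing already accumulated instead of cancelling
   it. *)
pose sg k (x : T -> R) : R := if 0 <= ip (G (nk k)) x then 1 else -1.
pose step k x y := x y + sg k x * (4^-1 ^+ k.+1 / t k) * G (nk k) y.
pose fix xs k : T -> R := if k is k'.+1 then step k' (xs k') else (fun=> 0).
have sx k : sqint (xs k).
  elim: k => [|k IH]; first exact: sqint0.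
  by apply: sqintD => //; apply: sqintZ.
have sg2 k x : sg k x ^+ 2 = 1 by rewrite /sg; case: ifP => _; rewrite ?sqrrN expr1n.
have dS k : dist (xs k) (xs k.+1) = 16^-1 ^+ k.+1.
  rewrite ipBC.
  rewrite (eq_ip _ _ (f' := fun y => (sg k (xs k) * (4^-1 ^+ k.+1 / t k)) * G (nk k) y)
     (g' := fun y => (sg k (xs k) * (4^-1 ^+ k.+1 / t k)) * G (nk k) y)); last 2 first.
  - by move=> y /=; rewrite /step; ring.
  - by move=> y /=; rewrite /step; ring.
  rewrite ipZl ?ipZr//; last exact: sqintZ.
  rewrite tt mulrA -expr2 exprMn sg2 mul1r -exprMn divfK ?gt_eqF//.
  by rewrite -exprM mulnC exprM; congr (_ ^+ _); field.
have grow k : 4^-1 ^+ k.+1 * t k <= `|ip (G (nk k)) (xs k.+1)|.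
  have -> : ip (G (nk k)) (xs k.+1) =
     ip (G (nk k)) (xs k) + sg k (xs k) * (4^-1 ^+ k.+1 * t k).
    rewrite [xs _]/= /step ipDr//; last exact: sqintZ.
    by rewrite ipZr// tt; congr (_ + _); field; rewrite gt_eqF.
  have p0 : 0 <= 4^-1 ^+ k.+1 * t k by rewrite mulr_ge0 ?exprn_ge0// ltW.
  rewrite /sg; case: ifPn => [h|]; first by rewrite ger0_norm; lra.
  by rewrite -ltNge => h; rewrite ltr0_norm; lra.
have far k m : dist (xs k) (xs (k + m)%N) <= 3 * 16^-1 ^+ k.+1.
  elim: m k => [|m IH] k.
    rewrite addn0 (eq_ip _ _ (f' := fun=> 0) (g' := fun=> 0)) ?ip0l ?mulr_ge0 ?exprn_ge0//.
    - by move=> y; rewrite subrr.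
    - by move=> y; rewrite subrr.
  have := ip_sub_le mD (sx k) (sx k.+1) (sx (k + m.+1)%N).
  have := IH k.+1; rewrite dS addSnnS (exprS _ k.+1).
  have : 0 <= 16^-1 ^+ k.+1 :> R by rewrite exprn_ge0.
  lra.
have [|x [sxx Hx]] := sqint_complete mD sx.
  move=> e e0; have geo : 3 * 16^-1 ^+ n @[n --> \oo] --> (0 : R).
    by apply: cvg_geometric; rewrite ger0_norm//; lra.
  have e4 : 0 < e / 4 by lra.
  have /cvgr0Pnorm_lt/(_ _ e4) [N _ NP] := geo.
  have NN := NP N (leqnn N).
  exists N => m n Nm Nn.
  have := ip_sub_le mD (sx m) (sx N) (sx n).
  have := far N (m - N)%N; have := far N (n - N)%N; rewrite !subnKC//.
  rewrite (ipBC (xs m) (xs N)).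
  have := le_lt_trans (ler_norm _) NN; rewrite exprS.
  have : 0 <= 16^-1 ^+ N :> R by rewrite exprn_ge0.
  lra.
have farx k : dist (xs k.+1) x <= (2 / 3 * 4^-1 ^+ k.+1) ^+ 2.
  (* 2 (3 / 16 + 1 / 50) < 4 / 9, where 3 / 16 bounds the later steps and 1 / 50 the distance from a
     late term to the limit. *)
  have e0 : 0 < 50^-1 * 16^-1 ^+ k.+1 :> R by rewrite mulr_gt0// exprn_gt0.
  have [N HN] := Hx _ e0.
  have := HN (k.+1 + N)%N (leq_addl _ _); have := far k.+1 N.
  have := ip_sub_le mD (sx k.+1) (sx (k.+1 + N)%N) sxx.
  have -> : (2 / 3 * 4^-1 ^+ k.+1) ^+ 2 = 4 / 9 * 16^-1 ^+ k.+1 :> R.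
    rewrite exprMn -exprM mulnC exprM (_ : 4^-1 ^+ 2 = 16^-1 :> R); last by field.
    by rewrite (_ : (2 / 3) ^+ 2 = 4 / 9 :> R)//; field.
  rewrite (exprS _ k.+1).
  lra.
have [M HM] := bG _ sxx.
have big k : 3^-1 * 2 ^+ k.+1 <= M.
  apply: le_trans (HM (nk k)).
  set p := 4^-1 ^+ k.+1 : R; have p0 : 0 <= p by rewrite exprn_ge0.
  have sd := sqintB mD (sx k.+1) sxx.
  have h1 := norm_ip mD (sG (nk k)) sd.
  have h2 : Num.sqrt (dist (xs k.+1) x) <= 2 / 3 * p.
    rewrite -[leRHS]ger0_norm ?mulr_ge0// -sqrtr_sqr.
    by apply: ler_wsqrtr; exact: farx.
  have h3 : `|ip (G (nk k)) (fun y => xs k.+1 y - x y)| <= t k * (2 / 3 * p).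
    by apply: le_trans h1 _; rewrite ler_wpM2l// ltW.
  rewrite (ipBr mD (sx k.+1) sxx (sG (nk k))) in h3.
  have h4 := grow k.
  have h6 := lerB_dist (ip (G (nk k)) (xs k.+1)) (ip (G (nk k)) x).
  have h7 : 2 ^+ k.+1 = p * 8 ^+ k.+1 :> R.
    by rewrite -exprMn; congr (_ ^+ _); field.
  have h8 : p * 8 ^+ k.+1 <= p * t k by rewrite ler_wpM2l// ltW// Hnk.
  rewrite -/p in h4; rewrite h7; lra.
have := big (Num.truncn `|M|).+2.
have : `|M| < (Num.truncn `|M|).+1%:R by rewrite truncnS_gt.
set K := (Num.truncn _).+1.
have : K%:R <= 2 ^+ K :> R by rewrite -natrX ler_nat ltnW// ltn_expl.
rewrite (exprS _ K.+1) (exprS _ K); have := ler_norm M; have := normr_ge0 M; lra.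
Qed.

End uniform_boundedness.

(** * Lebesgue measure on R^d *)

Section rV_basics.
Variable R : realType.

Lemma rV_ballP n (x y : 'rV[R]_n) (e : R) : 0 < e ->
  ball x e y <-> forall i, `|x ord0 i - y ord0 i| < e.
Proof.
move=> e0; split=> [[_ H] i|H]; first exact: H.
by split=> // i j; rewrite ord1; exact: H.
Qed.

Definition obox n (a b : 'I_n -> R) : set 'rV[R]_n :=
  [set x | forall i, a i < x ord0 i < b i].

Lemma measurable_obox n (a b : 'I_n -> R) : measurable (obox a b).
Proof.
have -> : obox a b = \bigcap_(i : 'I_n) (rV_coord i @^-1` `]a i, b i[).
  apply/seteqP; split => x H.
    by move=> i _ /=; rewrite in_itv /=; exact: H.
  by move=> i; have := H i I; rewrite /= in_itv.
apply: fin_bigcap_measurable => [|i _]; first exact: finite_finset.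
by rewrite -[X in measurable X]setTI; exact: measurable_rV_coord.
Qed.

(** Boxes with rational centre and radius. Their closures are kept inside U since a bump on a box
    has compact support in the domain only if the closed box lies there ([test_bump]). *)
Lemma open_obox n (U : set 'rV[R]_n) : open U ->
  exists F : 'rV[rat]_n * rat -> set 'rV[R]_n,
    U = \bigcup_k F k /\ forall k, F k = set0 \/ exists a b,
      F k = obox a b /\ forall x : 'rV[R]_n, (forall i, a i <= x ord0 i <= b i) -> U x.
Proof.
move=> oU.
pose lo (k : 'rV[rat]_n * rat) i : R := ratr (k.1 ord0 i) - ratr k.2.
pose hi (k : 'rV[rat]_n * rat) i : R := ratr (k.1 ord0 i) + ratr k.2.
pose good k := forall x : 'rV[R]_n, (forall i, lo k i <= x ord0 i <= hi k i) -> U x.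
exists (fun k => if `[< good k >] then obox (lo k) (hi k) else set0); split; last first.
  move=> k; case: asboolP => H; last by left.
  by right; exists (lo k), (hi k).
apply/seteqP; split => x; last first.
  move=> [k _]; case: asboolP => // H Hx; apply: H => i.
  by have /andP[/ltW -> /ltW ->] := Hx i.
move=> Ux.
have /nbhs_ballP[e /= e0 He] : nbhs x U by apply: open_nbhs_nbhs; split.
have [r /andP[r0 re]] : exists r : rat, 0 < (ratr r : R) < e / 2.
  have := @rat_in_itvoo R 0 (e / 2).
  rewrite divr_gt0// => /(_ isT)[r]; rewrite in_itv /= => H; by exists r.
have /choice[c Hc] (i : 'I_n) : exists q : rat, x ord0 i - ratr r < (ratr q : R) < x ord0 i + ratr r.
  have := @rat_in_itvoo R (x ord0 i - ratr r) (x ord0 i + ratr r).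
  have -> : x ord0 i - ratr r < x ord0 i + ratr r by lra.
  by move=> /(_ isT)[q]; rewrite in_itv /= => H; exists q.
exists (\row_i c i, r) => //; case: asboolP => [H i|[]].
  by rewrite /lo /hi /= !mxE; have := Hc i; lra.
move=> y Hy; apply: He; apply/rV_ballP => // i.
have := Hy i; have := Hc i; rewrite /lo /hi /= !mxE => h1 h2.
rewrite ltr_norml; lra.
Qed.

Lemma open_measurable_rV n (U : set 'rV[R]_n) : open U -> measurable U.
Proof.
move=> /open_obox[F [-> HF]].
apply: countable_bigcupT_measurable => // k.
have [->//|[a [b [-> _]]]] := HF k; exact: measurable_obox.
Qed.

Lemma continuous_measurable_rV n (f : 'rV[R]_n -> R) (D : set 'rV[R]_n) :
  continuous f -> measurable_fun D f.
Proof.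
move=> cf; apply: (@measurable_funS _ _ _ _ setT) => //.
apply: (measurability _ (RGenOpens.measurableE R)).
move=> _ [_ [a [b ->] <-]]; rewrite setTI; apply: open_measurable_rV.
by move/continuousP : cf; apply; exact: interval_open.
Qed.

Definition cube n (N : R) : set 'rV[R]_n := [set x | forall i, `|x ord0 i| <= N].

Lemma measurable_cube n N : measurable (@cube n N).
Proof.
have -> : cube N = \bigcap_(i : 'I_n) (rV_coord i @^-1` `[- N, N]).
  apply/seteqP; split => x H.
    by move=> i _ /=; rewrite in_itv /= -ler_norml; exact: H.
  by move=> i; have := H i I; rewrite /= in_itv/= -ler_norml.
apply: fin_bigcap_measurable => [|i _]; first exact: finite_finset.
by rewrite -[X in measurable X]setTI; exact: measurable_rV_coord.
Qed.

Lemma cons_rV0 n x (y : 'rV[R]_n) : cons_rV (x, y) ord0 ord0 = x.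
Proof. by rewrite mxE; case: splitP => // j _; rewrite mxE. Qed.

Lemma cons_rVS n x (y : 'rV[R]_n) i : cons_rV (x, y) ord0 (lift ord0 i) = y ord0 i.
Proof.
rewrite mxE; case: splitP => j; rewrite [in X in X -> _]/= /bump /=.
  by case: j => -[].
by rewrite !add1n => -[ij]; congr (y _ _); exact/val_inj.
Qed.

Lemma cube_cons n N x (y : 'rV[R]_n) : cube N (cons_rV (x, y)) <-> `|x| <= N /\ cube N y.
Proof.
split=> [H|[H1 H2] i].
  split; first by have := H ord0; rewrite cons_rV0.
  by move=> i; have := H (lift ord0 i); rewrite cons_rVS.
by case: (unliftP ord0 i) => [j ->|->]; rewrite ?cons_rVS ?cons_rV0.
Qed.

Lemma lebesgue_cube n (N : R) : (lebesgue_rV n (cube N) < +oo)%E.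
Proof.
elim: n => [|n IH].
  by rewrite /= diracE; case: (_ \in _) => //; rewrite ltry.
rewrite /= /lebesgue_step /pushforward.
have -> : @cons_rV R n @^-1` cube N = `[- N, N]%classic `*` cube N.
  apply/seteqP; split => -[x y] /=; rewrite in_itv/= -ler_norml.
    by move=> /cube_cons.
  by move=> /cube_cons.
rewrite product_measure1E//; last exact: measurable_cube.
have : ((@lebesgue_measure R) `[(- N)%R, N]%classic < +oo)%E.
  by rewrite lebesgue_measure_itv/=; case: ifP => _; rewrite ?ltry// -EFinD ltry.
by move=> h; rewrite lte_mul_pinfty// ge0_fin_numE.
Qed.

Lemma bounded_set_cube n (A : set 'rV[R]_n) : bounded_set A ->
  exists N, 0 < N /\ A `<=` cube N.
Proof.
move=> [M [_ HM]]; exists (`|M| + 1); split; first by rewrite ltr_wpDl.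
move=> x Ax i.
have M1 : M < `|M| + 1 by rewrite (le_lt_trans (ler_norm M))// ltrDl.
apply: le_trans (HM _ M1 x Ax).
by rewrite /Num.Def.normr /= mx_normrE; apply: (le_bigmax _ _ (ord0, i)).
Qed.

End rV_basics.

(** * Bounded functions supported in a set of finite measure, and Fubini's theorem *)

Section tame.
Context d (T : measurableType d) (R : realType).
Variables (mu : {measure set T -> \bar R}) (S : set T).
Hypothesis mS : measurable S.
Hypothesis Soo : (mu S < +oo)%E.
Implicit Types f g : T -> R.

(** On this class every integral exists, and it is stable under products, slices and partial
    integrals, so that Fubini's theorem can be iterated without integrability side conditions. *)
Definition tame f : Prop :=
  [/\ measurable_fun setT f, forall x, ~ S x -> f x = 0 &
      exists K, forall x, `|f x| <= K].

Lemma integrable_indic_finite : mu.-integrable setT (EFin \o (\1_S : T -> R)).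
Proof.
apply/integrableP; split; first exact/measurable_EFinP.
rewrite (eq_integral (fun x => (\1_S x)%:E)); last first.
  by move=> t _; rewrite gee0_abs// lee_fin.
by rewrite integral_indic// setIT.
Qed.

Lemma tame_integrable f : tame f -> mu.-integrable setT (EFin \o f).
Proof.
move=> [mf f0 [K fK]].
apply: (@integrable_le _ _ _ mu setT measurableT _ (fun x => K * \1_S x)).
- by [].
- move=> x _; rewrite indicE; case: (boolP (x \in S)) => [|/negP] xS.
    by rewrite mulr1.
  by rewrite f0 ?normr0 ?mulr0// => Sx; apply: xS; rewrite inE.
- by apply: integrable_scale => //; exact: integrable_indic_finite.
Qed.

Lemma tameD f g : tame f -> tame g -> tame (fun x => f x + g x).
Proof.
move=> [mf f0 [K fK]] [mg g0 [L gL]]; split.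
- exact: measurable_funD.
- by move=> x Sx; rewrite f0// g0// addr0.
- by exists (K + L) => x; apply: le_trans (ler_normD _ _) _; exact: lerD.
Qed.

Lemma tameM f g : tame f -> measurable_fun setT g -> (exists K, forall x, `|g x| <= K) ->
  tame (fun x => f x * g x).
Proof.
move=> [mf f0 [K fK]] mg [L gL]; split.
- exact: measurable_funM.
- by move=> x Sx; rewrite f0// mul0r.
- by exists (K * L) => x; rewrite normrM ler_pM.
Qed.

Lemma tame_mul f g : tame f -> tame g -> tame (fun x => f x * g x).
Proof. by move=> tf [mg _ Kg]; exact: tameM. Qed.

Lemma tame_sqr f : tame f -> tame (fun x => f x ^+ 2).
Proof. by move=> tf; under eq_fun do rewrite expr2; exact: tame_mul. Qed.

Lemma tameZ k f : tame f -> tame (fun x => k * f x).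
Proof.
move=> [mf f0 [K fK]]; split.
- exact: measurable_funM.
- by move=> x Sx; rewrite f0// mulr0.
- by exists (`|k| * K) => x; rewrite normrM ler_wpM2l.
Qed.

Lemma tameB f g : tame f -> tame g -> tame (fun x => f x - g x).
Proof.
move=> tf tg; under eq_fun do rewrite -mulN1r.
exact: tameD (tameZ _ tg).
Qed.

Lemma tame_sum I (s : seq I) (F : I -> T -> R) : (forall i, tame (F i)) ->
  tame (fun x => \sum_(i <- s) F i x).
Proof.
move=> tF; elim: s => [|i s IH].
  under eq_fun do rewrite big_nil.
  by split; [exact: measurable_cst| |exists 0 => x; rewrite normr0].
by under eq_fun do rewrite big_cons; exact: tameD.
Qed.

Lemma tame_sqint f : tame f -> sqint mu setT f.
Proof. by move=> tf; split; [case: tf|exact: (tame_integrable (tame_sqr tf))]. Qed.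

Lemma tame_RintegralD f g : tame f -> tame g ->
  \int[mu]_x (f x + g x) = \int[mu]_x f x + \int[mu]_x g x.
Proof. by move=> tf tg; rewrite RintegralD//; exact: tame_integrable. Qed.

Lemma tame_RintegralZ k f : tame f ->
  \int[mu]_x (k * f x) = k * \int[mu]_x f x.
Proof. by move=> tf; rewrite RintegralZl//; exact: tame_integrable. Qed.

Lemma tame_Rintegral_sum I (s : seq I) (F : I -> T -> R) : (forall i, tame (F i)) ->
  \int[mu]_x (\sum_(i <- s) F i x) = \sum_(i <- s) \int[mu]_x F i x.
Proof.
move=> tF; elim: s => [|i s IH].
  rewrite big_nil; under eq_Rintegral do rewrite big_nil.
  by rewrite /Rintegral integral0.
rewrite big_cons -IH -tame_RintegralD//; last exact: tame_sum.
by apply: eq_Rintegral => x _; rewrite big_cons.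
Qed.

Lemma tame_le_Rintegral f g : tame f -> tame g -> (forall x, f x <= g x) ->
  \int[mu]_x f x <= \int[mu]_x g x.
Proof. by move=> tf tg fg; apply: le_Rintegral => //; exact: tame_integrable. Qed.

Lemma tame_norm_Rintegral f K : tame f -> (forall x, `|f x| <= K) ->
  `|\int[mu]_x f x| <= K * fine (mu S).
Proof.
move=> tf fK; apply: le_trans (le_normr_Rintegral measurableT (tame_integrable tf)) _.
have tn : tame (fun x => `|f x|).
  case: tf => mf f0 _; split; first exact: measurableT_comp.
    by move=> x Sx; rewrite f0 ?normr0.
  by exists K => x; rewrite normr_id.
have K0 x := le_trans (normr_ge0 _) (fK x).
have i1 := integrable_indic_finite.
apply: (@le_trans _ _ (\int[mu]_x (K * \1_S x))).
  apply: le_Rintegral => //; [exact: tame_integrable|exact: integrable_scale|].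
  move=> x _; rewrite indicE; case: (boolP (x \in S)) => [|/negP] xS.
    by rewrite mulr1.
  by case: tf => _ f0 _; rewrite f0 ?normr0 ?mulr0// => Sx; apply: xS; rewrite inE.
by rewrite RintegralZl// /Rintegral integral_indic// setIT.
Qed.

End tame.
Arguments tame {d T R} S f.

Section fubini_rV.
Variables (R : realType) (n : nat) (N : R).
Local Notation leb := (lebesgue_rV n).
Local Notation leb1 := (@lebesgue_measure R).
Local Notation cubeS := (@cube R n.+1 N).
Local Notation cubeN := (@cube R n N).
Local Notation seg := ([set x : measurableTypeR R | `|x| <= N]).

Lemma measurable_seg : measurable seg.
Proof.
rewrite (_ : seg = `[- N, N]%classic); first exact: measurable_itv.
by apply/seteqP; split => x /=; rewrite in_itv/= -ler_norml.
Qed.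

Lemma lebesgue_seg : (leb1 seg < +oo)%E.
Proof.
rewrite (_ : seg = `[- N, N]%classic).
  by rewrite lebesgue_measure_itv/=; case: ifP => _; rewrite ?ltry// -EFinD ltry.
by apply/seteqP; split => x /=; rewrite in_itv/= -ler_norml.
Qed.

Variable f : 'rV[R]_n.+1 -> R.
Hypothesis tf : tame cubeS f.

Lemma tame_slice x : tame cubeN (fun y => f (cons_rV (x, y))).
Proof.
case: tf => mf f0 [K fK]; split.
- rewrite (_ : (fun y => _) = f \o (@cons_rV R n \o pair x))//.
  apply: (measurableT_comp mf); apply: (measurableT_comp (@measurable_cons_rV R n)).
  exact: pair1_measurable.
- by move=> y Sy; apply: f0 => /cube_cons[].
- by exists K.
Qed.

Lemma tame_slice2 y : tame seg (fun x => f (cons_rV (x, y))).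
Proof.
case: tf => mf f0 [K fK]; split.
- rewrite (_ : (fun x => _) = f \o (@cons_rV R n \o pair^~ y))//.
  apply: (measurableT_comp mf); apply: (measurableT_comp (@measurable_cons_rV R n)).
  exact: pair2_measurable.
- by move=> x Sx; apply: f0 => /cube_cons[].
- by exists K.
Qed.

Let mfc : measurable_fun setT (EFin \o f \o @cons_rV R n).
Proof.
apply/measurable_EFinP; apply: measurableT_comp; first by case: tf.
exact: measurable_cons_rV.
Qed.

Let ifs : (lebesgue_rV n.+1).-integrable setT (EFin \o f).
Proof.
by apply: tame_integrable tf; [exact: measurable_cube|exact: lebesgue_cube].
Qed.

Let ifc : (leb1 \x leb)%E.-integrable setT (EFin \o f \o @cons_rV R n).
Proof.
have /integrableP[mf fo] := ifs; apply/integrableP; split => //.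
apply: le_lt_trans fo.
rewrite /= /lebesgue_step ge0_integral_pushforward//.
- exact: measurable_cons_rV.
- by apply: (measurableT_comp (@abse_measurable R setT) mf).
Qed.

Lemma tame_Rintegral_slice : tame seg (fun x => \int[leb]_y f (cons_rV (x, y))).
Proof.
case: (tf) => mf f0 [K fK]; split.
- have := measurable_fubini_F ifc; rewrite /fubini_F => m.
  by exact: (measurableT_comp (@fine_measurable R setT measurableT) m).
- move=> x Sx; rewrite (@eq_Rintegral _ _ _ _ _ (fun=> 0)); last first.
    by move=> y _; apply: f0 => /cube_cons[].
  by rewrite /Rintegral integral0.
- exists (K * fine (leb cubeN)) => x.
  apply: tame_norm_Rintegral (tame_slice x) _ => //; [exact: measurable_cube|exact: lebesgue_cube].
Qed.

Lemma tame_Rintegral_slice2 :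
  tame cubeN (fun y => \int[leb1]_x f (cons_rV (x, y))).
Proof.
case: (tf) => mf f0 [K fK]; split.
- have := measurable_fubini_G ifc; rewrite /fubini_G => m.
  by exact: (measurableT_comp (@fine_measurable R setT measurableT) m).
- move=> y Sy; rewrite (@eq_Rintegral _ _ _ _ _ (fun=> 0)); last first.
    by move=> x _; apply: f0 => /cube_cons[].
  by rewrite /Rintegral integral0.
- exists (K * fine (leb1 seg)) => y.
  by apply: tame_norm_Rintegral (tame_slice2 y) _ => //; [exact: measurable_seg|exact: lebesgue_seg].
Qed.

Let transfer : (\int[lebesgue_rV n.+1]_x (f x)%:E =
  \int[leb1 \x leb]_z (f (cons_rV z))%:E)%E.
Proof.
rewrite /= /lebesgue_step integral_pushforward//; first exact: measurable_cons_rV.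
by apply/measurable_EFinP; case: tf.
Qed.

Lemma fubini_rV1 : \int[lebesgue_rV n.+1]_x f x =
  \int[leb1]_x \int[leb]_y f (cons_rV (x, y)).
Proof.
rewrite /Rintegral transfer -(integral12_prod_meas1 ifc) /fubini_F.
congr fine; apply: eq_integral => x _; rewrite fineK//.
apply: (integrable_fin_num measurableT).
exact: (tame_integrable (measurable_cube _) (lebesgue_cube _ _) (tame_slice x)).
Qed.

Lemma fubini_rV2 : \int[lebesgue_rV n.+1]_x f x =
  \int[leb]_y \int[leb1]_x f (cons_rV (x, y)).
Proof.
rewrite /Rintegral transfer -(integral21_prod_meas1 ifc) /fubini_G.
congr fine; apply: eq_integral => y _; rewrite fineK//.
apply: (integrable_fin_num measurableT).
exact: (tame_integrable measurable_seg lebesgue_seg (tame_slice2 y)).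
Qed.

End fubini_rV.

(** * Poincare and Rellich inequalities *)

Section one_dimension.
Variable R : realType.
Local Notation leb1 := (@lebesgue_measure R).
Implicit Types f g : R -> R.

Lemma fine_lebesgue_itv (a b : R) : a <= b ->
  fine (leb1 `[a, b]%classic) = b - a.
Proof.
move=> ab; rewrite lebesgue_measure_itv/= lte_fin; case: ltP => //= ba.
by apply/esym/eqP; rewrite subr_eq0; apply/eqP/le_anti; rewrite ab ba.
Qed.

Lemma continuous_measurable_R (g : R -> R) (D : set (measurableTypeR R)) :
  continuous g -> measurable_fun D (g : measurableTypeR R -> R).
Proof.
move=> cg; apply: (@measurable_funS _ _ _ _ setT) => //.
exact: continuous_measurable_fun.
Qed.

Lemma continuous_integrable_itv g (a b : R) : continuous g ->
  leb1.-integrable `[a, b]%classic (EFin \o g).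
Proof.
move=> cg; apply: continuous_compact_integrable; first exact: segment_compact.
exact: continuous_subspaceT.
Qed.

Lemma FTC f g (a b : R) : (forall x : R, is_derive x 1 f (g x)) -> continuous g ->
  a <= b -> \int[leb1]_(x in `[a, b]%classic) g x = f b - f a.
Proof.
move=> fg cg; rewrite le_eqVlt => /predU1P[->|ab].
  by rewrite subrr set_itv1 /Rintegral integral_set1.
have cf x : {for x, continuous f}.
  apply: differentiable_continuous; apply/derivable1_diffP.
  by have := fg x => -[].
rewrite /Rintegral (@continuous_FTC2 _ g f)//.
- exact: continuous_subspaceT.
- split.
  + by move=> x _; have := fg x => -[].
  + exact: cvg_at_right_filter (cf a).
  + exact: cvg_at_left_filter (cf b).
- by move=> x _; rewrite derive1E; have := fg x => -[].
Qed.

(** Cauchy-Schwarz for the product of g and 1 on [x, y]. The set D is larger in the applications: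
    the whole line in [poincare1], a half-open cell in [rellich_slice_increment]. *)
Lemma sqr_increment_le f g (h x y : R) (D : set (measurableTypeR R)) :
  (forall x : R, is_derive x 1 f (g x)) -> continuous g -> x <= y -> y - x <= h ->
  measurable D -> `[x, y]%classic `<=` D ->
  leb1.-integrable D (EFin \o (fun t => g t ^+ 2)) ->
  (f y - f x) ^+ 2 <= h * \int[leb1]_(t in D) (g t ^+ 2).
Proof.
move=> fg cg xy yxh mD xyD ig.
have cg2 : continuous (fun t => g t ^+ 2).
  by move=> t; under eq_fun do rewrite expr2; apply: cvgM; exact: cg.
have m1 : measurable (`[x, y]%classic : set (measurableTypeR R)) by exact: measurable_itv.
have sg : sqint leb1 `[x, y]%classic g.
  by split; [exact: continuous_measurable_R|exact: continuous_integrable_itv].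
have s1 : sqint leb1 `[x, y]%classic (fun=> 1).
  split; first exact: measurable_cst.
  apply: continuous_integrable_itv => t.
  by under eq_fun do rewrite expr1n; exact: cvg_cst.
have := cauchy_schwarz m1 sg s1.
have -> : l2dot leb1 `[x, y]%classic g (fun=> 1) = f y - f x.
  by rewrite -(FTC fg cg xy) /l2dot; apply: eq_Rintegral => t _; rewrite mulr1.
have -> : l2dot leb1 `[x, y]%classic (fun=> 1) (fun=> 1) = y - x.
  rewrite /l2dot; under eq_Rintegral do rewrite mulr1.
  by rewrite Rintegral_cst// mul1r; exact: fine_lebesgue_itv.
move=> /le_trans; apply; rewrite mulrC.
have i0 : 0 <= l2dot leb1 `[x, y]%classic g g by exact: ip_ge0.
apply: (@le_trans _ _ (h * l2dot leb1 `[x, y]%classic g g)); first by rewrite ler_wpM2r.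
have h0 : 0 <= h by lra.
rewrite ler_wpM2l// ipE /Rintegral fine_le//.
- exact: (integrable_fin_num m1 sg.2).
- exact: (integrable_fin_num mD ig).
apply: ge0_subset_integral => //.
- by apply/measurable_EFinP; exact: continuous_measurable_R cg2.
- by move=> t _; rewrite lee_fin sqr_ge0.
Qed.

Local Notation seg N := ([set x : measurableTypeR R | `|x| <= N]).

Lemma Rintegral_derivative_compact f g N : (forall x : R, is_derive x 1 f (g x)) ->
  continuous g -> (forall x, ~ seg N x -> f x = 0) -> (forall x, ~ seg N x -> g x = 0) ->
  \int[leb1]_x g x = 0.
Proof.
(* M lies strictly beyond [N], which may be negative, so that [f0] applies at both endpoints. *)
move=> fg cg f0 g0; set M := `|N| + 1.
have NM : N < M by rewrite (le_lt_trans (ler_norm N))// ltrDl.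
have M0 : 0 < M by rewrite ltr_wpDl.
transitivity (\int[leb1]_(x in `[- M, M]%classic) g x).
  rewrite [RHS]Rintegral_mkcond; apply: eq_Rintegral => x _.
  rewrite patchE; case: ifPn => // /negP xM.
  apply: g0 => /= xN; apply: xM; rewrite inE /= in_itv/= -ler_norml.
  exact: le_trans (ltW NM).
rewrite (FTC fg cg) ?f0 ?subrr//; last by lra.
- by apply/negP; rewrite -ltNge normrN (gtr0_norm M0).
- by apply/negP; rewrite -ltNge (gtr0_norm M0).
Qed.

(** One factor 2 (|N| + 1) comes from Cauchy-Schwarz for f x - f (- M), the other from integrating
    over an interval of that length. *)
Lemma poincare1 f g N : (forall x : R, is_derive x 1 f (g x)) ->
  continuous g -> (forall x, ~ seg N x -> f x = 0) -> (forall x, ~ seg N x -> g x = 0) ->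
  tame (seg N) f -> tame (seg N) g ->
  \int[leb1]_x (f x ^+ 2) <= (2 * (`|N| + 1)) ^+ 2 * \int[leb1]_x (g x ^+ 2).
Proof.
move=> fg cg f0 g0 tf tg; set M := `|N| + 1.
have NM : N < M by rewrite (le_lt_trans (ler_norm N))// ltrDl.
have M0 : 0 < M by rewrite ltr_wpDl.
have mM : measurable (`[- M, M]%classic : set (measurableTypeR R)) by exact: measurable_itv.
have ts := tame_sqr tf.
have iE : \int[leb1]_x (f x ^+ 2) = \int[leb1]_(x in `[- M, M]%classic) (f x ^+ 2).
  rewrite [RHS]Rintegral_mkcond; apply: eq_Rintegral => x _.
  rewrite patchE; case: ifPn => // /negP xM.
  rewrite f0 ?expr0n//= => xN; apply: xM; rewrite inE /= in_itv/= -ler_norml.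
  exact: le_trans (ltW NM).
have ig2 := tame_integrable (measurable_seg N) (lebesgue_seg N) (tame_sqr tg).
have if2 := tame_integrable (measurable_seg N) (lebesgue_seg N) (tame_sqr tf).
set I := \int[leb1]_x (g x ^+ 2).
have bnd x : `[- M, M]%classic x -> f x ^+ 2 <= 2 * M * I.
  rewrite /= in_itv/= => /andP[x1 x2].
  have := @sqr_increment_le f g (2 * M) (- M) x setT fg cg x1.
  rewrite (f0 (- M)) ?subr0; last by apply/negP; rewrite -ltNge normrN (gtr0_norm M0).
  by apply => //; lra.
rewrite iE; apply: (@le_trans _ _ (\int[leb1]_(x in `[- M, M]%classic) (2 * M * I))).
  apply: le_Rintegral => //.
  - apply: integrableS if2 => //.
  - by apply: continuous_integrable_itv => x; exact: cvg_cst.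
rewrite Rintegral_cst// (fine_lebesgue_itv (a := - M) (b := M)); last by lra.
by rewrite le_eqVlt; apply/orP; left; apply/eqP; ring.
Qed.

End one_dimension.

Section C1c.
Variable R : realType.

(** The inductions on the dimension need a class stable under freezing the first coordinate
    ([C1c_slice]); test functions enter it through [test_C1c]. *)
Definition C1c n (N : R) (w : 'rV[R]_n -> R) : Prop :=
  [/\ continuous w, forall x, ~ cube N x -> w x = 0,
      forall i x, derivable w x (delta_mx ord0 i) &
      forall i, continuous (partial i w)].

Lemma closed_cube n N : closed (@cube R n N).
Proof.
have -> : @cube R n N = \bigcap_(i : 'I_n) ((fun x : 'rV[R]_n => x ord0 i) @^-1` `[- N, N]%classic).
  apply/seteqP; split => x H.
    by move=> i _ /=; rewrite in_itv /= -ler_norml; exact: H.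
  by move=> i; have := H i I; rewrite /= in_itv/= -ler_norml.
apply: closed_bigI => i _; apply: preimage_closed; last exact: interval_closed.
by move=> x _; exact: coord_continuous.
Qed.

Lemma compact_cube n N : compact (@cube R n N).
Proof.
apply: bounded_closed_compact; last exact: closed_cube.
exists `|N|; split; first exact: normr_real.
move=> M NM x Nx; apply: le_trans (ltW NM).
have := normr_ge0 N; have := ler_norm N; move: `|N| => K NK K0.
rewrite /Num.Def.normr /= mx_normrE; apply: bigmax_le => // -[i j] _ /=.
by rewrite ord1; apply: le_trans (Nx j) NK.
Qed.

Lemma continuous_cube_tame n N (w : 'rV[R]_n -> R) : continuous w ->
  (forall x, ~ cube N x -> w x = 0) -> tame (cube N) w.
Proof.
move=> cw w0; split => //; first exact: continuous_measurable_rV.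
have /compact_bounded[M [_ HM]] : compact [set w x | x in cube N].
  apply: continuous_compact; last exact: compact_cube.
  exact: continuous_subspaceT.
exists (`|M| + 1) => x; have [Nx|Nx] := pselect (cube N x); last first.
  by rewrite w0// normr0 addr_ge0.
by apply: HM; [rewrite (le_lt_trans (ler_norm M))// ltrDl|exists x].
Qed.

Lemma partial_out n N (w : 'rV[R]_n -> R) i : (forall x, ~ cube N x -> w x = 0) ->
  forall x, ~ cube N x -> partial i w x = 0.
Proof.
move=> w0 x Nx; rewrite /partial (_ : 'D__ w x = 'D_(delta_mx ord0 i) (cst 0) x).
  by rewrite derive_cst.
apply: near_eq_derive.
have oC : open (~` @cube R n N) by apply: closed_openC; exact: closed_cube.
have : nbhs x (~` @cube R n N) by apply: open_nbhs_nbhs; split.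
by apply: filterS => y Ny; rewrite w0.
Qed.

Lemma C1c_tame n N (w : 'rV[R]_n -> R) : C1c N w -> tame (cube N) w.
Proof. by case=> cw w0 _ _; exact: continuous_cube_tame. Qed.

Lemma C1c_tame_partial n N (w : 'rV[R]_n -> R) i : C1c N w -> tame (cube N) (partial i w).
Proof.
by case=> cw w0 _ cp; apply: continuous_cube_tame => //; exact: partial_out.
Qed.

Lemma cons_rV_shift0 n (x h : R) (y : 'rV[R]_n) :
  cons_rV (h + x, y) = h *: delta_mx ord0 ord0 + cons_rV (x, y).
Proof.
apply/rowP => i; rewrite !mxE.
case: (unliftP ord0 i) => [j ->|->].
  by case: splitP => k; rewrite /= ?mxE ?mulr0 ?add0r//; case: k => -[].
by case: splitP => k; rewrite /= ?mxE ?mulr1//.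
Qed.

Lemma cons_rV_shiftS n (x h : R) (y : 'rV[R]_n) i :
  cons_rV (x, h *: delta_mx ord0 i + y) =
  h *: delta_mx ord0 (lift ord0 i) + cons_rV (x, y).
Proof.
apply/rowP => j; case: (unliftP ord0 j) => [k ->|->].
  by rewrite cons_rVS [RHS]mxE cons_rVS !mxE/= (inj_eq lift_inj).
by rewrite cons_rV0 [RHS]mxE cons_rV0 !mxE /= mulr0 add0r.
Qed.

Lemma continuous_cons2 n (x : R) : continuous (fun y : 'rV[R]_n => cons_rV (x, y)).
Proof.
move=> y A /nbhs_ballP[e /= e0 HA].
apply/nbhs_ballP; exists e => //= z /(rV_ballP _ _ e0) H; apply: HA; apply/rV_ballP => // i.
by case: (unliftP ord0 i) => [j ->|->]; rewrite ?cons_rVS// !cons_rV0 subrr normr0.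
Qed.

Lemma continuous_cons1 n (y : 'rV[R]_n) : continuous (fun x : R => cons_rV (x, y)).
Proof.
move=> x A /nbhs_ballP[e /= e0 HA].
apply/nbhs_ballP; exists e => //= z H; apply: HA; apply/rV_ballP => // i.
by case: (unliftP ord0 i) => [j ->|->]; rewrite ?cons_rV0// !cons_rVS subrr normr0.
Qed.

Lemma slice_quotient n (w : 'rV[R]_n.+1 -> R) (x : R) i y :
  (fun h : R => h^-1 *: (((fun y => w (cons_rV (x, y))) \o shift y) (h *: delta_mx ord0 i)
    - w (cons_rV (x, y)))) =
  (fun h : R => h^-1 *: ((w \o shift (cons_rV (x, y))) (h *: delta_mx ord0 (lift ord0 i))
    - w (cons_rV (x, y)))).
Proof. by apply/funext => h /=; rewrite cons_rV_shiftS. Qed.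

Lemma partial_slice n (w : 'rV[R]_n.+1 -> R) (x : R) i y :
  partial i (fun y => w (cons_rV (x, y))) y = partial (lift ord0 i) w (cons_rV (x, y)).
Proof. by rewrite /partial /derive slice_quotient. Qed.

Lemma C1c_slice n N (w : 'rV[R]_n.+1 -> R) x : C1c N w ->
  C1c N (fun y => w (cons_rV (x, y))).
Proof.
case=> cw w0 dw cp; split.
- by move=> y; apply: continuous_comp; [exact: continuous_cons2|exact: cw].
- by move=> y Ny; apply: w0 => /cube_cons[].
- move=> i y; have := dw (lift ord0 i) (cons_rV (x, y)); rewrite /derivable.
  by rewrite -slice_quotient.
- move=> i; rewrite (_ : partial _ _ = (fun y => partial (lift ord0 i) w (cons_rV (x, y)))).
    move=> y; apply: (@continuous_comp _ _ _ (fun y => cons_rV (x, y)) (partial (lift ord0 i) w)).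
    exact: continuous_cons2. exact: cp.
  by apply/funext => y; rewrite partial_slice.
Qed.

Lemma is_derive_slice n N (w : 'rV[R]_n.+1 -> R) y : C1c N w -> forall x : R,
  is_derive x 1 (fun x => w (cons_rV (x, y))) (partial ord0 w (cons_rV (x, y))).
Proof.
case=> cw w0 dw cp x.
have E : (fun h : R => h^-1 *: (((fun x => w (cons_rV (x, y))) \o shift x) (h *: 1) - w (cons_rV (x, y)))) =
  (fun h : R => h^-1 *: ((w \o shift (cons_rV (x, y))) (h *: delta_mx ord0 ord0) - w (cons_rV (x, y)))).
  by apply/funext => h /=; rewrite -cons_rV_shift0 /GRing.scale/= mulr1.
split.
  by have := dw ord0 (cons_rV (x, y)); rewrite /derivable -E.
by rewrite /partial /derive -E.
Qed.

Lemma continuous_slice1 n (g : 'rV[R]_n.+1 -> R) y : continuous g ->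
  continuous (fun x : R => g (cons_rV (x, y))).
Proof.
move=> cg x; apply: (@continuous_comp _ _ _ (fun x : R => cons_rV (x, y)) g).
  exact: continuous_cons1.
exact: cg.
Qed.

Lemma slice_out n N (f : 'rV[R]_n.+1 -> R) y : (forall x, ~ cube N x -> f x = 0) ->
  forall x : R, ~ (`|x| <= N) -> f (cons_rV (x, y)) = 0.
Proof. by move=> f0 x Nx; apply: f0 => /cube_cons[]. Qed.

(** For the first axis this is the one-dimensional statement on each line; the other axes are those
    of slices of lower dimension. Applied to a product it is the integration by parts behind
    [smooth_H1]. *)
Lemma Rintegral_partial n N (w : 'rV[R]_n -> R) i : C1c N w ->
  \int[lebesgue_rV n]_x partial i w x = 0.
Proof.
elim: n w i => [w [[]]//|n IH] w i cw.
have tp := C1c_tame_partial i cw.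
case: (unliftP ord0 i) => [j ij|i0].
  rewrite (fubini_rV1 tp) (@eq_Rintegral _ _ _ _ _ (fun=> 0)).
    by rewrite /Rintegral integral0.
  move=> x _ /=; rewrite -[RHS](IH (fun y => w (cons_rV (x, y))) j (C1c_slice x cw)).
  by apply: eq_Rintegral => y _; rewrite partial_slice ij.
rewrite (fubini_rV2 tp) (@eq_Rintegral _ _ _ _ _ (fun=> 0)).
  by rewrite /Rintegral integral0.
move=> y _ /=; have [c w0 dw cp] := cw; rewrite i0.
apply: (@Rintegral_derivative_compact _ (fun x => w (cons_rV (x, y))) _ N).
- exact: is_derive_slice cw.
- exact: continuous_slice1.
- exact: slice_out w0.
- by apply: slice_out; exact: partial_out.
Qed.

Lemma poincare n N (w : 'rV[R]_n.+1 -> R) : C1c N w ->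
  \int[lebesgue_rV n.+1]_x (w x ^+ 2) <=
  (2 * (`|N| + 1)) ^+ 2 * \int[lebesgue_rV n.+1]_x (partial ord0 w x ^+ 2).
Proof.
move=> cw; have tw := C1c_tame cw; have tp := C1c_tame_partial ord0 cw.
rewrite (fubini_rV2 (tame_sqr tw)) (fubini_rV2 (tame_sqr tp)).
have mC := @measurable_cube R n N; have C := @lebesgue_cube R n N.
have t1 := tame_Rintegral_slice2 (tame_sqr tp).
have t2 := tame_Rintegral_slice2 (tame_sqr tw).
rewrite -(tame_RintegralZ mC C _ t1).
apply: (tame_le_Rintegral mC C t2 (tameZ _ t1)) => y.
have [c w0 dw cp] := cw.
apply: (@poincare1 _ (fun x => w (cons_rV (x, y))) (fun x => partial ord0 w (cons_rV (x, y)))).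
- exact: is_derive_slice cw.
- exact: continuous_slice1.
- exact: slice_out w0.
- by apply: slice_out; exact: partial_out.
- exact: tame_slice2 tw _.
- exact: tame_slice2 tp _.
Qed.

End C1c.

Lemma poincare_coord (R : realType) d (N : R) : (0 < d)%N -> exists2 C, 0 <= C & exists i : 'I_d,
  forall w, C1c N w -> \int[lebesgue_rV d]_x (w x ^+ 2) <=
                       C * \int[lebesgue_rV d]_x (partial i w x ^+ 2).
Proof.
case: d => // n _; exists ((2 * (`|N| + 1)) ^+ 2); first exact: sqr_ge0.
by exists ord0 => w; exact: poincare.
Qed.

Section rellich.
Variable R : realType.
Local Notation leb1 := (@lebesgue_measure R).
Local Notation seg N := ([set x : measurableTypeR R | `|x| <= N]).
Local Notation Ico a h := (`[a, a + h[%classic : set (measurableTypeR R)).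

Lemma fine_lebesgue_ico (a h : R) : 0 < h -> fine (leb1 (Ico a h)) = h.
Proof.
by move=> h0; rewrite lebesgue_measure_itv/= lte_fin ltrDl h0/= addrC addKr.
Qed.

Lemma tame_seg_integrable N f (D : set (measurableTypeR R)) : measurable D ->
  tame (seg N) f -> leb1.-integrable D (EFin \o f).
Proof.
move=> mD tf; have := tame_integrable (measurable_seg N) (lebesgue_seg N) tf.
exact: integrableS.
Qed.

Lemma cst_integrable_ico (a h c : R) : 0 < h ->
  leb1.-integrable (Ico a h) (EFin \o (fun=> c)).
Proof.
move=> h0; have m : measurable (Ico a h) by exact: measurable_itv.
apply: integrableS (continuous_integrable_itv a (a + h) (g := fun=> c) _) => //.
  by move=> x /=; rewrite !in_itv/= => /andP[-> /ltW].
by move=> x; exact: cvg_cst.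
Qed.

(** On an interval of length h, F differs from its mean by at most the square root of [del], so F^2
    is at most twice the squared mean plus 2 [del]. *)
Lemma mean_value_le N F (a h del : R) : 0 < h -> tame (seg N) F ->
  (forall x y, Ico a h x -> Ico a h y -> (F y - F x) ^+ 2 <= del) ->
  \int[leb1]_(x in Ico a h) (F x ^+ 2) <=
  2 / h * (\int[leb1]_(x in Ico a h) F x) ^+ 2 + 2 * h * del.
Proof.
move=> h0 tF Fdel; have m : measurable (Ico a h) by exact: measurable_itv.
set A := \int[leb1]_(x in Ico a h) F x.
have iF := tame_seg_integrable m tF.
have iF2 := tame_seg_integrable m (tame_sqr tF).
have pt x : Ico a h x -> F x ^+ 2 <= 2 * (A / h) ^+ 2 + 2 * del.
  move=> Ix.
  have del0 : 0 <= del by apply: le_trans (Fdel x x Ix Ix); rewrite sqr_ge0.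
  have iB : leb1.-integrable (Ico a h) (EFin \o (fun y => F x - F y)).
    exact: (integrableB m (cst_integrable_ico a (F x) h0) iF).
  have : `|h * F x - A| <= h * Num.sqrt del.
    have -> : h * F x - A = \int[leb1]_(y in Ico a h) (F x - F y).
      rewrite RintegralB//; last exact: cst_integrable_ico.
      by rewrite Rintegral_cst// fine_lebesgue_ico// mulrC.
    apply: le_trans (le_normr_Rintegral m iB) _.
    rewrite -[X in X * _](fine_lebesgue_ico a h0) mulrC -Rintegral_cst//.
    apply: le_Rintegral => //.
    - exact: (integrable_norm iB).
    - exact: cst_integrable_ico.
    - by move=> y Iy; rewrite -sqrtr_sqr; apply: ler_wsqrtr; exact: Fdel.
  have -> : h * F x - A = h * (F x - A / h) by field; rewrite gt_eqF.
  rewrite normrM (gtr0_norm h0) ler_pM2l// => Hs.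
  have Hs2 : (F x - A / h) ^+ 2 <= del.
    rewrite -real_normK ?num_real// -[leRHS]sqr_sqrtr//.
    by rewrite lerXn2r ?nnegrE ?sqrtr_ge0.
  have := sqr_ge0 (F x - 2 * (A / h)).
  move: (A / h) Hs2 => av; nra.
apply: le_trans (_ : \int[leb1]_(x in Ico a h) (2 * (A / h) ^+ 2 + 2 * del) <= _).
  by apply: le_Rintegral => //; exact: cst_integrable_ico.
rewrite Rintegral_cst// fine_lebesgue_ico// le_eqVlt; apply/orP; left.
by apply/eqP; field; rewrite gt_eqF.
Qed.

(** The oscillation on a cell is bounded by the integral of g over that cell only, so the errors of
    m adjacent cells add up to a single integral of g. *)
Lemma mean_value_sum N F g (h c : R) : 0 < h -> tame (seg N) F -> tame (seg N) g ->
  (forall a x y, Ico a h x -> Ico a h y ->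
     (F y - F x) ^+ 2 <= c * h * \int[leb1]_(t in Ico a h) g t) ->
  forall m a, \int[leb1]_(x in Ico a (m%:R * h)) (F x ^+ 2) <=
   \sum_(j < m) 2 / h * (\int[leb1]_(x in Ico (a + j%:R * h) h) F x) ^+ 2 +
   2 * c * h ^+ 2 * \int[leb1]_(x in Ico a (m%:R * h)) g x.
Proof.
move=> h0 tF tg Fg; elim=> [|m IH] a.
  rewrite mul0r addr0 set_itvco0 big_ord0 !Rintegral_set0.
  by rewrite mulr0 addr0.
have split : Ico a (m.+1%:R * h) = Ico a (m%:R * h) `|` Ico (a + m%:R * h) h.
  have mh0 : 0 <= m%:R * h by rewrite mulr_ge0// ltW.
  apply/seteqP; split => x /=; rewrite !in_itv/= -natr1 mulrDl mul1r.
    by case: (ltP x (a + m%:R * h)) => H /andP[H1 H2]; [left|right; rewrite -addrA]; rewrite ?H1 ?H.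
  by case=> /andP[H1 H2]; apply/andP; split; lra.
have m1 : measurable (Ico a (m%:R * h)) by exact: measurable_itv.
have m2 : measurable (Ico (a + m%:R * h) h) by exact: measurable_itv.
have disj : [disjoint Ico a (m%:R * h) & Ico (a + m%:R * h) h].
  apply/disj_setPRL => x /=; rewrite !in_itv/= => /andP[H1 H2] /andP[H3 H4].
  by move: H1; rewrite leNgt H4.
have mU : measurable (Ico a (m%:R * h) `|` Ico (a + m%:R * h) h) by exact: measurableU.
rewrite split big_ord_recr/= Rintegral_setU//; last exact: tame_seg_integrable mU (tame_sqr tF).
rewrite Rintegral_setU//; last exact: tame_seg_integrable mU tg.
have := IH a; have := mean_value_le h0 tF (Fg (a + m%:R * h)).
set x1 := \int[_]_(_ in _) _; set x2 := \int[_]_(_ in _) _; set x3 := \int[_]_(_ in _) _.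
set x4 := \int[_]_(_ in _) _; set x5 := \int[_]_(_ in _) _.
nra.
Qed.

Definition rV_tail n (z : 'rV[R]_n.+1) : 'rV[R]_n := rsubmx (z : 'rV_(1 + n)).

Lemma rV_tailK n x (y : 'rV[R]_n) : rV_tail (cons_rV (x, y)) = y.
Proof. by rewrite /rV_tail /cons_rV row_mxKr. Qed.

Lemma measurable_rV_tail n : measurable_fun setT (@rV_tail n).
Proof.
apply: measurable_fun_to_rV => i.
rewrite [X in measurable_fun _ X](_ : _ = @rV_coord R n.+1 (lift ord0 i)).
  exact: measurable_rV_coord.
by apply/funext => z; rewrite /rV_tail mxE; congr (z _ _); exact/val_inj.
Qed.

Lemma measurable_comp_tail n (f : 'rV[R]_n -> R) : measurable_fun setT f ->
  measurable_fun setT (fun z => f (rV_tail z)).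
Proof. by move=> mf; exact: (measurableT_comp mf (@measurable_rV_tail n)). Qed.

Lemma tame_indic_slice n N (f : 'rV[R]_n.+1 -> R) (I : set (measurableTypeR R)) :
  measurable I -> tame (cube N) f ->
  tame (cube N) (fun z => \1_I (z ord0 ord0) * f z).
Proof.
move=> mI tf; under eq_fun do rewrite mulrC; apply: tameM => //.
  apply: measurableT_comp; first exact: measurable_indic.
  exact: (@measurable_rV_coord R n.+1 ord0).
exists 1 => x; rewrite indicE; case: (_ \in _); rewrite ?normr1//.
by rewrite normr0.
Qed.

Lemma Rintegral_indic_slice n N (f : 'rV[R]_n.+1 -> R) (I : set (measurableTypeR R)) :
  measurable I -> tame (cube N) f ->
  \int[lebesgue_rV n]_y \int[leb1]_(x in I) f (cons_rV (x, y)) =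
  \int[leb1]_(x in I) \int[lebesgue_rV n]_y f (cons_rV (x, y)).
Proof.
move=> mI tf; have ti := tame_indic_slice mI tf.
have := fubini_rV2 ti; rewrite (fubini_rV1 ti) => H.
rewrite [RHS]Rintegral_mkcond.
transitivity (\int[leb1]_x \int[lebesgue_rV n]_y
   (\1_I (cons_rV (x, y) ord0 ord0) * f (cons_rV (x, y)))).
  rewrite H; apply: eq_Rintegral => y _; rewrite Rintegral_mkcond.
  apply: eq_Rintegral => x _; rewrite patchE cons_rV0 indicE.
  by case: ifP => _; rewrite ?mul1r ?mul0r.
apply: eq_Rintegral => x _; rewrite patchE; under eq_Rintegral do rewrite cons_rV0 indicE.
case: ifP => _; first by under eq_Rintegral do rewrite mul1r.
by under eq_Rintegral do rewrite mul0r; rewrite /Rintegral integral0.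
Qed.

Lemma rellich_slice_increment n N (w : 'rV[R]_n.+1 -> R) chi (a h x y : R) : 0 < h ->
  C1c N w -> tame (cube N) chi -> Ico a h x -> Ico a h y ->
  (\int[lebesgue_rV n]_v (w (cons_rV (y, v)) * chi v) -
   \int[lebesgue_rV n]_v (w (cons_rV (x, v)) * chi v)) ^+ 2 <=
  (\int[lebesgue_rV n]_v (chi v ^+ 2)) * h *
  \int[leb1]_(t in Ico a h) \int[lebesgue_rV n]_v (partial ord0 w (cons_rV (t, v)) ^+ 2).
Proof.
move=> h0 cw tc; wlog xy : x y / x <= y.
  move=> H Ix Iy; case/orP: (le_total x y) => xy; first exact: H.
  by rewrite -sqrrN opprB; exact: H.
move=> Ix Iy.
have mC := @measurable_cube R n N; have C := @lebesgue_cube R n N.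
have mI : measurable (Ico a h) by exact: measurable_itv.
have tp := tame_sqr (C1c_tame_partial ord0 cw).
have ty := C1c_tame (C1c_slice y cw); have tx := C1c_tame (C1c_slice x cw).
have td := tameB ty tx.
rewrite -RintegralB//; [|exact: (tame_integrable mC C (tame_mul _ _))..].
under eq_Rintegral do rewrite -mulrBl.
have := cauchy_schwarz measurableT (tame_sqint mC C td) (tame_sqint mC C tc).
rewrite /l2dot; move=> /le_trans; apply.
under [X in _ * X <= _]eq_Rintegral do rewrite -expr2.
under [X in X * _ <= _]eq_Rintegral do rewrite -expr2.
rewrite mulrC -mulrA ler_wpM2l//; first by apply: Rintegral_ge0 => v _; rewrite sqr_ge0.
rewrite -(Rintegral_indic_slice mI tp).
have ti := tame_indic_slice mI tp.
have tj : tame (cube N) (fun v => \int[leb1]_(t in Ico a h) (partial ord0 w (cons_rV (t, v)) ^+ 2)).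
  have := tame_Rintegral_slice2 ti; congr (tame _ _); apply/funext => v.
  rewrite [RHS]Rintegral_mkcond; apply: eq_Rintegral => t _; rewrite patchE cons_rV0 indicE.
  by case: ifP => _; rewrite ?mul1r ?mul0r.
rewrite -(tame_RintegralZ mC C _ tj).
apply: (tame_le_Rintegral mC C (tame_sqr td) (tameZ _ tj)) => v.
apply: (@sqr_increment_le _ (fun t => w (cons_rV (t, v))) (fun t => partial ord0 w (cons_rV (t, v)))).
- exact: is_derive_slice cw.
- by apply: continuous_slice1; case: cw.
- exact: xy.
- move: Ix Iy => /=; rewrite !in_itv/= => /andP[? ?] /andP[? ?]; lra.
- exact: mI.
- move=> t /=; move: Ix Iy; rewrite /= !in_itv/= => /andP[? ?] /andP[? ?] /andP[? ?]; apply/andP; split; lra.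
- exact: tame_seg_integrable mI (tame_slice2 tp v).
Qed.

Lemma Rintegral_rV0 (f : 'rV[R]_0 -> R) : measurable_fun setT f ->
  \int[lebesgue_rV 0]_x f x = f 0.
Proof.
move=> mf; rewrite /Rintegral (integral_dirac _ _ (f := EFin \o f))//.
- by rewrite diracT mul1e.
- exact/measurable_EFinP.
Qed.

(* By induction on the dimension n.+1: apply the inequality to the slices, and
   cut the first axis into intervals of length h, on which the coefficients of
   the slices vary little. *)
Lemma rellich_inequality n (N eta : R) : 0 < N -> 0 < eta ->
  exists (I : finType) (chi : I -> 'rV[R]_n -> R),
    (forall k, tame (cube N) (chi k)) /\
    forall w, C1c N w -> \int[lebesgue_rV n]_x (w x ^+ 2) <=
      \sum_k (\int[lebesgue_rV n]_x (w x * chi k x)) ^+ 2 +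
      eta * \sum_i \int[lebesgue_rV n]_x (partial i w x ^+ 2).
Proof.
move=> N0 eta0; elim: n => [|n [I [chi [tchi IH]]]].
  (* In dimension 0 the measure is a unit mass, and a single coefficient determines w. *)
  exists unit, (fun _ _ => 1); split.
    move=> _; split; [exact: measurable_cst|by move=> x []; case|by exists 1 => x; rewrite normr1].
  move=> w cw; rewrite (big_pred1 tt); last by case.
  have tw := C1c_tame cw.
  rewrite big_ord0 mulr0 addr0 !Rintegral_rV0 ?mulr1//.
  - by apply: measurable_funM => //; case: tw.
  - by case: (tame_sqr tw).
have mC := @measurable_cube R n N; have C := @lebesgue_cube R n N.
have mS := @measurable_seg R N; have S := @lebesgue_seg R N.
pose c k := \int[lebesgue_rV n]_v (chi k v ^+ 2).
have c0 k : 0 <= c k by apply: Rintegral_ge0 => v _; rewrite sqr_ge0.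
pose K := \sum_k c k.
have K0 : 0 <= K by apply: sumr_ge0.
(* The half-open cells start at - N and have total length 3 N, so that they cover [- N, N]. M is
   large enough for the errors 2 c_k h^2 of [mean_value_sum], summed over k, to stay below [eta]. *)
have [M [M0 HM]] : exists M : nat, 0 < (M%:R : R) /\ 2 * K * (3 * N / M%:R) ^+ 2 <= eta.
  pose q := 2 * K * (3 * N) ^+ 2 / eta.
  have N00 := ltW N0; have q0 : 0 <= q by apply: divr_ge0; [rewrite !mulr_ge0 ?sqr_ge0 | exact: ltW].
  exists (Num.truncn q).+1; split => //.
  have := truncnS_gt q; set L := (Num.truncn q).+1 => qL.
  have L1 : 1 <= L%:R :> R by rewrite ler1n.
  have L0 : 0 < L%:R :> R by lra.
  rewrite expr_div_n mulrA ler_pdivrMr ?exprn_gt0//.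
  have -> : 2 * K * (3 * N) ^+ 2 = q * eta by rewrite divfK// gt_eqF.
  rewrite mulrC ler_pM2l//; apply: (le_trans (ltW qL)).
  by rewrite expr2 ler_peMr// ltW.
pose h := 3 * N / M%:R; have h0 : 0 < h by rewrite divr_gt0// mulr_gt0.
pose J (j : nat) : set (measurableTypeR R) := Ico (- N + j%:R * h) h.
have mJ j : measurable (J j) by exact: measurable_itv.
(* The square root absorbs the constant 2 / h of [mean_value_le]. Intersecting with [seg N] keeps
   the support in the cube and changes no coefficient, since w vanishes beyond. *)
pose chi' (kj : I * 'I_M) (z : 'rV[R]_n.+1) : R :=
  Num.sqrt (2 / h) * (\1_(J kj.2 `&` seg N) (z ord0 ord0) * chi kj.1 (rV_tail z)).
have chi'E kj x y : chi' kj (cons_rV (x, y)) = Num.sqrt (2 / h) * (\1_(J kj.2 `&` seg N) x * chi kj.1 y).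
  by rewrite /chi' cons_rV0 rV_tailK.
have tchi' kj : tame (cube N) (chi' kj).
  have [mk k0 [B kB]] := tchi kj.1.
  apply: tameZ; split.
  - apply: measurable_funM.
      apply: measurableT_comp; first by apply: measurable_indic; exact: measurableI (mJ _) mS.
      exact: (@measurable_rV_coord R n.+1 ord0).
    exact: measurable_comp_tail.
  - move=> z Nz; rewrite indicE; case: (boolP (_ \in _)); last by rewrite mul0r.
    rewrite inE /= => -[_ z0]; rewrite k0 ?mulr0// => Nr; apply: Nz => i.
    case: (unliftP ord0 i) => [j ->|->//].
    have := Nr j; rewrite mxE; congr (`|z _ _| <= _); exact/val_inj.
  - exists B => z; rewrite normrM; apply: le_trans (kB (rV_tail z)).
    by rewrite ler_piMl// indicE; case: (_ \in _); rewrite ?normr1 ?normr0.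
exists (I * 'I_M)%type, chi'; split => // w cw.
have tw := C1c_tame cw.
have tp i := C1c_tame_partial i cw.
pose F k (x : R) := \int[lebesgue_rV n]_v (w (cons_rV (x, v)) * chi k v).
pose g (x : R) := \int[lebesgue_rV n]_v (partial ord0 w (cons_rV (x, v)) ^+ 2).
have tg : tame (seg N) g by exact: tame_Rintegral_slice (tame_sqr (tp ord0)).
have twchi k : tame (cube N) (fun z : 'rV[R]_n.+1 => w z * chi k (rV_tail z)).
  have [mk k0 kB] := tchi k.
  apply: tameM => //.
    exact: measurable_comp_tail.
  by have [B HB] := kB; exists B => z.
have FE k x : F k x = \int[lebesgue_rV n]_v (w (cons_rV (x, v)) * chi k (rV_tail (cons_rV (x, v)))).
  by apply: eq_Rintegral => v _; rewrite rV_tailK.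
have tF k : tame (seg N) (F k).
  have := tame_Rintegral_slice (twchi k); congr (tame _ _); apply/funext => x.
  by rewrite FE.
have slice x : \int[lebesgue_rV n]_v (w (cons_rV (x, v)) ^+ 2) <=
   \sum_k F k x ^+ 2 + eta * \sum_i \int[lebesgue_rV n]_v (partial (lift ord0 i) w (cons_rV (x, v)) ^+ 2).
  apply: le_trans (IH _ (C1c_slice x cw)) _.
  apply: lerD; first exact: lexx.
  apply: ler_wpM2l; first exact: ltW.
  apply: ler_sum => i _.
  by under eq_Rintegral do rewrite partial_slice.
have tP i : tame (seg N) (fun x => \int[lebesgue_rV n]_v (partial (lift ord0 i) w (cons_rV (x, v)) ^+ 2)).
  exact: tame_Rintegral_slice (tame_sqr (tp _)).
rewrite (fubini_rV1 (tame_sqr tw)).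
apply: (@le_trans _ _ (\sum_k \int[leb1]_x (F k x ^+ 2) +
    eta * \sum_i \int[lebesgue_rV n.+1]_x (partial (lift ord0 i) w x ^+ 2))).
  have t1 : tame (seg N) (fun x => \sum_k F k x ^+ 2).
    by apply: tame_sum => k; exact: tame_sqr.
  have t2 : tame (seg N) (fun x => \sum_i \int[lebesgue_rV n]_v (partial (lift ord0 i) w (cons_rV (x, v)) ^+ 2)).
    by apply: tame_sum => i; exact: tP.
  apply: le_trans (tame_le_Rintegral mS S _ (tameD t1 (tameZ eta t2)) slice) _.
    exact: tame_Rintegral_slice (tame_sqr tw).
  rewrite (tame_RintegralD mS S t1 (tameZ eta t2)) (tame_RintegralZ mS S _ t2).
  rewrite (tame_Rintegral_sum mS S _ tP).
  rewrite (tame_Rintegral_sum mS S _ (fun k => tame_sqr (tF k))).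
  rewrite le_eqVlt; apply/orP; left; apply/eqP; congr (_ + _ * _).
  by apply: eq_bigr => i _; rewrite (fubini_rV1 (tame_sqr (tp _))).
rewrite [X in _ <= _ + eta * X]big_ord_recl mulrDr addrA lerD2r.
rewrite (fubini_rV1 (tame_sqr (tp ord0))) -/g.
have cover : Ico (- N) (M%:R * h) = `[- N, 2 * N[%classic.
  suff -> : - N + M%:R * h = 2 * N by [].
  by rewrite /h; field; rewrite gt_eqF.
have key k : \int[leb1]_x (F k x ^+ 2) <=
   \sum_(j < M) (\int[lebesgue_rV n.+1]_x (w x * chi' (k, j) x)) ^+ 2 +
   2 * c k * h ^+ 2 * \int[leb1]_x g x.
  have ms := @mean_value_sum N (F k) g h (c k) h0 (tF k) tg
    (fun a x y Ix Iy => rellich_slice_increment h0 cw (tchi k) Ix Iy) M (- N).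
  have mM : measurable (Ico (- N) (M%:R * h)) by exact: measurable_itv.
  have -> : \int[leb1]_x (F k x ^+ 2) = \int[leb1]_(x in Ico (- N) (M%:R * h)) (F k x ^+ 2).
    rewrite [RHS]Rintegral_mkcond; apply: eq_Rintegral => x _; rewrite patchE.
    case: ifPn => // /negP xM; have [_ F0 _] := tF k; rewrite F0 ?expr0n//= => xN.
    apply: xM; rewrite cover inE /= in_itv/=; move: xN; rewrite ler_norml => /andP[-> xN].
    by rewrite /=; lra.
  apply: le_trans ms _; apply: lerD.
    apply: ler_sum => j _.
    have -> : \int[lebesgue_rV n.+1]_x (w x * chi' (k, j) x) =
        Num.sqrt (2 / h) * \int[leb1]_(x in J j) F k x.
      rewrite (fubini_rV1 (tame_mul tw (tchi' (k, j)))) [X in _ = _ * X]Rintegral_mkcond.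
      have tJ : tame (seg N) (fun x => \1_(J j `&` seg N) x * F k x).
        suff : tame (seg N) (fun x => F k x * \1_(J j `&` seg N) x).
          by congr (tame _ _); apply/funext => x; rewrite mulrC.
        apply: tameM; first exact: tF.
          by apply: measurable_indic; exact: measurableI.
        by exists 1 => x; rewrite indicE; case: (_ \in _); rewrite ?normr1 ?normr0.
      transitivity (\int[leb1]_x (Num.sqrt (2 / h) * (\1_(J j `&` seg N) x * F k x))).
        apply: eq_Rintegral => x _.
        rewrite mulrA. rewrite -(tame_RintegralZ mC C _ (tame_mul (C1c_tame (C1c_slice x cw)) (tchi k))).
        by apply: eq_Rintegral => v _; rewrite chi'E /=; ring.
      rewrite (tame_RintegralZ mS S _ tJ); congr (_ * _).
      apply: eq_Rintegral => x _; rewrite patchE indicE in_setI.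
      case: (x \in J j) => /=; last by rewrite mul0r.
      case: (boolP (x \in seg N)) => [_|/negP Nx]; first by rewrite mul1r.
      by have [_ F0 _] := tF k; rewrite F0 ?mulr0// => xN; apply: Nx; rewrite inE.
    by rewrite exprMn sqr_sqrtr// divr_ge0// ltW.
  apply: ler_wpM2l; first by apply: mulr_ge0 (mulr_ge0 _ (c0 k)) (sqr_ge0 h).
  have iM := tame_seg_integrable mM tg; have iT := tame_seg_integrable measurableT tg.
  rewrite /Rintegral; apply: fine_le.
  - exact: (integrable_fin_num mM iM).
  - exact: (integrable_fin_num measurableT iT).
  apply: ge0_subset_integral => //.
  - by apply/measurable_EFinP; case: tg.
  - by move=> x _; rewrite lee_fin; apply: Rintegral_ge0 => v _; rewrite sqr_ge0.
apply: le_trans (ler_sum _ (fun k _ => key k)) _.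
rewrite big_split/= (pair_bigA _ (fun k j => (\int[lebesgue_rV n.+1]_x (w x * chi' (k, j) x)) ^+ 2))/=.
apply: lerD; first by apply: ler_sum => -[k j] _.
rewrite -mulr_suml -mulr_suml -mulr_sumr; apply: ler_wpM2r => //.
by apply: Rintegral_ge0 => x _; apply: Rintegral_ge0 => v _; rewrite sqr_ge0.
Qed.

End rellich.

(** * Test functions *)

Section smooth.
Variables (R : realType) (d : nat).
Implicit Types f g : 'rV[R]_d -> R.

(** Replaces inductions on lists of derivatives: it is enough to exhibit a class closed under
    differentiation. The list is peeled from its end because [foldr] applies the last index
    first. *)
Lemma smooth_coind (P : ('rV[R]_d -> R) -> Prop) :
  (forall f, P f -> (forall x, differentiable f x) /\ forall i, P (partial i f)) ->
  forall f, P f -> smooth f.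
Proof.
move=> HP f Pf s; elim/last_ind: s f Pf => [|s i IH] f Pf x.
  exact: (HP f Pf).1.
by rewrite foldr_rcons; apply: IH; exact: (HP f Pf).2.
Qed.

Lemma smooth_differentiable f x : smooth f -> differentiable f x.
Proof. by move=> /(_ [::] x). Qed.

Lemma smooth_continuous f : smooth f -> continuous f.
Proof.
by move=> sf x; apply: differentiable_continuous; exact: smooth_differentiable.
Qed.

Lemma smooth_derivable f x v : smooth f -> derivable f x v.
Proof. by move=> sf; apply: diff_derivable; exact: smooth_differentiable. Qed.

Arguments smooth_derivable [f] x v _.

Lemma smooth_partial i f : smooth f -> smooth (partial i f).
Proof. by move=> sf s x; rewrite -foldr_rcons; exact: sf. Qed.

Lemma partialM i f g : smooth f -> smooth g ->
  partial i (fun x => f x * g x) = (fun x => f x * partial i g x + g x * partial i f x).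
Proof.
move=> sf sg; apply/funext => x.
by rewrite [LHS](deriveM (smooth_derivable _ _ sf) (smooth_derivable _ _ sg)).
Qed.

(** By the Leibniz rule the derivatives of a product are sums of products, so products alone are not
    closed under differentiation; the algebra generated by smooth functions is, which [smooth_coind]
    asks for. *)
Inductive smooth_alg : ('rV[R]_d -> R) -> Prop :=
| smooth_alg_base f : smooth f -> smooth_alg f
| smooth_algD f g : smooth_alg f -> smooth_alg g -> smooth_alg (fun x => f x + g x)
| smooth_algM f g : smooth_alg f -> smooth_alg g -> smooth_alg (fun x => f x * g x).

Lemma smooth_alg_smooth f : smooth_alg f -> smooth f.
Proof.
apply: smooth_coind => {}f; elim => {f}.
- move=> f sf; split=> [x|i]; first exact: smooth_differentiable.
  exact/smooth_alg_base/smooth_partial.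
- move=> f g _ [df pf] _ [dg pg]; split=> [x|i]; first exact: differentiableD.
  rewrite (_ : partial _ _ = (fun x => partial i f x + partial i g x)).
    exact: smooth_algD.
  by apply/funext => x; rewrite [LHS](deriveD (diff_derivable (df x)) (diff_derivable (dg x))).
- move=> f g af [df pf] ag [dg pg]; split=> [x|i]; first exact: differentiableM.
  rewrite (_ : partial _ _ = (fun x => f x * partial i g x + g x * partial i f x)).
    by apply: smooth_algD; apply: smooth_algM.
  by apply/funext => x; rewrite [LHS](deriveM (diff_derivable (df x)) (diff_derivable (dg x))).
Qed.

Lemma smoothD f g : smooth f -> smooth g -> smooth (fun x => f x + g x).
Proof. by move=> sf sg; apply: smooth_alg_smooth; apply: smooth_algD; exact: smooth_alg_base. Qed.

Lemma smoothM f g : smooth f -> smooth g -> smooth (fun x => f x * g x).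
Proof. by move=> sf sg; apply: smooth_alg_smooth; apply: smooth_algM; exact: smooth_alg_base. Qed.

Lemma partial_cst i (a : R) : partial i (fun _ : 'rV[R]_d => a) = (fun=> 0).
Proof. by apply/funext => x; rewrite /partial derive_cst. Qed.

Lemma smooth_cst (a : R) : smooth (fun _ : 'rV[R]_d => a).
Proof.
apply: (@smooth_coind (fun f => exists a, f = fun=> a)); last by exists a.
move=> _ [b ->]; split=> [x|i]; first exact: differentiable_cst.
by exists 0; exact: partial_cst.
Qed.

Lemma smoothZ (a : R) f : smooth f -> smooth (fun x => a * f x).
Proof. by move=> sf; apply: smoothM => //; exact: smooth_cst. Qed.

Lemma smoothB f g : smooth f -> smooth g -> smooth (fun x => f x - g x).
Proof.
move=> sf sg; rewrite (_ : (fun x => _) = (fun x => f x + (-1) * g x)).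
  by apply: smoothD => //; exact: smoothZ.
by apply/funext => x; rewrite mulN1r.
Qed.

Lemma smooth_prod n (F : 'I_n -> 'rV[R]_d -> R) : (forall i, smooth (F i)) ->
  smooth (fun x => \prod_i F i x).
Proof.
move=> sF.
suff H s : smooth (fun x => \prod_(i <- s) F i x) by exact: H.
elim: s => [|i s IH].
  by under eq_fun do rewrite big_nil; exact: smooth_cst.
by under eq_fun do rewrite big_cons; exact: smoothM.
Qed.

Lemma partial_comp_coord i k (F : R -> R) (F' : R -> R) :
  (forall t : R, is_derive t 1 F (F' t)) ->
  partial i (fun x : 'rV[R]_d => F (x ord0 k)) =
  (fun x => (i == k)%:R * F' (x ord0 k)).
Proof.
move=> dF; apply/funext => x; rewrite /partial /derive.
have E : (fun h : R => h^-1 *: (((fun x : 'rV[R]_d => F (x ord0 k)) \o shift x) (h *: delta_mx ord0 i) - F (x ord0 k))) =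
  (fun h : R => h^-1 *: ((F \o shift (x ord0 k)) (h *: (i == k)%:R) - F (x ord0 k))).
  apply/funext => h /=; rewrite !mxE eqxx/= (eq_sym k).
  by case: (i == k).
rewrite E; case: (i == k).
  by rewrite mul1r -[RHS](@derive_val _ _ _ _ _ _ _ (dF (x ord0 k))).
rewrite mul0r (_ : (fun h : R => _) = cst 0); first exact: lim_cst.
by apply/funext => h /=; rewrite scaler0 add0r subrr scaler0.
Qed.

Lemma smooth_comp_coord (C : (R -> R) -> Prop) k :
  (forall F, C F -> exists F', C F' /\ forall t : R, is_derive t 1 F (F' t)) ->
  forall F, C F -> smooth (fun x : 'rV[R]_d => F (x ord0 k)).
Proof.
move=> HC F CF.
(* The scalar [a] makes room for the factor [(i == k)%:R] that each differentiation produces. *)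
apply: (@smooth_coind (fun f => exists a F, C F /\ f = (fun x => a * F (x ord0 k)))); last first.
  by exists 1, F; split => //; apply/funext => x; rewrite mul1r.
move=> _ [a [G [CG ->]]]; have [G' [CG' dG]] := HC _ CG.
have dGx x : differentiable (fun x : 'rV[R]_d => G (x ord0 k)) x.
  apply: differentiable_comp; first exact: differentiable_coord.
  by apply/derivable1_diffP; have := dG (x ord0 k) => -[].
split=> [x|i]; first by apply: differentiableM => //; exact: differentiable_cst.
exists (a * (i == k)%:R), G'; split => //; apply/funext => x.
rewrite [LHS](deriveM _ (diff_derivable (dGx x))); last exact: derivable_cst.
rewrite derive_cst scaler0 addr0 -mulrA.
by have := congr1 (fun f => f x) (partial_comp_coord i k dG); rewrite /partial => ->.
Qed.

Lemma smooth_coord k : smooth (fun x : 'rV[R]_d => x ord0 k).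
Proof.
pose C (F : R -> R) := F = id \/ exists a, F = cst a.
have HC F : C F -> exists F', C F' /\ forall t : R, is_derive t 1 F (F' t).
  move=> [->|[a ->]].
    by exists (cst 1); split; [right; exists 1|move=> t; exact: is_derive_id].
  by exists (cst 0); split; [right; exists 0|move=> t; exact: is_derive_cst].
by apply: (smooth_comp_coord k HC (F := id)); left.
Qed.

Lemma partial_coord i k :
  partial i (fun x : 'rV[R]_d => x ord0 k) = (fun=> (i == k)%:R).
Proof.
have did (t : R) : is_derive t 1 (id : R -> R) (cst 1 t) by exact: is_derive_id.
rewrite (partial_comp_coord i k did).
by apply/funext => x; exact: mulr1.
Qed.

End smooth.

(** * Smooth bump functions *)

Section flat.
Variable R : realType.

(* The polynomial factor makes this class of functions, flat at 0, stable under
   differentiation. *)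
Definition flat (c : R) (p : {poly R}) (t : R) : R :=
  if 0 < t then p.[t^-1] * expR (- (c * t^-1)) else 0.

(** With s = 1 / h this bounds by K h the difference quotient at 0 of [flat c p], whose extra factor
    1 / h is the reason why [is_derive_flat] uses the polynomial ['X * p]. *)
Lemma poly_expN_le (c : R) (p : {poly R}) : 0 < c -> exists2 K, 0 <= K &
  forall s, 1 <= s -> `|p.[s] * expR (- (c * s))| <= K * s^-1.
Proof.
move=> c0.
have mono (k : nat) (s : R) : 1 <= s -> s ^+ k * expR (- (c * s)) <= (k.+1%:R / c) ^+ k.+1 * s^-1.
  move=> s1; have s0 : 0 < s by lra.
  (* The power k + 1 of x <= exp x, one more than in s^k: the spare power yields the factor s^-1. *)
  have e1 : (c * s / k.+1%:R) ^+ k.+1 <= expR (c * s).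
    have -> : c * s = k.+1%:R * (c * s / k.+1%:R).
      by rewrite mulrCA mulfV ?mulr1// pnatr_eq0.
    rewrite expRM_natl mulrCA mulfV ?pnatr_eq0// mulr1.
    have q0 : 0 <= c * s / k.+1%:R by rewrite divr_ge0// ltW// mulr_gt0.
    rewrite lerXn2r ?nnegrE ?expR_ge0//.
    by apply: le_trans (expR_ge1Dx _); rewrite lerDr.
  rewrite expRN ler_pdivrMr ?expR_gt0//.
  have -> : s ^+ k = (k.+1%:R / c) ^+ k.+1 * s^-1 * (c * s / k.+1%:R) ^+ k.+1.
    rewrite mulrAC -exprMn.
    have -> : k.+1%:R / c * (c * s / k.+1%:R) = s.
      have k1 : k.+1%:R != 0 :> R by rewrite pnatr_eq0.
      move: k.+1%:R k1 => q q0; field; rewrite q0 gt_eqF//.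
    by rewrite exprSr mulfK// gt_eqF.
  by rewrite ler_wpM2l// mulr_ge0 ?invr_ge0 ?exprn_ge0// ?divr_ge0// ltW.
exists (\sum_(i < size p) `|p`_i| * (i.+1%:R / c) ^+ i.+1).
  by apply: sumr_ge0 => i _; rewrite mulr_ge0 ?exprn_ge0// divr_ge0// ltW.
move=> s s1; rewrite horner_coef mulr_suml mulr_suml.
apply: le_trans (ler_norm_sum _ _ _) _; apply: ler_sum => i _.
rewrite -mulrA normrM -mulrA ler_wpM2l//.
rewrite ger0_norm; first exact: mono.
by rewrite mulr_ge0 ?expR_ge0// exprn_ge0//; lra.
Qed.

(** In the derivative of p(1/t) exp(-c/t) both terms carry t^-2, which is 'X^2 evaluated at 1/t. *)
Definition flat_deriv (c : R) (p : {poly R}) : {poly R} := 'X^2 * (c *: p - p^`()).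

Lemma is_derive_flat (c : R) (p : {poly R}) : 0 < c -> forall t : R,
  is_derive t 1 (flat c p) (flat c (flat_deriv c p) t).
Proof.
move=> c0 t; case: (ltgtP t 0) => t0.
- have -> : flat c (flat_deriv c p) t = 0 by rewrite /flat ltNge ltW.
  apply: (@near_eq_is_derive _ _ _ (cst 0 : R -> R)).
  near=> s; rewrite /flat ltNge ltW//=.
  by near: s; exact: lt_nbhsl.
- pose G s : R := p.[s] * expR (- (c * s)).
  have dE s : is_derive (s : R) 1 (fun s : R => expR (- (c * s))) (- c * expR (- (c * s))).
    have dL : is_derive (s : R) 1 (fun s : R => - (c * s)) (- c).
      have := is_deriveN (is_deriveZ c (is_derive_id s (1 : R))).
      by rewrite /GRing.scale/= mulr1.
    by rewrite mulrC; exact: (is_derive1_comp (f := expR) (is_derive_expR _) dL).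
  have dG s : is_derive (s : R) 1 G (p.[s] * (- c * expR (- (c * s))) + expR (- (c * s)) * p^`().[s]).
    by have := is_deriveM (is_derive_poly p s) (dE s); apply.
  apply: (@near_eq_is_derive _ _ _ (fun t : R => G t^-1)).
    near=> s; rewrite /flat ifT//.
    by near: s; exact: lt_nbhsr.
  have tn0 : t != 0 by rewrite gt_eqF.
  have dV : is_derive t 1 (fun t : R => t^-1) (- t ^- 2 *: 1).
    exact: (@is_deriveV _ id t 1 1 tn0 (is_derive_id t (1 : R))).
  have := is_derive1_comp (dG t^-1) dV; congr (is_derive _ _ _ _).
  rewrite /flat t0 /flat_deriv hornerM hornerXn hornerD hornerZ hornerN /GRing.scale/=.
  by rewrite exprVn; ring.
- rewrite t0 (_ : flat _ _ 0 = 0); last by rewrite /flat ltxx.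
  have [K K0 HK] := poly_expN_le ('X * p) c0.
  have lim0 : h^-1 *: ((flat c p \o shift 0) (h *: 1) - flat c p 0) @[h --> 0^'] --> (0 : R).
    apply/cvgrPdist_le => e e0.
    have eK : 0 < e / (K + 1) by rewrite divr_gt0// ltr_wpDl.
    near=> h.
    have h1 : `|h| <= 1 by near: h; exact: dnbhs0_le.
    have he : `|h| <= e / (K + 1) by near: h; exact: dnbhs0_le.
    rewrite sub0r normrN /= addr0 /GRing.scale/= mulr1 {2}/flat ltxx subr0.
    rewrite /flat; case: ifPn => h0; last by rewrite mulr0 normr0 ltW.
    have h1' : 1 <= h^-1 by rewrite invf_ge1//; apply: le_trans h1; exact: ler_norm.
    have := HK _ h1'; rewrite hornerM hornerX mulrA invrK => /le_trans; apply.
    apply: (@le_trans _ _ ((K + 1) * `|h|)).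
      by rewrite (gtr0_norm h0) ler_wpM2r// ?ltW// ltrDl.
    by rewrite mulrC -ler_pdivlMr// ltr_wpDl.
  split; first by apply/cvg_ex; exists 0.
  by apply/cvg_lim.
Unshelve. all: by end_near. Qed.

End flat.

Section bump.
Variables (R : realType) (d : nat).
Implicit Types (Omega : set 'rV[R]_d).

Definition cbox n (a b : 'I_n -> R) : set 'rV[R]_n :=
  [set x | forall i, a i <= x ord0 i <= b i].

Lemma compact_cbox (a b : 'I_d -> R) : compact (cbox a b).
Proof.
apply: bounded_closed_compact; last first.
  have -> : cbox a b = \bigcap_(i : 'I_d) ((fun x : 'rV[R]_d => x ord0 i) @^-1` `[a i, b i]%classic).
    apply/seteqP; split => x H.
      by move=> i _ /=; rewrite in_itv /=; exact: H.
    by move=> i; have := H i I; rewrite /= in_itv/=.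
  apply: closed_bigI => i _; apply: preimage_closed; last exact: interval_closed.
  by move=> x _; exact: coord_continuous.
pose N := \sum_i (`|a i| + `|b i|).
exists N; split; first by apply: num_real.
move=> M NM x Hx; apply: le_trans (ltW NM).
have N0 : 0 <= N by apply: sumr_ge0 => i _; rewrite addr_ge0.
have HN j : `|x ord0 j| <= N.
  apply: (@le_trans _ _ (`|a j| + `|b j|)); last first.
    by rewrite /N (bigD1 j)//= lerDl; apply: sumr_ge0 => i _; rewrite addr_ge0.
  have /andP[h1 h2] := Hx j; rewrite ler_norml.
  have := ler_norm (- a j); rewrite normrN => h3; have := ler_norm (b j) => h4.
  have := normr_ge0 (a j); have := normr_ge0 (b j); lra.
move: N N0 HN {NM Hx} => N N0 HN.
rewrite /Num.Def.normr /= mx_normrE; apply: bigmax_le => // -[i j] _ /=.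
by rewrite ord1; exact: HN.
Qed.

Lemma test_smooth Omega z : test_function Omega z -> smooth z.
Proof. by case. Qed.

Lemma test0 Omega : test_function Omega (fun=> 0).
Proof.
split; first exact: smooth_cst.
by exists set0; split => //; exact: compact0.
Qed.

Lemma testMr Omega z f : test_function Omega z -> smooth f ->
  test_function Omega (fun x => z x * f x).
Proof.
move=> [sz [K [cK KO zK]]] sf; split; first exact: smoothM.
by exists K; split => // x Kx; rewrite zK// mul0r.
Qed.

Lemma testMl Omega z f : test_function Omega z -> smooth f ->
  test_function Omega (fun x => f x * z x).
Proof.
by move=> tz sf; under eq_fun do rewrite mulrC; exact: testMr.
Qed.

Lemma testD Omega z w : test_function Omega z -> test_function Omega w ->
  test_function Omega (fun x => z x + w x).
Proof.
move=> [sz [K [cK KO zK]]] [sw [L [cL LO wL]]]; split; first exact: smoothD.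
exists (K `|` L); split; [exact: compactU|by move=> x []; [exact: KO|exact: LO]|].
by move=> x /not_orP[Kx Lx]; rewrite zK// wL// addr0.
Qed.

Lemma testZ Omega a z : test_function Omega z -> test_function Omega (fun x => a * z x).
Proof. by move=> tz; apply: testMl => //; exact: smooth_cst. Qed.

Lemma test_partial Omega i z : test_function Omega z -> test_function Omega (partial i z).
Proof.
move=> [sz [K [cK KO zK]]]; split; first exact: smooth_partial.
exists K; split => // x Kx; rewrite /partial.
rewrite (_ : 'D__ z x = 'D_(delta_mx ord0 i) (cst 0) x); first by rewrite derive_cst.
apply: near_eq_derive.
have oK : open (~` K) by apply: closed_openC; apply: compact_closed => //; exact: norm_hausdorff.
have : nbhs x (~` K) by apply: open_nbhs_nbhs; split.
by apply: filterS => y Ky; rewrite zK.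
Qed.

(** The parameter c serves twice: as it tends to 0 the bumps converge to the indicator of the box
    ([cvg_bump]), and halving it takes the square root ([bump_sqr]). *)
Definition bumpf (c : R) (a b : 'I_d -> R) (x : 'rV[R]_d) : R :=
  \prod_i (flat c 1 (x ord0 i - a i) * flat c 1 (b i - x ord0 i)).

Lemma smooth_bump c a b : 0 < c -> smooth (bumpf c a b).
Proof.
move=> c0; apply: smooth_prod => i.
(* Both orientations are needed for the two factors of a bump; the sign due to the reflection goes
   into the polynomial. *)
pose C (F : R -> R) := exists p, F = (fun t => flat c p (t - a i)) \/ F = (fun t => flat c p (b i - t)).
have HC F : C F -> exists F', C F' /\ forall t : R, is_derive t 1 F (F' t).
  move=> [p [->|->]].
    exists (fun t => flat c (flat_deriv c p) (t - a i)); split.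
      by exists (flat_deriv c p); left.
    move=> t; have d1 : is_derive t 1 (fun t : R => t - a i) 1.
      have := is_deriveB (is_derive_id t (1 : R)) (is_derive_cst (a i) t (1 : R)).
      by rewrite subr0.
    by have := is_derive1_comp (f := flat c p) (g := fun t => t - a i) (is_derive_flat p c0 (t - a i)) d1; rewrite mulr1.
  exists (fun t => flat c (- flat_deriv c p) (b i - t)); split.
    by exists (- flat_deriv c p); right.
  move=> t; have d1 : is_derive t 1 (fun t : R => b i - t) (-1).
    have := is_deriveB (is_derive_cst (b i) t (1 : R)) (is_derive_id t (1 : R)).
    by rewrite sub0r.
  have := is_derive1_comp (f := flat c p) (g := fun t => b i - t) (is_derive_flat p c0 (b i - t)) d1; congr (is_derive _ _ _ _).
  by rewrite /flat; case: ifP => _; rewrite ?mul0r// hornerN mulrN1 mulNr.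
apply: smoothM.
  apply: (smooth_comp_coord i HC (F := fun t => flat c 1 (t - a i))).
  by exists 1; left.
apply: (smooth_comp_coord i HC (F := fun t => flat c 1 (b i - t))).
by exists 1; right.
Qed.

Lemma bump_out c a b x : ~ obox a b x -> bumpf c a b x = 0.
Proof.
move=> /existsNP[i Hi]; rewrite /bumpf (bigD1 i)//= /flat !subr_gt0.
case: (ltP (a i) (x ord0 i)) => h1; last by rewrite !mul0r.
case: (ltP (x ord0 i) (b i)) => h2; last by rewrite mulr0 mul0r.
by exfalso; apply: Hi; rewrite h1 h2.
Qed.

Lemma test_bump Omega c a b : 0 < c -> cbox a b `<=` Omega ->
  test_function Omega (bumpf c a b).
Proof.
move=> c0 abO; split; first exact: smooth_bump.
exists (cbox a b); split => //; first exact: compact_cbox.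
move=> x nx; apply: bump_out => ox; apply: nx => i.
by have /andP[/ltW -> /ltW ->] := ox i.
Qed.

Lemma flat_ge0 (c t : R) : 0 <= flat c 1 t.
Proof. by rewrite /flat; case: ifP => // _; rewrite hornerC mul1r expR_ge0. Qed.

Lemma flat_le1 (c t : R) : 0 < c -> flat c 1 t <= 1.
Proof.
move=> c0; rewrite /flat; case: ifP => // t0; rewrite hornerC mul1r -expR0 ler_expR.
by rewrite oppr_le0 mulr_ge0 ?invr_ge0 ?ltW.
Qed.

Lemma flat_sqr (c t : R) : flat (c / 2) 1 t ^+ 2 = flat c 1 t.
Proof.
rewrite /flat; case: ifP => _; last by rewrite expr0n.
rewrite hornerC !mul1r expr2 -expRD; congr expR; lra.
Qed.

Lemma bump_ge0 c a b x : 0 <= bumpf c a b x.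
Proof. by apply: prodr_ge0 => i _; rewrite mulr_ge0// flat_ge0. Qed.

Lemma bump_le1 c a b x : 0 < c -> bumpf c a b x <= 1.
Proof.
move=> c0; apply: prodr_ile1 => i _; apply/andP; split.
  by rewrite mulr_ge0// flat_ge0.
by rewrite mulr_ile1 ?flat_ge0 ?flat_le1.
Qed.

Lemma bump_sqr c a b x : bumpf c a b x = bumpf (c / 2) a b x * bumpf (c / 2) a b x.
Proof.
rewrite -expr2 -prodrXl; apply: eq_bigr => i _.
by rewrite exprMn !flat_sqr.
Qed.

Lemma cvg_flat (t : R) : flat n.+1%:R^-1 1 t @[n --> \oo] --> (if 0 < t then 1 else 0 : R).
Proof.
rewrite /flat; case: ifP => t0; last exact: cvg_cst.
under eq_fun do rewrite hornerC mul1r.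
have h : - (n.+1%:R^-1 * t^-1) @[n --> \oo] --> (0 : R).
  have : - (n.+1%:R^-1 * t^-1) @[n --> \oo] --> (- (0 * t^-1) : R).
    by apply: cvgN; apply: cvgMl; exact: cvg_harmonic.
  by rewrite mul0r oppr0.
by have := cvg_comp _ _ h (@continuous_expR R 0); rewrite expR0; exact.
Qed.

Lemma cvg_bump a b x : bumpf n.+1%:R^-1 a b x @[n --> \oo] --> (\1_(obox a b) x : R).
Proof.
have -> : \1_(obox a b) x = \prod_i ((if 0 < x ord0 i - a i then 1 else 0) *
    (if 0 < b i - x ord0 i then 1 else 0)) :> R.
  rewrite indicE; case: (boolP (x \in obox a b)) => [|/negP] xab.
    rewrite big1// => i _; move: xab; rewrite inE => /(_ i) /andP[h1 h2].
    by rewrite !subr_gt0 h1 h2 mulr1.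
  have /existsNP[i Hi] : ~ obox a b x by move=> h; apply: xab; rewrite inE.
  rewrite (bigD1 i)//= !subr_gt0.
  case: (ltP (a i) (x ord0 i)) => h1; last by rewrite !mul0r.
  case: (ltP (x ord0 i) (b i)) => h2; last by rewrite mulr0 mul0r.
  by exfalso; apply: Hi; rewrite h1 h2.
apply: cvg_big; first exact: mul_continuous.
by move=> i _; apply: cvgM; exact: cvg_flat.
Qed.

End bump.

(** * Density of test functions in L^2 *)

Section borel.
Variables (R : realType) (d : nat).

(** Presents the measurable sets as generated by the open sets, a family stable under intersection,
    as [dynkin_induction] requires in [VS_measurable]. *)
Lemma measurable_rVE : @measurable _ 'rV[R]_d = <<s @open 'rV[R]_d >>.
Proof.
apply/seteqP; split; last first.
  apply: smallest_sub; first exact: sigma_algebra_measurable.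
  exact: open_measurable_rV.
rewrite [X in X `<=` _](_ : _ = g_sigma_preimage (@rV_coord R d))//.
apply: smallest_sub; first exact: smallest_sigma_algebra.
apply: (big_ind (fun X => X `<=` <<s @open 'rV[R]_d >>)).
- by [].
- by move=> A B HA HB x [/HA|/HB].
move=> i _ _ [B mB <-]; rewrite setTI.
have [s0 sC sU] := smallest_sigma_algebra setT (@open 'rV[R]_d).
suff : <<s @RGenOpens.G R >> `<=` [set B | <<s @open 'rV[R]_d >> (rV_coord i @^-1` B)].
  by apply; rewrite -[<<s _ >>](RGenOpens.measurableE R).
apply: smallest_sub.
  split => /=; first by rewrite preimage_set0.
  - by move=> A HA; rewrite setTD preimage_setC -setTD; exact: sC.
  - by move=> F HF; rewrite preimage_bigcup; exact: sU.
move=> _ [a [b ->]] /=; apply: sub_gen_smallest.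
apply: open_comp; last exact: interval_open.
by move=> x _; exact: coord_continuous.
Qed.

End borel.

Section density.
Variables (R : realType) (d : nat) (Omega : set 'rV[R]_d).
Hypothesis oO : open Omega.
Local Notation leb := (@lebesgue_rV R d).
Hypothesis ltyO : (leb Omega < +oo)%E.
Local Notation sqint := (sqint leb Omega).
Local Notation ip := (l2dot leb Omega).
Let mO : measurable Omega := open_measurable_rV oO.

Lemma bounded_sqint (f : 'rV[R]_d -> R) K : measurable_fun Omega f ->
  (forall x, Omega x -> `|f x| <= K) -> sqint f.
Proof.
move=> mf fK; apply: (sqint_dom mO (g := fun=> K)) => //.
  by move=> x Ox; apply: le_trans (fK x Ox) (ler_norm _).
split; first exact: measurable_cst.
by apply: measurable_bounded_integrable => //; exact: bounded_cst.
Qed.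

Lemma dominated_dist (f : nat -> 'rV[R]_d -> R) (h G : 'rV[R]_d -> R) :
  (forall n, sqint (f n)) -> sqint h -> sqint G ->
  (forall n x, Omega x -> `|h x - f n x| <= G x) ->
  (forall x, Omega x -> f n x @[n --> \oo] --> h x) ->
  forall e : R, 0 < e -> exists n, ip (fun x => h x - f n x) (fun x => h x - f n x) <= e.
Proof.
move=> sf sh sG fG fh e e0.
have shf n := sqintB mO sh (sf n).
have [] := @dominated_convergence _ _ _ leb Omega mO
  (fun n x => ((h x - f n x) ^+ 2)%:E) (cst 0%E) (fun x => (G x ^+ 2)%:E).
- by move=> n; apply/measurable_EFinP/measurable_funX; case: (shf n).
- exact: measurable_cst.
- apply: aeW => x Ox /=; apply: cvg_EFin; first exact: nearW.
  have h1 : h x - f n x @[n --> \oo] --> (0 : R).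
    by rewrite -(subrr (h x)); apply: cvgB; [exact: cvg_cst|exact: fh].
  have c2 : (h x - f n x) ^+ 2 @[n --> \oo] --> (0 : R).
    rewrite (_ : (fun n => (h x - f n x) ^+ 2) =
      (fun n => h x - f n x) \* (fun n => h x - f n x)); last first.
      by apply/funext => n /=; rewrite expr2.
    by rewrite -(mulr0 0); exact: cvgM.
  exact: c2.
- by case: sG.
- apply: aeW => x n Ox /=; rewrite lee_fin ger0_norm ?sqr_ge0//.
  rewrite -real_normK ?num_real// lerXn2r ?nnegrE ?(fG n x Ox)//.
  exact: le_trans (fG n x Ox).
move=> _ _; rewrite integral0 => /fine_cvg/= H.
have /cvgrPdist_le/(_ e e0) [N _ /(_ N (leqnn N))] := H.
by rewrite sub0r normrN /= -(ipEFin mO (shf N))/= ger0_norm ?ip_ge0//; exists N.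
Qed.

Variable V : set ('rV[R]_d -> R).
Hypothesis Vsq : forall f, V f -> sqint f.
Hypothesis Vlin : forall a b f g, V f -> V g -> V (fun x => a * f x + b * g x).
Hypothesis Vlim : forall h, sqint h ->
  (forall e : R, 0 < e -> exists f, V f /\ ip (fun x => h x - f x) (fun x => h x - f x) <= e) -> V h.
(* Products suffice because [bumpf c a b] is the square of [bumpf (c / 2) a b]. *)
Hypothesis Vtest : forall chi a, test_function Omega chi -> test_function Omega a ->
  V (fun x => chi x * a x).

Let Vcvg (f : nat -> 'rV[R]_d -> R) h G : (forall n, V (f n)) -> sqint h -> sqint G ->
  (forall n x, Omega x -> `|h x - f n x| <= G x) ->
  (forall x, Omega x -> f n x @[n --> \oo] --> h x) -> V h.
Proof.
move=> Vf sh sG fG fh; apply: Vlim => // e e0.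
have [n Hn] := dominated_dist (fun n => Vsq (Vf n)) sh sG fG fh e0.
by exists (f n).
Qed.

Let Veq f h : V f -> (forall x, Omega x -> f x = h x) -> V h.
Proof.
move=> Vf fh; apply: (@Vcvg (fun=> f) h (fun=> 0)) => //.
- have sf := Vsq Vf; apply: (sqint_dom mO _ _ sf) => [|x Ox]; last by rewrite fh.
  by apply: eq_measurable_fun (sf.1) => x; rewrite inE => Ox; exact: fh.
- exact: sqint0.
- by move=> n x Ox; rewrite fh// subrr normr0.
- by move=> x Ox; rewrite fh//; exact: cvg_cst.
Qed.

Let V0 : V (fun=> 0).
Proof.
apply: (@Veq (fun x => 0 * 0)); last by move=> x _; rewrite mulr0.
by apply: Vtest; exact: test0.
Qed.

Let VS (A : set 'rV[R]_d) := V (\1_(A `&` Omega)).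

Let sqint_indic (A : set 'rV[R]_d) : measurable A -> sqint (\1_A).
Proof.
move=> mA; apply: (@bounded_sqint _ 1); first exact: measurable_indic.
by move=> x _; rewrite indicE; case: (_ \in _); rewrite ?normr1 ?normr0.
Qed.

Let indic_dist (A B : set 'rV[R]_d) x : `|\1_A x - \1_B x| <= 1 :> R.
Proof.
rewrite !indicE; case: (_ \in _); case: (_ \in _);
  by rewrite ?subrr ?subr0 ?sub0r ?normrN ?normr1 ?normr0.
Qed.

Let sqint1 : sqint (fun=> 1).
Proof. by apply: (@bounded_sqint _ 1) => [|x _]; [exact: measurable_cst|rewrite normr1]. Qed.

Let VS_bigcup (F : nat -> set 'rV[R]_d) : (forall k, measurable (F k)) ->
  (forall n, VS (\big[setU/set0]_(k < n) F k)) -> VS (\bigcup_k F k).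
Proof.
move=> mF VF; apply: (Vcvg VF) sqint1 _ _.
- by apply: sqint_indic; apply: measurableI => //; exact: bigcup_measurable.
- by move=> n x Ox; exact: indic_dist.
move=> x Ox; apply: cvg_near_cst.
have [[k _ Fk]|nF] := pselect ((\bigcup_k F k) x).
  exists k.+1 => // n /= kn; rewrite !indicE !mem_set//; split => //; first by exists k.
  by rewrite -bigcup_mkord; exists k.
apply: nearW => n; rewrite !indicE !memNset//; first by case.
by rewrite -bigcup_mkord => -[[k _ Fk] _]; apply: nF; exists k.
Qed.

Let good (S : set 'rV[R]_d) := S = set0 \/ exists a b, S = obox a b /\ cbox a b `<=` Omega.

Let good_measurable S : good S -> measurable S.
Proof. by move=> [->//|[a [b [-> _]]]]; exact: measurable_obox. Qed.

Let good_VS S : good S -> VS S.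
Proof.
move=> [->|[a [b [-> abO]]]].
  by apply: (Veq V0) => x _; rewrite set0I indic0.
apply: (@Vcvg (fun n => bumpf n.+1%:R^-1 a b) (\1_(obox a b `&` Omega)) (fun=> 1)) => //.
- move=> n; have n0 : 0 < n.+1%:R^-1 / 2 :> R by rewrite divr_gt0// invr_gt0.
  apply: (@Veq (fun x => bumpf (n.+1%:R^-1 / 2) a b x * bumpf (n.+1%:R^-1 / 2) a b x)).
    by apply: Vtest; exact: test_bump.
  by move=> x _; rewrite [RHS]bump_sqr.
- by apply: sqint_indic; apply: measurableI => //; exact: measurable_obox.
- move=> n x Ox; have n0 : 0 < n.+1%:R^-1 :> R by rewrite invr_gt0.
  have := bump_ge0 n.+1%:R^-1 a b x; have := @bump_le1 _ _ n.+1%:R^-1 a b x n0.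
  rewrite indicE; case: (_ \in _) => h1 h2; rewrite ler_norml ?mulr1n ?mulr0n; apply/andP; split; lra.
- move=> x Ox; rewrite (_ : \1_(_ `&` _) x = \1_(obox a b) x); first exact: cvg_bump.
  by rewrite !indicE in_setI (mem_set Ox) andbT.
Qed.

Let goodI S T : good S -> good T -> good (S `&` T).
Proof.
move=> [->|[a [b [-> abO]]]]; first by rewrite set0I; left.
move=> [->|[a' [b' [-> abO']]]]; first by rewrite setI0; left.
right; exists (fun i => Num.max (a i) (a' i)), (fun i => Num.min (b i) (b' i)); split.
  apply/seteqP; split => x.
    by move=> [h1 h2] i; rewrite gt_max lt_min; have /andP[-> ->] := h1 i; have /andP[-> ->] := h2 i.
  by move=> h; split => i; have := h i; rewrite gt_max lt_min => /andP[/andP[? ?] /andP[? ?]]; apply/andP.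
by move=> x hx; apply: abO => i; have := hx i; rewrite ge_max le_min => /andP[/andP[? ?] /andP[? ?]]; apply/andP.
Qed.

Let VS_setU A B : VS A -> VS B -> VS (A `&` B) -> VS (A `|` B).
Proof.
move=> VA VB VAB.
apply: (@Veq (fun x => 1 * (1 * \1_(A `&` Omega) x + 1 * \1_(B `&` Omega) x) + (-1) * \1_(A `&` B `&` Omega) x)).
  by apply: Vlin => //; exact: Vlin.
move=> x Ox; rewrite !indicE !in_setI in_setU (mem_set Ox) !andbT.
by case: (x \in A); case: (x \in B) => /=; ring.
Qed.

(** Inclusion-exclusion: an intersection of boxes is a box, so the induction hypothesis also applies
    to the family cut with its last member. *)
Let VS_union n (F : nat -> set 'rV[R]_d) : (forall k, good (F k)) ->
  VS (\big[setU/set0]_(k < n) F k).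
Proof.
elim: n F => [|n IH] F gF; first by rewrite big_ord0; apply: good_VS; left.
rewrite big_ord_recr/=; apply: VS_setU; [exact: IH|exact: good_VS|].
rewrite -bigcup_mkord setI_bigcupl bigcup_mkord.
by apply: (IH (fun k => F k `&` F n)) => k; exact: goodI.
Qed.

Let VS_open U : open U -> VS U.
Proof.
move=> oU.
(* Intersecting with [Omega] first puts the closed boxes inside [Omega], where their bumps are test
   functions. *)
have [F [UF gF]] := open_obox (openI oU oO).
have VU : VS (U `&` Omega); last first.
  by apply: (Veq VU) => x Ox; rewrite !indicE !in_setI (mem_set Ox) !andbT.
pose F' n := if unpickle n is Some k then F k else set0.
have gF' n : good (F' n).
  rewrite /F'; case: unpickle => [k|]; last by left.
  have [->|[a [b [-> abU]]]] := gF k; [by left|right].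
  by exists a, b; split => // x /abU[].
have -> : U `&` Omega = \bigcup_n F' n.
  rewrite UF; apply/seteqP; split => x.
    by move=> [k _ Fk]; exists (pickle k) => //; rewrite /F' pickleK.
  by move=> [n _]; rewrite /F'; case: unpickle => // k Fk; exists k.
apply: VS_bigcup => [k|n]; first exact: good_measurable.
exact: VS_union.
Qed.

Let VS_measurable A : measurable A -> VS A.
Proof.
rewrite measurable_rVE; apply: (dynkin_induction (@measurable_rVE R d)).
- by move=> U W oU oW; exact: openI.
- exact: VS_open openT.
- exact: VS_open.
- move=> S mS VSS; apply: (@Veq (fun x => 1 * \1_(setT `&` Omega) x + (-1) * \1_(S `&` Omega) x)).
    by apply: Vlin => //; exact: VS_open openT.
  move=> x Ox; rewrite !indicE !in_setI in_setC in_setT (mem_set Ox) !andbT.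
  by case: (x \in S) => /=; ring.
- move=> F mF tF VF; apply: VS_bigcup => //; elim=> [|n IH].
    by rewrite big_ord0; apply: good_VS; left.
  rewrite big_ord_recr/=; apply: VS_setU => //.
  rewrite (_ : _ `&` _ = set0); first by apply: good_VS; left.
  rewrite -bigcup_mkord setI_bigcupl bigcup0// => k /= kn.
  by move/trivIsetP : tF; apply => //; rewrite ltn_eqF.
Qed.

Let Vsum I (s : seq I) (F : I -> 'rV[R]_d -> R) : (forall i, V (F i)) ->
  V (fun x => \sum_(i <- s) F i x).
Proof.
move=> VF; elim: s => [|i s IH]; first by apply: (Veq V0) => x _; rewrite big_nil.
apply: (Veq (Vlin 1 1 (VF i) IH)) => x _; by rewrite big_cons !mul1r.
Qed.

Import HBNNSimple.

Let V_nnsfun (f : {nnsfun 'rV[R]_d >-> R}) : V f.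
Proof.
(* The zero term gives each summand the shape a f + b g of [Vlin]. *)
apply: (@Veq (fun x => \sum_(y <- finmap.enum_fset (fset_set (range f)))
    (y * \1_((f @^-1` [set y]) `&` Omega) x +
     0 * (y * \1_((f @^-1` [set y]) `&` Omega) x)))).
  apply: Vsum => y; have Vy := VS_measurable (measurable_sfunP f (measurable_set1 y)).
  apply: (Veq (Vlin y 0 Vy Vy)) => x _; by rewrite !mul0r.
move=> x Ox; rewrite (fimfunE f) fsbig_finite//.
apply: eq_bigr => y _; rewrite mul0r addr0; congr (_ * _).
by rewrite !indicE in_setI (mem_set Ox) andbT.
Qed.

Let V_ge0 h : sqint h -> (forall x, 0 <= h x) -> V h.
Proof.
move=> sh h0; have [mh _] := sh.
have mh' : measurable_fun Omega (EFin \o h) by exact/measurable_EFinP.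
pose g := nnsfun_approx mO mh'.
have gh n x : Omega x -> g n x <= h x.
  move=> Ox; rewrite -lee_fin /g nnsfun_approxE; apply: le_approx => // y Oy.
  by rewrite lee_fin.
apply: (@Vcvg (fun n => g n) h h) => //.
- by move=> n x Ox; rewrite ger0_norm ?subr_ge0 ?gh// gerBl.
- move=> x Ox; have := @cvg_nnsfun_approx _ _ _ Omega mO _ mh' (fun x _ => h0 x) x Ox.
  by move/fine_cvg.
Qed.

(** Density phrased as an induction principle, [V] being the property to prove. It climbs from boxes
    to finite unions, open sets, Borel sets, simple functions and nonnegative functions, each limit
    being a dominated one. *)
Lemma density_ind h : sqint h -> V h.
Proof.
move=> sh; have [mh _] := sh.
have sp : sqint (fun x => Num.max (h x) 0).
  apply: sqint_dom sh => //; first exact: measurable_maxr.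
  by move=> x _; rewrite ger0_norm ?le_max ?lexx ?orbT// ge_max ler_norm normr_ge0.
have sn : sqint (fun x => Num.max (- h x) 0).
  apply: sqint_dom sh => //; first by apply: measurable_maxr => //; exact: measurableT_comp.
  by move=> x _; rewrite ger0_norm ?le_max ?lexx ?orbT// ge_max -normrN ler_norm normr_ge0.
apply: (Veq (Vlin 1 (-1) (V_ge0 sp _) (V_ge0 sn _))).
- by move=> x; rewrite le_max lexx orbT.
- by move=> x; rewrite le_max lexx orbT.
move=> x _; case: (boolP (0 <= h x)) => hx.
  by rewrite (max_l hx) max_r ?oppr_le0// mulr0 addr0 mul1r.
have {}hx : h x <= 0 by rewrite ltW// ltNge.
by rewrite (max_r hx) max_l ?oppr_ge0//; ring.
Qed.

End density.

(** * Sobolev spaces *)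

Lemma sqrtr_le (R : realType) (x y : R) : 0 <= y -> x <= y ^+ 2 -> Num.sqrt x <= y.
Proof. by move=> y0 xy; rewrite -(ger0_norm y0) -sqrtr_sqr; apply: ler_wsqrtr. Qed.

Lemma cvg_sqr (R : realType) (T : Type) (F : set_system T) {FF : Filter F} (f : T -> R) (a : R) :
  f x @[x --> F] --> a -> f x ^+ 2 @[x --> F] --> a ^+ 2.
Proof.
move=> fa; rewrite (_ : (fun x => f x ^+ 2) = f \* f); first by rewrite expr2; exact: cvgM.
by apply/funext => x; rewrite expr2.
Qed.

Section sobolev.
Variables (R : realType) (d : nat) (Omega : set 'rV[R]_d).
Hypothesis oO : open Omega.
Hypothesis bO : bounded_set Omega.
Local Notation leb := (@lebesgue_rV R d).
Local Notation sqint := (sqint leb Omega).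
Local Notation ip := (l2dot leb Omega).
Local Notation dist f g := (ip (fun x => f x - g x) (fun x => f x - g x)).
Local Notation gr u i := (fun x => wgrad Omega u x ord0 i).
Local Notation grad u := (fun (i : 'I_d) x => wgrad Omega u x ord0 i).
Local Notation test := (test_function Omega).
Implicit Types (u v w z f g h : 'rV[R]_d -> R).
Let mO : measurable Omega := open_measurable_rV oO.
Local Hint Resolve mO : core.

Lemma bounded_measure_lty : (leb Omega < +oo)%E.
Proof.
have [N [_ ON]] := bounded_set_cube bO.
apply: le_lt_trans (lebesgue_cube d N); apply: le_measure; rewrite ?inE//.
exact: measurable_cube.
Qed.

(* Almost everywhere equality in Omega, phrased by duality *)
Definition eqv f g := [/\ sqint f, sqint g & forall h, sqint h -> ip f h = ip g h].

Lemma eqv_ip f g f' g' : eqv f f' -> eqv g g' -> ip f g = ip f' g'.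
Proof. by move=> [_ sf' fE] [sg sg' gE]; rewrite fE// ipC gE// ipC. Qed.

Lemma eqv_refl f : sqint f -> eqv f f. Proof. by []. Qed.

Lemma eqv_sym f g : eqv f g -> eqv g f.
Proof. by move=> [sf sg H]; split => // h sh; rewrite H. Qed.

Lemma eqv_lin a b f g f' g' : eqv f f' -> eqv g g' ->
  eqv (fun x => a * f x + b * g x) (fun x => a * f' x + b * g' x).
Proof.
move=> [sf sf' fE] [sg sg' gE]; split; [exact: sqint_lin..|].
by move=> h sh; rewrite !ip_linl// fE// gE.
Qed.

Lemma smooth_bounded w : smooth w -> exists K, forall x, Omega x -> `|w x| <= K.
Proof.
move=> sw; have [N [_ ON]] := bounded_set_cube bO.
have /compact_bounded[M [_ HM]] : compact [set w x | x in @cube R d N].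
  apply: continuous_compact; last exact: compact_cube.
  by apply: continuous_subspaceT; exact: smooth_continuous.
exists (`|M| + 1) => x Ox.
by apply: HM; [rewrite (le_lt_trans (ler_norm M))// ltrDl|exists x => //; exact: ON].
Qed.

Lemma smooth_measurable w : smooth w -> measurable_fun Omega w.
Proof. by move=> sw; apply: continuous_measurable_rV; exact: smooth_continuous. Qed.

Lemma smooth_sqint w : smooth w -> sqint w.
Proof.
move=> sw; have [K HK] := smooth_bounded sw.
by apply: (bounded_sqint oO bounded_measure_lty _ HK); exact: smooth_measurable.
Qed.

Lemma smooth_mul_sqint w f : smooth w -> sqint f -> sqint (fun x => w x * f x).
Proof.
move=> sw sf; have [K HK] := smooth_bounded sw.
by apply: (sqint_bounded_mul mO _ HK sf); exact: smooth_measurable.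
Qed.

Lemma ip_mul_le (K : R) w f : smooth w -> (forall x, Omega x -> `|w x| <= K) -> sqint f ->
  ip (fun x => w x * f x) (fun x => w x * f x) <= K ^+ 2 * ip f f.
Proof.
move=> sw HK sf.
have -> : K ^+ 2 * ip f f = ip (fun x => K * f x) (fun x => K * f x).
  by rewrite (ipZl mO _ sf (sqintZ mO _ sf)) (ipZr mO _ sf sf) mulrA.
apply: (le_ip mO (smooth_mul_sqint sw sf) (sqintZ mO _ sf)) => x Ox.
rewrite !exprMn ler_wpM2r ?sqr_ge0// -real_normK ?num_real//.
by rewrite lerXn2r ?nnegrE ?HK// (le_trans _ (HK x Ox)).
Qed.

Lemma test_sqint z : test z -> sqint z.
Proof. by move=> [sz _]; exact: smooth_sqint. Qed.

Lemma test_C1c N z : test z -> Omega `<=` cube N -> C1c N z.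
Proof.
move=> [sz [K [cK KO zK]]] ON; split.
- exact: smooth_continuous.
- by move=> x nx; apply: zK => Kx; apply: nx; apply: ON; exact: KO.
- by move=> i x; exact: smooth_derivable.
- by move=> i; apply: smooth_continuous; exact: smooth_partial.
Qed.

Lemma Rintegral_out f : (forall x, ~ Omega x -> f x = 0) ->
  \int[leb]_(x in Omega) f x = \int[leb]_x f x.
Proof.
move=> f0; rewrite Rintegral_mkcond; apply: eq_Rintegral => x _.
by rewrite patchE; case: ifPn => // /negP xO; rewrite f0// => Ox; apply: xO; rewrite inE.
Qed.

Lemma test_out z x : test z -> ~ Omega x -> z x = 0.
Proof. by move=> [sz [K [cK KO zK]]] nO; apply: zK => /KO. Qed.

Lemma test_Rintegral_partial i z : test z -> \int[leb]_(x in Omega) partial i z x = 0.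
Proof.
move=> tz; have [N [_ ON]] := bounded_set_cube bO.
rewrite Rintegral_out; last by move=> x; exact: test_out (test_partial i tz).
exact: Rintegral_partial (test_C1c tz ON).
Qed.

(** The fundamental lemma of the calculus of variations: the set of h on which f and g agree is a
    linear space, closed by Cauchy-Schwarz, so [density_ind] applies to it. *)
Lemma test_ip_eqv f g : sqint f -> sqint g ->
  (forall z, test z -> ip f z = ip g z) -> eqv f g.
Proof.
move=> sf sg fg; split => //.
pose V h := sqint h /\ ip f h = ip g h.
suff H h : sqint h -> V h by move=> h /H[].
apply: (@density_ind _ _ Omega oO bounded_measure_lty V).
- by move=> k [].
- move=> a b k k' [sk kE] [sk' kE']; split; first exact: sqint_lin.
  by rewrite !ip_linr// kE kE'.
- move=> k sk Hk; split => //; apply/eqP; rewrite -subr_eq0 -sqrf_eq0 eq_le sqr_ge0 andbT.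
  have sfg := sqintB mO sf sg.
  apply: (@le0_of_small _ _ (ip (fun x => f x - g x) (fun x => f x - g x))); first exact: ip_ge0.
  move=> e e0; have [q [[sq qE] He]] := Hk e e0.
  have skq := sqintB mO sk sq.
  have -> : ip f k - ip g k = ip (fun x => f x - g x) (fun x => k x - q x).
    by rewrite ipBr// !ipBl// qE subrr subr0.
  apply: le_trans (cauchy_schwarz mO sfg skq) _.
  by rewrite ler_wpM2l// ip_ge0.
- move=> chi a tc ta; have tca : test (fun x => chi x * a x) by apply: testMr => //; case: ta.
  by split; [exact: test_sqint|exact: fg].
Qed.

Lemma wgradP u : H1 Omega u -> is_weak_gradient Omega u (wgrad Omega u).
Proof.
move=> [_ [G HG]]; rewrite /wgrad; case: xgetP => [_ ->//|/(_ G)]; exact.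
Qed.

Lemma H1_sqint u : H1 Omega u -> sqint u. Proof. by case. Qed.

Lemma gr_sqint u i : H1 Omega u -> sqint (gr u i).
Proof. by move=> /wgradP[+ _]; apply. Qed.

Lemma ipDef f g : ip f g = \int[leb]_(x in Omega) (f x * g x). Proof. by []. Qed.

Lemma gr_test u i z : H1 Omega u -> test z -> ip (gr u i) z = - ip u (partial i z).
Proof.
by move=> /wgradP[_ H] tz; rewrite [in RHS]ipDef (H i z tz) opprK.
Qed.

(** [wgrad] is picked by choice, so the rules of calculus for it hold only up to [eqv]. They all
    derive from this uniqueness, through [H1_intro]. *)
Lemma gr_eqv u G : H1 Omega u -> is_weak_gradient Omega u G ->
  forall i, eqv (gr u i) (fun x => G x ord0 i).
Proof.
move=> Hu [sG HG] i; apply: test_ip_eqv; [exact: gr_sqint|exact: sG|].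
by move=> z tz; rewrite gr_test// [in LHS]ipDef (HG i z tz) opprK.
Qed.

Lemma weak_gradient_intro u (G : 'rV[R]_d -> 'rV[R]_d) :
  (forall i, sqint (fun x => G x ord0 i)) ->
  (forall i z, test z -> ip u (partial i z) = - ip (fun x => G x ord0 i) z) ->
  is_weak_gradient Omega u G.
Proof. by move=> sG H; split => // i z tz; exact: H. Qed.

Definition row_field (G : 'I_d -> 'rV[R]_d -> R) (x : 'rV[R]_d) : 'rV[R]_d :=
  \row_i G i x.

Lemma H1_intro u (G : 'I_d -> 'rV[R]_d -> R) : sqint u -> (forall i, sqint (G i)) ->
  (forall i z, test z -> ip u (partial i z) = - ip (G i) z) ->
  H1 Omega u /\ forall i, eqv (gr u i) (G i).
Proof.
move=> su sG H.
have E i : (fun x => row_field G x ord0 i) = G i by apply/funext => x; rewrite mxE.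
have W : is_weak_gradient Omega u (row_field G).
  apply: weak_gradient_intro => [i|i z tz]; first by rewrite E.
  by rewrite E; exact: H.
have Hu : H1 Omega u by split => //; exists (row_field G).
by split => // i; have := gr_eqv Hu W i; rewrite E.
Qed.

Lemma H1_lin a b u v : H1 Omega u -> H1 Omega v ->
  H1 Omega (fun x => a * u x + b * v x) /\
  forall i, eqv (gr (fun x => a * u x + b * v x) i) (fun x => a * gr u i x + b * gr v i x).
Proof.
move=> Hu Hv; have su := H1_sqint Hu; have sv := H1_sqint Hv.
apply: (@H1_intro _ (fun i x => a * gr u i x + b * gr v i x)).
- exact: sqint_lin.
- by move=> i; apply: sqint_lin => //; exact: gr_sqint.
move=> i z tz; have sz := test_sqint tz; have sp := test_sqint (test_partial i tz).
rewrite !ip_linl//; try exact: gr_sqint.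
by rewrite !gr_test//; ring.
Qed.

Lemma smooth_H1 w : smooth w -> H1 Omega w /\ forall i, eqv (gr w i) (partial i w).
Proof.
move=> sw; apply: H1_intro; first exact: smooth_sqint.
  by move=> i; apply: smooth_sqint; exact: smooth_partial.
move=> i z tz; have sz := test_smooth tz.
have := test_Rintegral_partial i (testMl tz sw).
rewrite partialM// => H.
have s1 := smooth_sqint sw; have s2 := smooth_sqint (smooth_partial i sz).
have s3 := smooth_sqint sz; have s4 := smooth_sqint (smooth_partial i sw).
apply/eqP; rewrite -subr_eq0 opprK (ipC _ _ (partial i w)) /ip -RintegralD//;
  [exact/eqP|exact: sqint_mul..].
Qed.

Lemma smooth_mul_H1 w u : smooth w -> H1 Omega u ->
  H1 Omega (fun x => w x * u x) /\
  forall i, eqv (gr (fun x => w x * u x) i) (fun x => w x * gr u i x + partial i w x * u x).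
Proof.
move=> sw Hu; have su := H1_sqint Hu.
have s1 i : sqint (fun x => w x * gr u i x) by apply: smooth_mul_sqint => //; exact: gr_sqint.
have s2 i : sqint (fun x => partial i w x * u x) by apply: smooth_mul_sqint => //; exact: smooth_partial.
apply: H1_intro.
- exact: smooth_mul_sqint.
- by move=> i; exact: sqintD.
move=> i z tz; have sz := test_smooth tz.
have tzw := testMl tz sw.
have := gr_test i Hu tzw; rewrite partialM// => H.
have s3 := smooth_sqint (smooth_partial i sz).
have s4 := smooth_mul_sqint sw s3.
have s5 : sqint (fun x => z x * partial i w x) by apply: smooth_mul_sqint => //; apply: smooth_sqint; exact: smooth_partial.
rewrite ipDr// in H.
rewrite ipDl//; last exact: smooth_sqint.
have -> : ip (fun x => w x * u x) (partial i z) = ip u (fun x => w x * partial i z x).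
  by apply: eq_Rintegral => x _; ring.
have -> : ip (fun x => w x * gr u i x) z = ip (gr u i) (fun x => w x * z x).
  by apply: eq_Rintegral => x _; ring.
have -> : ip (fun x => partial i w x * u x) z = ip u (fun x => z x * partial i w x).
  by apply: eq_Rintegral => x _; ring.
by rewrite H opprD opprK addrK.
Qed.

Definition gradsq u : R := \sum_i ip (gr u i) (gr u i).
Definition h1sq u : R := ip u u + gradsq u.

Lemma gradsq_ge0 u : 0 <= gradsq u.
Proof. by apply: sumr_ge0 => i _; exact: ip_ge0. Qed.

Lemma h1sq_ge0 u : 0 <= h1sq u.
Proof. by rewrite addr_ge0 ?ip_ge0 ?gradsq_ge0. Qed.

Lemma gr_le_gradsq u i : ip (gr u i) (gr u i) <= gradsq u.
Proof.
rewrite /gradsq (bigD1 i)//= lerDl; apply: sumr_ge0 => j _; exact: ip_ge0.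
Qed.

Lemma vdot_ge0 (x : 'rV[R]_d) : 0 <= vdot x x.
Proof. by apply: sumr_ge0 => i _; rewrite -expr2 sqr_ge0. Qed.

Lemma enorm_sqr (x : 'rV[R]_d) : enorm x ^+ 2 = vdot x x.
Proof. by rewrite sqr_sqrtr// vdot_ge0. Qed.

Lemma sum_ip_Rintegral (F G : 'I_d -> 'rV[R]_d -> R) :
  (forall i, sqint (F i)) -> (forall i, sqint (G i)) ->
  leb.-integrable Omega (EFin \o (fun x => \sum_i F i x * G i x)) /\
  \int[leb]_(x in Omega) (\sum_i F i x * G i x) = \sum_i ip (F i) (G i).
Proof.
move=> sF sG.
suff Hs s : leb.-integrable Omega (EFin \o (fun x => \sum_(i <- s) F i x * G i x)) /\
  \int[leb]_(x in Omega) (\sum_(i <- s) F i x * G i x) = \sum_(i <- s) ip (F i) (G i) by exact: (Hs _).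
elim: s => [|i s [IH1 IH2]].
  rewrite big_nil; have E : (fun x : 'rV[R]_d => \sum_(i <- [::]) F i x * G i x) = fun=> 0.
    by apply/funext => x; rewrite big_nil.
  by rewrite E; split; [exact: integrable0|rewrite /Rintegral integral0].
have E : (fun x : 'rV[R]_d => \sum_(j <- i :: s) F j x * G j x) =
  fun x => F i x * G i x + \sum_(j <- s) F j x * G j x.
  by apply/funext => x; rewrite big_cons.
have i1 := sqint_mul mO (sF i) (sG i).
by rewrite E big_cons -IH2 RintegralD//; split => //; exact: integrable_add.
Qed.

Lemma H1normE u : H1 Omega u -> H1norm Omega u = Num.sqrt (h1sq u).
Proof.
move=> Hu; rewrite /H1norm /h1sq ipE; congr (Num.sqrt (_ + _)).
under eq_Rintegral do rewrite enorm_sqr.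
by apply: (sum_ip_Rintegral (F := fun i => gr u i) (G := fun i => gr u i) _ _).2 => i; exact: gr_sqint.
Qed.

Lemma H1_sub u v : H1 Omega u -> H1 Omega v ->
  H1 Omega (fun x => u x - v x) /\
  forall i, eqv (gr (fun x => u x - v x) i) (fun x => gr u i x - gr v i x).
Proof.
move=> Hu Hv; have [H1uv E] := H1_lin 1 (-1) Hu Hv.
have F : (fun x => 1 * u x + -1 * v x) = (fun x => u x - v x).
  by apply/funext => x; rewrite mul1r mulN1r.
rewrite F in H1uv E; split => // i; have := E i; congr eqv.
by apply/funext => x; rewrite mul1r mulN1r.
Qed.

Lemma H1_add u v : H1 Omega u -> H1 Omega v ->
  H1 Omega (fun x => u x + v x) /\
  forall i, eqv (gr (fun x => u x + v x) i) (fun x => gr u i x + gr v i x).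
Proof.
move=> Hu Hv; have [H1uv E] := H1_lin 1 1 Hu Hv.
have F : (fun x => 1 * u x + 1 * v x) = (fun x => u x + v x).
  by apply/funext => x; rewrite !mul1r.
rewrite F in H1uv E; split => // i; have := E i; congr eqv.
by apply/funext => x; rewrite !mul1r.
Qed.

Definition h1_cvg (s : nat -> 'rV[R]_d -> R) u : Prop :=
  [/\ forall n, H1 Omega (s n), H1 Omega u &
      forall e : R, 0 < e -> exists N, forall n, (N <= n)%N -> h1sq (fun x => u x - s n x) <= e].

Definition l2_cvg (s : nat -> 'rV[R]_d -> R) f : Prop :=
  [/\ forall n, sqint (s n), sqint f &
      forall e : R, 0 < e -> exists N, forall n, (N <= n)%N -> dist f (s n) <= e].

Lemma ip_sub_eqv f f' g g' : eqv f f' -> eqv g g' -> dist f g = dist f' g'.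
Proof.
move=> ef eg.
have [sf sf' _] := ef; have [sg sg' _] := eg.
have := eqv_lin 1 (-1) ef eg => E.
have := eqv_ip E E.
have F k l : (fun x : 'rV[R]_d => 1 * k x + -1 * l x) = (fun x => k x - l x :> R).
  by apply/funext => x; rewrite mul1r mulN1r.
by rewrite !F.
Qed.

Lemma h1_cvg_l2 s u : h1_cvg s u -> l2_cvg s u.
Proof.
move=> [Hs Hu Hc]; split => [n||e e0]; [exact: H1_sqint|exact: H1_sqint|].
have [N HN] := Hc e e0; exists N => n /HN; apply: le_trans.
by rewrite /h1sq lerDl gradsq_ge0.
Qed.

Lemma h1_cvg_gr s u i : h1_cvg s u -> l2_cvg (fun n => gr (s n) i) (gr u i).
Proof.
move=> [Hs Hu Hc]; split => [n||e e0]; [exact: gr_sqint|exact: gr_sqint|].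
have [N HN] := Hc e e0; exists N => n /HN; apply: le_trans.
have [Hus E] := H1_sub Hu (Hs n).
have -> : dist (gr u i) (gr (s n) i) = ip (gr (fun x => u x - s n x) i) (gr (fun x => u x - s n x) i).
  by rewrite (eqv_ip (E i) (E i)).
apply: le_trans (gr_le_gradsq _ i) _.
by rewrite /h1sq lerDr ip_ge0.
Qed.

Lemma l2_cvg_ip s f h : l2_cvg s f -> sqint h -> ip (s n) h @[n --> \oo] --> ip f h.
Proof.
move=> [ss sf Hc] sh; apply/cvgrPdist_le => e e0.
have K0 := ip_ge0 leb Omega h; set K := ip h h in K0.
have d0 : 0 < e ^+ 2 / (K + 1) by rewrite divr_gt0 ?exprn_gt0// ltr_wpDl.
have [N HN] := Hc _ d0; exists N => // n /= Nn.
have sfs := sqintB mO sf (ss n).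
rewrite -ipBl//; have := cauchy_schwarz mO sfs sh; rewrite -/K => H.
rewrite -(@ler_pXn2r _ 2) ?nnegrE ?(ltW e0)// real_normK ?num_real//.
apply: le_trans H _; apply: le_trans (ler_wpM2r K0 (HN n Nn)) _.
rewrite mulrAC ler_pdivrMr ?ltr_wpDl// ler_wpM2l ?sqr_ge0//; lra.
Qed.

Lemma l2_cvg_ip2 s f : l2_cvg s f -> ip (s n) (s n) @[n --> \oo] --> ip f f.
Proof.
move=> Hs; have [ss sf Hc] := Hs.
have E n : ip (s n) (s n) = 2 * ip (s n) f - ip f f + dist f (s n).
  rewrite ipBl// ?ipBr//; last exact: sqintB.
  by rewrite (ipC _ _ f (s n)); ring.
rewrite (_ : (fun n => ip (s n) (s n)) = (fun n => 2 * ip (s n) f - ip f f + dist f (s n))); last exact/funext.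
have c0 : dist f (s n) @[n --> \oo] --> (0 : R).
  apply/cvgrPdist_le => e e0; have [N HN] := Hc e e0; exists N => // n /= Nn.
  by rewrite sub0r normrN ger0_norm ?ip_ge0// HN.
have c1 : 2 * ip (s n) f - ip f f + dist f (s n) @[n --> \oo] --> 2 * ip f f - ip f f + 0.
  apply: cvgD => //; apply: cvgB; last exact: cvg_cst.
  by apply: cvgM; [exact: cvg_cst|exact: l2_cvg_ip].
by move: c1; rewrite (_ : 2 * ip f f - ip f f + 0 = ip f f)//; ring.
Qed.

Lemma h1_cvg_gradsq s u : h1_cvg s u -> gradsq (s n) @[n --> \oo] --> gradsq u.
Proof.
move=> Hs; apply: cvg_big; first exact: add_continuous.
by move=> i _; exact: l2_cvg_ip2 (h1_cvg_gr i Hs).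
Qed.

Lemma h1_cvg_of_h1norm (s : nat -> 'rV[R]_d -> R) u : (forall n, H1 Omega (s n)) -> H1 Omega u ->
  H1norm Omega (u \- s n) @[n --> \oo] --> (0 : R) -> h1_cvg s u.
Proof.
move=> Hs Hu /cvgr0Pnorm_le Hc; split => // e e0.
have [|N _ HN] := Hc (Num.sqrt e); first by rewrite sqrtr_gt0.
exists N => n Nn; have := HN n Nn.
have [Hus _] := H1_sub Hu (Hs n).
rewrite (_ : u \- s n = (fun x => u x - s n x))// H1normE// ger0_norm ?sqrtr_ge0//.
by rewrite ler_sqrt// ltW.
Qed.

Lemma H10_seq v : H10 Omega v -> exists z : nat -> 'rV[R]_d -> R,
  (forall n, test (z n)) /\ h1_cvg z v.
Proof.
move=> [Hv Hd].
have /choice[z Hz] (n : nat) : exists z, test z /\ H1norm Omega (v \- z) < n.+1%:R^-1.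
  by apply: Hd; rewrite invr_gt0.
exists z; split; first by move=> n; exact: (Hz n).1.
apply: h1_cvg_of_h1norm => //.
  by move=> n; apply: (smooth_H1 _).1; case: (Hz n) => -[].
apply/cvgrPdist_le => e e0; have [N HN] := inv_nat_lt e0.
exists N => // n /= Nn; rewrite sub0r normrN ger0_norm ?sqrtr_ge0//.
by apply: le_trans (ltW (Hz n).2) _; exact: HN.
Qed.

Lemma H10_intro v : H1 Omega v ->
  (forall e : R, 0 < e -> exists z, test z /\ h1sq (fun x => v x - z x) <= e) -> H10 Omega v.
Proof.
move=> Hv Hd; split => // e e0.
have e2 : 0 < (e / 2) ^+ 2 by rewrite exprn_gt0// divr_gt0.
have [z [tz Hz]] := Hd _ e2; exists z; split => //.
have [Hvz _] := H1_sub Hv (smooth_H1 (test_smooth tz)).1.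
rewrite (_ : v \- z = (fun x => v x - z x))// H1normE//.
apply: le_lt_trans (_ : e / 2 < e); last by lra.
by apply: sqrtr_le => //; rewrite divr_ge0// ltW.
Qed.

Lemma test_H10 z : test z -> H10 Omega z.
Proof.
move=> tz; have [Hz _] := smooth_H1 (test_smooth tz).
apply: H10_intro => // e e0; exists z; split => //.
have [H0 E] := H1_sub Hz Hz.
have S0 : (fun x => z x - z x) = fun=> 0 by apply/funext => x; rewrite subrr.
rewrite S0 in E *; rewrite /h1sq ip0l add0r /gradsq big1 ?ltW// => i _.
rewrite (eqv_ip (E i) (E i)); have -> : (fun x => gr z i x - gr z i x) = fun=> 0.
  by apply/funext => x; rewrite subrr.
by rewrite ip0l.
Qed.

Lemma h1sq_eqv u (G : 'I_d -> 'rV[R]_d -> R) : (forall i, eqv (gr u i) (G i)) ->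
  h1sq u = ip u u + \sum_i ip (G i) (G i).
Proof. by move=> E; congr (_ + _); apply: eq_bigr => i _; exact: eqv_ip. Qed.

Lemma sqr2_le (a b : R) : (a + b) ^+ 2 <= 2 * a ^+ 2 + 2 * b ^+ 2.
Proof. have := sqr_ge0 (a - b); nra. Qed.

Lemma ip_lin_le a b f g : sqint f -> sqint g ->
  ip (fun x => a * f x + b * g x) (fun x => a * f x + b * g x) <=
  2 * a ^+ 2 * ip f f + 2 * b ^+ 2 * ip g g.
Proof.
move=> sf sg; have := ip_ge0 leb Omega (fun x => a * f x + (- b) * g x).
rewrite !ip_expand//; lra.
Qed.

Lemma h1sq_lin_le a b u v : H1 Omega u -> H1 Omega v ->
  h1sq (fun x => a * u x + b * v x) <= 2 * a ^+ 2 * h1sq u + 2 * b ^+ 2 * h1sq v.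
Proof.
move=> Hu Hv; have [_ E] := H1_lin a b Hu Hv.
rewrite (h1sq_eqv E) /h1sq !mulrDr addrACA; apply: lerD.
  by apply: ip_lin_le; exact: H1_sqint.
rewrite /gradsq !mulr_sumr -big_split/=; apply: ler_sum => i _.
by apply: ip_lin_le; exact: gr_sqint.
Qed.

Lemma H10_H1 v : H10 Omega v -> H1 Omega v. Proof. by case. Qed.

Lemma H10_approx v : H10 Omega v -> forall e : R, 0 < e ->
  exists z, test z /\ h1sq (fun x => v x - z x) <= e.
Proof.
move=> Hv e e0; have [z [tz [_ _ Hc]]] := H10_seq Hv.
by have [N HN] := Hc e e0; exists (z N); split => //; exact: HN.
Qed.

Lemma H10_lin a b u v : H10 Omega u -> H10 Omega v ->
  H10 Omega (fun x => a * u x + b * v x).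
Proof.
move=> Hu Hv; have Hu1 := H10_H1 Hu; have Hv1 := H10_H1 Hv.
apply: H10_intro => [|e e0]; first exact: (H1_lin a b Hu1 Hv1).1.
have A0 : 0 <= a ^+ 2 by exact: sqr_ge0. have B0 : 0 <= b ^+ 2 by exact: sqr_ge0.
have K0 : 0 < 2 * a ^+ 2 + 2 * b ^+ 2 + 1 by lra.
have eK : 0 < e / (2 * a ^+ 2 + 2 * b ^+ 2 + 1) by rewrite divr_gt0.
have [z [tz Hz]] := H10_approx Hu eK; have [y [ty Hy]] := H10_approx Hv eK.
exists (fun x => a * z x + b * y x); split; first by apply: testD; exact: testZ.
have [Huz _] := H1_sub Hu1 (smooth_H1 (test_smooth tz)).1.
have [Hvy _] := H1_sub Hv1 (smooth_H1 (test_smooth ty)).1.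
have := h1sq_lin_le a b Huz Hvy.
rewrite (_ : (fun x => a * (u x - z x) + b * (v x - y x)) =
   (fun x => a * u x + b * v x - (a * z x + b * y x))); last by apply/funext => x; ring.
move/le_trans; apply.
set q := e / _ in eK Hz Hy; have qE : q * (2 * a ^+ 2 + 2 * b ^+ 2 + 1) = e.
  by rewrite /q divfK// gt_eqF.
move: (h1sq _) (h1sq _) Hz Hy => X Y HX HY.
by have := ler_wpM2l A0 HX; have := ler_wpM2l B0 HY; lra.
Qed.

Lemma H10_closed v : H1 Omega v -> (forall e : R, 0 < e ->
  exists w, H10 Omega w /\ h1sq (fun x => v x - w x) <= e) -> H10 Omega v.
Proof.
move=> Hv Hd; apply: H10_intro => // e e0; have e4 : 0 < e / 4 by lra.
have [w [Hw Hvw]] := Hd _ e4; have [z [tz Hz]] := H10_approx Hw e4.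
exists z; split => //.
have Hz1 := (smooth_H1 (test_smooth tz)).1.
have := h1sq_lin_le 1 1 (H1_sub Hv (H10_H1 Hw)).1 (H1_sub (H10_H1 Hw) Hz1).1.
rewrite (_ : (fun x => 1 * (v x - w x) + 1 * (w x - z x)) = (fun x => v x - z x)); last by apply/funext => x; ring.
rewrite expr1n; move: (h1sq _) (h1sq _) (h1sq _) Hvw Hz => X Y Z; lra.
Qed.

(** This is what the argument retains of having a trace: it permits cutting off by a test function
    ([test_mul_H10]). *)
Definition smooth_closure u : Prop := H1 Omega u /\
  forall e : R, 0 < e -> exists w, smooth w /\ h1sq (fun x => u x - w x) <= e.

Lemma trace_smooth_closure u g : is_trace Omega u g -> smooth_closure u.
Proof.
move=> [Hu _ [w [sw Hw _]]]; split => // e e0.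
have [_ _ Hc] := h1_cvg_of_h1norm (fun n => (smooth_H1 (sw n)).1) Hu Hw.
by have [N HN] := Hc e e0; exists (w N); split => //; exact: HN.
Qed.

Lemma smooth_closure_sub u v : smooth_closure u -> smooth_closure v ->
  smooth_closure (fun x => u x - v x).
Proof.
move=> [Hu Au] [Hv Av]; split; first exact: (H1_sub Hu Hv).1.
move=> e e0; have e4 : 0 < e / 4 by lra.
have [w [sw Hw]] := Au _ e4; have [y [sy Hy]] := Av _ e4.
exists (fun x => w x - y x); split; first exact: smoothB.
have := h1sq_lin_le 1 (-1) (H1_sub Hu (smooth_H1 sw).1).1 (H1_sub Hv (smooth_H1 sy).1).1.
rewrite (_ : (fun x => 1 * (u x - w x) + -1 * (v x - y x)) = (fun x => u x - v x - (w x - y x))); last by apply/funext => x; ring.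
rewrite sqrrN expr1n; move: (h1sq _) (h1sq _) (h1sq _) Hw Hy => X Y Z; lra.
Qed.

Lemma h1sq_smooth_mul_le w : smooth w -> exists2 C, 0 <= C &
  forall u, H1 Omega u -> h1sq (fun x => w x * u x) <= C * h1sq u.
Proof.
move=> sw; have [K HK] := smooth_bounded sw.
have /choice[L HL] i := smooth_bounded (smooth_partial i sw).
have S0 : 0 <= \sum_i 2 * L i ^+ 2 by apply: sumr_ge0 => i _; rewrite mulr_ge0 ?sqr_ge0.
have K0 := sqr_ge0 K.
exists (K ^+ 2 + 2 * K ^+ 2 + \sum_i 2 * L i ^+ 2).
  by apply: addr_ge0 => //; apply: addr_ge0 => //; exact: mulr_ge0.
move=> u Hu; have su := H1_sqint Hu.
have [_ E] := smooth_mul_H1 sw Hu.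
rewrite (h1sq_eqv E).
have h0 := ip_mul_le sw HK su.
have h1 : \sum_i ip (fun x => w x * gr u i x + partial i w x * u x) (fun x => w x * gr u i x + partial i w x * u x)
   <= 2 * K ^+ 2 * gradsq u + (\sum_i 2 * L i ^+ 2) * ip u u.
  rewrite /gradsq mulr_sumr mulr_suml -big_split/=; apply: ler_sum => i _.
  have si := gr_sqint i Hu.
  have := ip_mul_le sw HK si; have := ip_mul_le (smooth_partial i sw) (HL i) su.
  have := ip_lin_le 1 1 (smooth_mul_sqint sw si) (smooth_mul_sqint (smooth_partial i sw) su).
  rewrite expr1n !mulr1.
  rewrite (_ : (fun x => 1 * (w x * gr u i x) + 1 * (partial i w x * u x)) =
    (fun x => w x * gr u i x + partial i w x * u x)); last by apply/funext => x; rewrite !mul1r.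
  move: (ip _ _) (ip _ _) (ip _ _) (ip _ _) (ip _ _) => x1 x2 x3 x4 x5; lra.
have g0 := gradsq_ge0 u; have i0 := ip_ge0 leb Omega u.
rewrite /h1sq; apply: le_trans (lerD h0 h1) _.
move: (\sum_i 2 * L i ^+ 2) (K ^+ 2) (ip u u) (gradsq u) S0 K0 g0 i0 => S Q X Y S0 Q0 Y0 X0.
by have := mulr_ge0 S0 Y0; have := mulr_ge0 Q0 Y0; have := mulr_ge0 Q0 X0; lra.
Qed.

(** The approximants of u are smooth but need not vanish near the boundary; multiplied by [a] they
    become test functions, and multiplication by [a] is bounded in H^1. *)
Lemma test_mul_H10 a u : test a -> smooth_closure u -> H10 Omega (fun x => a x * u x).
Proof.
move=> ta [Hu Au]; have sa := test_smooth ta.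
apply: H10_intro; first exact: (smooth_mul_H1 sa Hu).1.
move=> e e0; have [C C0 HC] := h1sq_smooth_mul_le sa.
have eC : 0 < e / (C + 1) by rewrite divr_gt0// ltr_wpDl.
have [w [sw Hw]] := Au _ eC; exists (fun x => a x * w x); split; first exact: testMr.
have Huw := (H1_sub Hu (smooth_H1 sw).1).1.
have := HC _ Huw; rewrite (_ : (fun x => a x * (u x - w x)) = (fun x => a x * u x - a x * w x)); last by apply/funext => x; ring.
move/le_trans; apply; apply: le_trans (ler_wpM2l C0 Hw) _.
by rewrite mulrA ler_pdivrMr ?ltr_wpDl// mulrDr mulr1 mulrC lerDl ltW.
Qed.

Lemma H1_functional (l : ('rV[R]_d -> R) -> R) C :
  (forall a b u v, H1 Omega u -> H1 Omega v -> l (fun x => a * u x + b * v x) = a * l u + b * l v) ->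
  (forall u, H1 Omega u -> `|l u| <= C * Num.sqrt (h1sq u)) ->
  bounded_functional Omega (H1 Omega) l.
Proof.
move=> ll lC; split.
  move=> a u v Hu Hv; have := ll a 1 u v Hu Hv; rewrite mul1r => <-.
  by congr l; apply/funext => x /=; rewrite mul1r.
by exists C => u Hu; rewrite H1normE//; exact: lC.
Qed.

Lemma sqrt_ip_le_h1 u : Num.sqrt (ip u u) <= Num.sqrt (h1sq u).
Proof. by apply: ler_wsqrtr; rewrite lerDl gradsq_ge0. Qed.

Lemma sqrt_gr_le_h1 u i : Num.sqrt (ip (gr u i) (gr u i)) <= Num.sqrt (h1sq u).
Proof.
apply: ler_wsqrtr; apply: le_trans (gr_le_gradsq _ i) _.
by rewrite lerDr ip_ge0.
Qed.

Lemma ip_functional h : sqint h -> bounded_functional Omega (H1 Omega) (fun z => ip z h).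
Proof.
move=> sh; apply: (@H1_functional _ (Num.sqrt (ip h h))).
  by move=> a b u v Hu Hv; rewrite ip_linl//; exact: H1_sqint.
move=> u Hu; apply: le_trans (norm_ip mO (H1_sqint Hu) sh) _.
by rewrite mulrC ler_wpM2l ?sqrtr_ge0// sqrt_ip_le_h1.
Qed.

Lemma gr_functional h i : sqint h -> bounded_functional Omega (H1 Omega) (fun z => ip (gr z i) h).
Proof.
move=> sh; apply: (@H1_functional _ (Num.sqrt (ip h h))).
  move=> a b u v Hu Hv; have [_ /(_ i)[_ _ E]] := H1_lin a b Hu Hv.
  by rewrite E// ip_linl//; exact: gr_sqint.
move=> u Hu; apply: le_trans (norm_ip mO (gr_sqint i Hu) sh) _.
by rewrite mulrC ler_wpM2l ?sqrtr_ge0// sqrt_gr_le_h1.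
Qed.

Lemma pos_near (P : R -> Prop) : (\forall e \near 0^'+, P e) <->
  exists2 del, 0 < del & forall e, 0 < e -> e < del -> P e.
Proof.
split=> [[del /= d0 H]|[del d0 H]].
  exists del => // e e0 ed; apply: H => //.
  by rewrite /= sub0r normrN gtr0_norm.
exists del => //= e; rewrite /= sub0r normrN => ed e0; apply: H => //.
by rewrite gtr0_norm in ed.
Qed.

(** Uniform boundedness concerns sequences: if no bound held near 0, there would be parameters below
    1 / (n + 1) with squared norm above n, and along them the pairings still converge, hence are
    bounded. *)
Lemma weakly_bounded (f : R -> 'rV[R]_d -> R) : (forall e, 0 < e -> sqint (f e)) ->
  (forall h, sqint h -> exists l, ip (f e) h @[e --> 0^'+] --> (l : R)) ->
  exists C, \forall e \near 0^'+, ip (f e) (f e) <= C.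
Proof.
move=> sf cf; apply: contrapT => nC.
have /choice[s Hs] (n : nat) : exists e, [/\ 0 < e, e < n.+1%:R^-1 & n%:R < ip (f e) (f e)].
  apply: contrapT => H; apply: nC; exists n%:R; apply/pos_near.
  exists n.+1%:R^-1; first by rewrite invr_gt0.
  by move=> e e0 en; rewrite leNgt; apply/negP => K; apply: H; exists e.
have [|h sh|C HC] := @uniform_boundedness _ _ R leb Omega mO (fun n => f (s n)).
- by move=> n; apply: sf; case: (Hs n).
- have [l Hl] := cf h sh.
  have s0 : s n @[n --> \oo] --> 0^'+.
    move=> P /pos_near[del d0 HP].
    have [N HN] := inv_nat_lt d0; exists N => // n /= Nn; have [sn0 snn _] := Hs n.
    by apply: HP => //; apply: lt_le_trans snn _; exact: HN.
  have cl := cvg_comp _ _ s0 Hl.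
  have /cvg_seq_bounded[M [_ HM]] : cvgn (fun n => ip (f (s n)) h) by apply/cvg_ex; exists l.
  exists (`|M| + 1) => n; apply: (HM (`|M| + 1)) => //.
  by rewrite (le_lt_trans (ler_norm M))// ltrDl.
have [_ _] := Hs (Num.truncn `|C|).+1.
have := HC (Num.truncn `|C|).+1; have := truncnS_gt `|C|; have := ler_norm C.
by move=> h1 h2 h3 h4; have := lt_le_trans h4 (le_trans h3 h1); rewrite ltNge (ltW h2).
Qed.

Lemma near_all_ord n (P : 'I_n -> R -> Prop) : (forall i, \forall e \near 0^'+, P i e) ->
  \forall e \near 0^'+, forall i, P i e.
Proof.
move=> H; suff K (s : seq 'I_n) : \forall e \near 0^'+, forall i, i \in s -> P i e.
  have := K (enum 'I_n); apply: filterS => e He i; apply: He; exact: mem_enum.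
elim: s => [|j s IH]; first exact: (nearW (F := 0^'+)).
apply: filterS2 (H j) IH => e Pj Ps i; rewrite inE => /predU1P[->//|].
exact: Ps.
Qed.

Lemma weak_cvg_bounded (u : R -> 'rV[R]_d -> R) u0 : (forall e, 0 < e -> H1 Omega (u e)) ->
  H1_weak_cvg Omega u u0 -> exists2 C, 0 <= C & \forall e \near 0^'+, h1sq (u e) <= C.
Proof.
move=> Hu cu.
have [C HC] : exists C, \forall e \near 0^'+, ip (u e) (u e) <= C.
  apply: weakly_bounded => [e e0|h sh]; first exact/H1_sqint/Hu.
  by exists (ip u0 h); exact: cu (ip_functional sh).
have /choice[K HK] i : exists C, \forall e \near 0^'+, ip (gr (u e) i) (gr (u e) i) <= C.
  apply: (@weakly_bounded (fun e => gr (u e) i)) => [e e0|h sh]; first exact/gr_sqint/Hu.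
  by exists (ip (gr u0 i) h); exact: cu (gr_functional i sh).
exists (`|C| + \sum_i `|K i|); first by rewrite addr_ge0// sumr_ge0.
apply: filterS2 HC (near_all_ord HK) => e h1 h2.
apply: lerD; first exact: le_trans h1 (ler_norm _).
by apply: ler_sum => i _; exact: le_trans (h2 i) (ler_norm _).
Qed.

(** Both sides are continuous for the H^1 norm, so the inequality passes from test functions to
    their closure. *)
Lemma Rellich_H10 (eta : R) : 0 < eta -> exists (I : finType) (chi : I -> 'rV[R]_d -> R),
  (forall k, sqint (chi k)) /\ forall v, H10 Omega v ->
   ip v v <= \sum_k (ip v (chi k)) ^+ 2 + eta * gradsq v.
Proof.
move=> eta0; have [N [N0 ON]] := bounded_set_cube bO.
have [I [chi [tchi Hchi]]] := rellich_inequality d N0 eta0.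
have schi k : sqint (chi k).
  have [mk _ [K HK]] := tchi k; apply: (bounded_sqint oO bounded_measure_lty (K := K)) => //.
  exact: measurable_funTS.
exists I, chi; split => // v Hv.
have [z [tz Hz]] := H10_seq Hv.
have testineq w : test_function Omega w -> ip w w <= \sum_k (ip w (chi k)) ^+ 2 + eta * gradsq w.
  move=> tw; have cw := test_C1c tw ON.
  have := Hchi w cw.
  have outI f : (forall x, ~ Omega x -> f x = 0) -> \int[leb]_x f x = \int[leb]_(x in Omega) f x.
    by move=> f0; rewrite Rintegral_out.
  rewrite outI => [|x nx]; last by rewrite (test_out tw nx) expr0n.
  rewrite -ipE => /le_trans; apply; apply: lerD.
    apply: ler_sum => k _; rewrite outI// => x nx.
    by rewrite (test_out tw nx) mul0r.
  apply: ler_wpM2l; first exact: ltW.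
  apply: ler_sum => i _.
  have [_ /(_ i) E] := smooth_H1 (test_smooth tw).
  rewrite outI => [|x nx]; last by rewrite (test_out (test_partial i tw) nx) expr0n.
  by rewrite -ipE (eqv_ip E E).
have c1 := l2_cvg_ip2 (h1_cvg_l2 Hz).
have c2 : \sum_k (ip (z n) (chi k)) ^+ 2 + eta * gradsq (z n) @[n --> \oo] -->
   \sum_k (ip v (chi k)) ^+ 2 + eta * gradsq v.
  apply: cvgD.
    apply: cvg_big; first exact: add_continuous.
    move=> k _; have c := l2_cvg_ip (h1_cvg_l2 Hz) (schi k).
    exact: cvg_sqr.
  by apply: cvgM; [exact: cvg_cst|exact: h1_cvg_gradsq].
by apply: (ler_cvg_to c1 c2); apply: nearW => n; exact: testineq.
Qed.

(** Rellich's theorem without extraction: weak convergence kills the finitely many coefficients of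
    [theta (u e - u0)], and the gradient term is small since the gradients are bounded. *)
Lemma weak_cvg_strong_loc (u : R -> 'rV[R]_d -> R) u0 theta :
  (forall e, 0 < e -> smooth_closure (u e)) -> smooth_closure u0 ->
  H1_weak_cvg Omega u u0 -> test_function Omega theta ->
  ip (fun x => theta x * (u e x - u0 x)) (fun x => theta x * (u e x - u0 x))
    @[e --> 0^'+] --> (0 : R).
Proof.
move=> Au Au0 cu tth; have sth := test_smooth tth.
have Hu e : 0 < e -> H1 Omega (u e) by move=> /Au[].
have Hu0 : H1 Omega u0 by case: Au0.
have [C C0 HC] := weak_cvg_bounded Hu cu.
have [D D0 HD] := h1sq_smooth_mul_le sth.
pose M := D * (2 * C + 2 * h1sq u0).
have M0 : 0 <= M by rewrite mulr_ge0// addr_ge0 ?mulr_ge0 ?h1sq_ge0.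
apply/cvgrPdist_le => del del0.
(* M will bound the squared gradients of the localised differences, so the gradient term costs at
   most del / 2. *)
have eta0 : 0 < del / 2 / (M + 1) by rewrite !divr_gt0// ltr_wpDl.
have [I [chi [schi Hchi]]] := Rellich_H10 eta0.
pose v e x := theta x * (u e x - u0 x).
have Hv e : 0 < e -> H10 Omega (v e).
  move=> e0; exact: (test_mul_H10 tth (smooth_closure_sub (Au e e0) Au0)).
have c0 : \sum_k (ip (v e) (chi k)) ^+ 2 @[e --> 0^'+] --> (0 : R).
  rewrite [X in _ --> X](_ : 0 = \sum_(k : I) 0 :> R); last by rewrite big1.
  apply: cvg_big; first exact: add_continuous.
  move=> k _.
  have sk := smooth_mul_sqint sth (schi k).
  have cv : ip (v e) (chi k) @[e --> 0^'+] --> (0 : R).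
    have := cu _ (ip_functional sk) => c1.
    have c2 : ip (u e) (fun x => theta x * chi k x) - ip u0 (fun x => theta x * chi k x) @[e --> 0^'+] --> (0 : R).
      have := cvgB c1 (cvg_cst (ip u0 (fun x => theta x * chi k x))).
      by rewrite subrr; exact.
    apply: cvg_trans c2; apply: near_eq_cvg; near=> e.
    have e0 : 0 < e by near: e; exact: nbhs_right_gt.
    rewrite -ipBl//; try exact/H1_sqint/Hu; try exact/H1_sqint.
    by rewrite /ip; apply: eq_Rintegral => x _; rewrite /v; ring.
  by have := cvg_sqr cv; rewrite expr0n; exact.
have d2 : 0 < del / 2 by lra.
move/cvgrPdist_le : c0 => /(_ _ d2) c0.
apply: filterS3 HC c0 (nbhs_right_gt (0 : R)) => e hC hs e0.
rewrite sub0r normrN ger0_norm ?ip_ge0//.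
apply: le_trans (Hchi _ (Hv e e0)) _.
rewrite sub0r normrN in hs; have hs' := le_trans (ler_norm _) hs.
have gM : gradsq (v e) <= M.
  apply: le_trans (_ : h1sq (v e) <= _); first by rewrite lerDr ip_ge0.
  have Hus := (H1_sub (Hu e e0) Hu0).1.
  apply: le_trans (HD _ Hus) _; rewrite ler_wpM2l//.
  have := h1sq_lin_le 1 (-1) (Hu e e0) Hu0.
  rewrite (_ : (fun x => 1 * u e x + -1 * u0 x) = (fun x => u e x - u0 x)); last by apply/funext => x; ring.
  rewrite sqrrN expr1n !mulr1 => /le_trans; apply.
  by rewrite lerD2r ler_wpM2l.
have : del / 2 / (M + 1) * gradsq (v e) <= del / 2.
  rewrite mulrAC ler_pdivrMr ?ltr_wpDl//; apply: ler_wpM2l; first exact: ltW.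
  by apply: le_trans gM _; rewrite lerDl.
move: hs'; rewrite /v.
move: (\sum_k _) (_ * gradsq _) => x y hx hy; lra.
Unshelve. all: by end_near. Qed.

(** * Fluxes and existence of solutions *)

Implicit Types (F G H : 'I_d -> 'rV[R]_d -> R).

Definition vip F G : R := \sum_i ip (F i) (G i).

Definition vsqint F : Prop := forall i, sqint (F i).

Lemma vip_ge0 F : 0 <= vip F F.
Proof. by apply: sumr_ge0 => i _; exact: ip_ge0. Qed.

Lemma vipC F G : vip F G = vip G F.
Proof. by apply: eq_bigr => i _; rewrite ipC. Qed.

Lemma vip_linl a b F G H : vsqint F -> vsqint G -> vsqint H ->
  vip (fun i x => a * F i x + b * G i x) H = a * vip F H + b * vip G H.
Proof.
move=> sF sG sH; rewrite /vip !mulr_sumr -big_split/=; apply: eq_bigr => i _.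
by rewrite ip_linl.
Qed.

Lemma vip_linr a b F G H : vsqint F -> vsqint G -> vsqint H ->
  vip H (fun i x => a * F i x + b * G i x) = a * vip H F + b * vip H G.
Proof. by move=> sF sG sH; rewrite vipC vip_linl// !(vipC H). Qed.

Lemma vsqint_lin a b F G : vsqint F -> vsqint G -> vsqint (fun i x => a * F i x + b * G i x).
Proof. by move=> sF sG i; exact: sqint_lin. Qed.

Lemma vip_cauchy_schwarz F G : vsqint F -> vsqint G ->
  vip F G ^+ 2 <= vip F F * vip G G.
Proof.
move=> sF sG; apply: discriminant_le; [exact: vip_ge0..|] => t.
have := vip_ge0 (fun i x => 1 * F i x + t * G i x).
have s := vsqint_lin 1 t sF sG.
rewrite vip_linl// !vip_linr// (vipC G F).
by move: (vip F F) (vip F G) (vip G G) => x y q; rewrite !mul1r; lra.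
Qed.

Lemma vip_eqv F G F' G' : (forall i, eqv (F i) (F' i)) -> (forall i, eqv (G i) (G' i)) ->
  vip F G = vip F' G'.
Proof. by move=> E E'; apply: eq_bigr => i _; exact: eqv_ip. Qed.

Definition flux (B : 'rV[R]_d -> 'M[R]_d) F (i : 'I_d) (x : 'rV[R]_d) : R :=
  \sum_j B x i j * F j x.

Lemma poincare_H10 : (0 < d)%N -> exists2 C, 0 <= C & forall v, H10 Omega v -> ip v v <= C * gradsq v.
Proof.
move=> d0; have [N [_ ON]] := bounded_set_cube bO.
have [C C0 [i HC]] := poincare_coord N d0.
exists C => // v Hv; have [z [tz Hz]] := H10_seq Hv.
have c1 := l2_cvg_ip2 (h1_cvg_l2 Hz).
have c2 : C * gradsq (z n) @[n --> \oo] --> C * gradsq v.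
  by apply: cvgM; [exact: cvg_cst|exact: h1_cvg_gradsq].
apply: (ler_cvg_to c1 c2); apply: nearW => m; set w := z m.
have tw : test w := tz m.
have := HC w (test_C1c tw ON).
rewrite -Rintegral_out => [|x nx]; last by rewrite (test_out tw nx) expr0n.
rewrite -Rintegral_out => [|x nx]; last by rewrite (test_out (test_partial i tw) nx) expr0n.
rewrite -!ipE => /le_trans; apply; apply: (ler_wpM2l C0).
have [_ /(_ i) E] := smooth_H1 (test_smooth tw).
by rewrite -(eqv_ip E E); exact: gr_le_gradsq.
Qed.

Lemma gradsq_sub u v : H1 Omega u -> H1 Omega v ->
  gradsq (fun x => u x - v x) = \sum_i dist (gr u i) (gr v i).
Proof.
by move=> Hu Hv; have [_ E] := H1_sub Hu Hv; apply: eq_bigr => i _; exact: eqv_ip.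
Qed.

(** By Poincaré a Cauchy sequence for the gradients is also Cauchy in L^2; the two L^2 limits are
    related by the weak gradient identity, which passes to the limit against each test function. *)
Lemma H10_complete (s : nat -> 'rV[R]_d -> R) : (0 < d)%N ->
  (forall n, H10 Omega (s n)) ->
  (forall e : R, 0 < e -> exists N, forall m n, (N <= m)%N -> (N <= n)%N ->
     gradsq (fun x => s m x - s n x) <= e) ->
  exists l, H10 Omega l /\ forall e : R, 0 < e -> exists N, forall n, (N <= n)%N ->
     gradsq (fun x => s n x - l x) <= e.
Proof.
move=> d0 Hs cs; have [C C0 HC] := poincare_H10 d0.
have H1s n := H10_H1 (Hs n).
have [l [sl cl]] : exists l, sqint l /\ (forall e : R, 0 < e -> exists N, forall n, (N <= n)%N ->
    dist (s n) l <= e).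
  apply: sqint_complete => // [n|e e0]; first exact: H1_sqint.
  have [|N HN] := cs (e / (C + 1)); first by rewrite divr_gt0// ltr_wpDl.
  exists N => m n Nm Nn; have H10s := H10_lin 1 (-1) (Hs m) (Hs n).
  have := HC _ H10s.
  rewrite (_ : (fun x => 1 * s m x + -1 * s n x) = (fun x => s m x - s n x)); last by apply/funext => x; ring.
  move/le_trans; apply; apply: le_trans (ler_wpM2l C0 (HN m n Nm Nn)) _.
  by rewrite mulrCA ger_pMr// ler_pdivrMr ?ltr_wpDl// mul1r lerDl.
have /choice[G HG] i : exists G : 'rV[R]_d -> R, sqint G /\ (forall e : R, 0 < e -> exists N, forall n, (N <= n)%N ->
    dist (gr (s n) i) G <= e).
  apply: (sqint_complete mO (f := fun n => gr (s n) i)) => [n|e e0]; first exact: gr_sqint.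
  have [N HN] := cs e e0; exists N => m n Nm Nn; apply: le_trans (HN m n Nm Nn).
  rewrite gradsq_sub// (bigD1 i)//= lerDl; apply: sumr_ge0 => j _; exact: ip_ge0.
have cl' : l2_cvg s l.
  split => // [n|e e0]; first exact: H1_sqint.
  by have [N HN] := cl e e0; exists N => n /HN; rewrite ipBC.
have cG i : l2_cvg (fun n => gr (s n) i) (G i).
  have [sG cG] := HG i.
  split => // [n|e e0]; first exact: gr_sqint.
  by have [N HN] := cG e e0; exists N => n /HN; rewrite ipBC.
have [Hl El] : H1 Omega l /\ forall i, eqv (gr l i) (G i).
  apply: H1_intro => // [i|i z tz]; first by case: (HG i).
  have c1 := l2_cvg_ip cl' (test_sqint (test_partial i tz)).
  have c2 := l2_cvg_ip (cG i) (test_sqint tz).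
  apply: (cvg_unique _ c1) => //.
  rewrite (_ : (fun n => ip (s n) (partial i z)) = (fun n => - ip (gr (s n) i) z)); first exact: cvgN.
  by apply/funext => n; rewrite gr_test// opprK.
have dG n i : dist (gr l i) (gr (s n) i) = dist (G i) (gr (s n) i).
  by apply: ip_sub_eqv => //; apply: eqv_refl; exact: gr_sqint.
have c0 : h1sq (fun x => l x - s n x) @[n --> \oo] --> (0 : R).
  have c0' (f' : nat -> 'rV[R]_d -> R) f : l2_cvg f' f -> dist f (f' n) @[n --> \oo] --> (0 : R).
    move=> [_ _ Hc]; apply/cvgrPdist_le => e e0; have [N HN] := Hc e e0; exists N => // n /= Nn.
    by rewrite sub0r normrN ger0_norm ?ip_ge0// HN.
  have : dist l (s n) + \sum_i dist (G i) (gr (s n) i) @[n --> \oo] --> 0 + \sum_(i < d) (0 : R).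
    apply: cvgD; first exact: c0'.
    apply: cvg_big; first exact: add_continuous.
    by move=> i _; exact: c0' (cG i).
  rewrite big1// addr0; apply: cvg_trans; apply: near_eq_cvg; apply: nearW => n.
  by rewrite /h1sq gradsq_sub//; congr (_ + _); apply: eq_bigr => i _; rewrite dG.
have c0e e : 0 < e -> exists N, forall n, (N <= n)%N -> h1sq (fun x => l x - s n x) <= e.
  move/cvgrPdist_le : c0 => /(_ e) + e0 => /(_ e0)[N _ HN]; exists N => n Nn.
  by have := HN n Nn; rewrite sub0r normrN ger0_norm ?h1sq_ge0.
exists l; split.
  apply: H10_closed => // e e0; have [N HN] := c0e e e0.
  by exists (s N); split => //; exact: HN.
move=> e e0; have [N HN] := c0e e e0; exists N => n Nn.
apply: le_trans (HN n Nn); have -> : gradsq (fun x => s n x - l x) = gradsq (fun x => l x - s n x).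
  by rewrite (gradsq_sub (H1s n) Hl) (gradsq_sub Hl (H1s n)); apply: eq_bigr => i _; rewrite ipBC.
by rewrite /h1sq lerDr ip_ge0.
Qed.

Section coefficients.
Variables (alpha beta : R) (B : 'rV[R]_d -> 'M[R]_d).
Hypothesis cB : coef_class alpha beta Omega B.

Lemma flux_mxapp F x i : flux B F i x = mxapp (B x) (row_field F x) ord0 i.
Proof.
rewrite /flux /mxapp mxE; apply: eq_bigr => j _; rewrite !mxE; exact: mulrC.
Qed.

Lemma flux_lin a b F G i x : flux B (fun i x => a * F i x + b * G i x) i x = a * flux B F i x + b * flux B G i x.
Proof.
by rewrite /flux !mulr_sumr -big_split/=; apply: eq_bigr => j _; ring.
Qed.

Lemma flux_measurable F i : vsqint F -> measurable_fun Omega (flux B F i).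
Proof.
move=> sF; apply: measurable_sum => j; apply: measurable_funM; first exact: cB.1.
by case: (sF j).
Qed.

Lemma flux_bound F : {ae leb, forall x, Omega x -> forall i, flux B F i x ^+ 2 <= beta ^+ 2 * \sum_j F j x ^+ 2}.
Proof.
have [_] := cB; apply: filterS => x H Ox i; have [_ /(_ (row_field F x))[_ Hb]] := H Ox.
apply: (@le_trans _ _ (enorm (mxapp (B x) (row_field F x)) ^+ 2)).
  rewrite enorm_sqr /vdot (bigD1 i)//= -flux_mxapp -expr2 lerDl.
  by apply: sumr_ge0 => j _; rewrite -expr2 sqr_ge0.
have -> : \sum_j F j x ^+ 2 = enorm (row_field F x) ^+ 2.
  by rewrite enorm_sqr /vdot; apply: eq_bigr => j _; rewrite !mxE expr2.
rewrite -exprMn lerXn2r ?nnegrE ?sqrtr_ge0//.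
by apply: le_trans Hb; rewrite sqrtr_ge0.
Qed.

Lemma flux_sqint F i : vsqint F -> sqint (flux B F i) /\ ip (flux B F i) (flux B F i) <= beta ^+ 2 * vip F F.
Proof.
move=> sF; have m := flux_measurable i sF.
have sbF j : sqint (fun x => beta ^+ 2 * F j x) by exact: sqintZ.
pose q (x : 'rV[R]_d) := \sum_j (beta ^+ 2 * F j x) * F j x.
have qE x : q x = beta ^+ 2 * \sum_j F j x ^+ 2.
  by rewrite mulr_sumr; apply: eq_bigr => j _; rewrite -mulrA expr2.
have q0 x : 0 <= q x by rewrite qE mulr_ge0 ?sqr_ge0// sumr_ge0// => j _; exact: sqr_ge0.
have [iq intq] := sum_ip_Rintegral sbF sF.
have mq : measurable_fun Omega (EFin \o q) by case/integrableP : iq.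
have le : (\int[leb]_(x in Omega) (flux B F i x ^+ 2)%:E <= \int[leb]_(x in Omega) (q x)%:E)%E.
  apply: ae_ge0_le_integral => //.
  - by move=> x _; rewrite lee_fin sqr_ge0.
  - exact/measurable_EFinP/measurable_funX.
  - by move=> x _; rewrite lee_fin.
  - by have := flux_bound F; apply: filterS => x H Ox; rewrite lee_fin qE; exact: H.
have s : sqint (flux B F i).
  split => //; apply/integrableP; split; first exact/measurable_EFinP/measurable_funX.
  under eq_integral do rewrite gee0_abs ?lee_fin ?sqr_ge0//.
  apply: le_lt_trans le _; have := integrable_fin_num mO iq.
  rewrite ge0_fin_numE; first exact; apply: integral_ge0 => x _; rewrite lee_fin; exact: (q0 x).
split => //.
have -> : beta ^+ 2 * vip F F = \int[leb]_(x in Omega) q x.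
  by rewrite intq /vip mulr_sumr; apply: eq_bigr => j _; rewrite ipZl.
rewrite ipE /Rintegral; apply: fine_le le.
- exact: (integrable_fin_num mO s.2).
- exact: (integrable_fin_num mO iq).
Qed.

Lemma flux_vsqint F : vsqint F -> vsqint (flux B F).
Proof. by move=> sF i; case: (flux_sqint i sF). Qed.

Lemma flux_vip_le F : vsqint F -> vip (flux B F) (flux B F) <= d%:R * beta ^+ 2 * vip F F.
Proof.
move=> sF; apply: (@le_trans _ _ (\sum_(i < d) beta ^+ 2 * vip F F)).
  by apply: ler_sum => i _; exact: (flux_sqint i sF).2.
by rewrite sumr_const card_ord -[_ *+ d]mulr_natl mulrA.
Qed.

Lemma flux_eqv F G : (forall i, eqv (F i) (G i)) -> forall i, eqv (flux B F i) (flux B G i).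
Proof.
move=> E i.
have sF : vsqint F by move=> j; case: (E j).
have sG : vsqint G by move=> j; case: (E j).
have [s1 _] := flux_sqint i sF; have [s2 _] := flux_sqint i sG.
split => // h sh; apply/eqP; rewrite -subr_eq0 -ipBl//; apply/eqP.
apply: ip_eq0 => //; first exact: sqintB.
have [s3 le] := flux_sqint i (vsqint_lin 1 (-1) sF sG).
have D x : flux B (fun i x => 1 * F i x + -1 * G i x) i x = flux B F i x - flux B G i x.
  by rewrite flux_lin mul1r mulN1r.
rewrite (eq_ip _ _ D D) in le.
apply/eqP; rewrite eq_le ip_ge0 andbT; apply: le_trans le _.
have E1 := fun j => eqv_lin 1 (-1) (E j) (eqv_refl (sG j)).
rewrite (vip_eqv E1 E1) [X in _ * X](_ : _ = 0) ?mulr0//.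
rewrite /vip big1// => j _.
rewrite (_ : (fun x => 1 * G j x + -1 * G j x) = fun=> 0) ?ip0l//.
by apply/funext => x; rewrite mul1r mulN1r subrr.
Qed.

Lemma ae_eq_Rintegral f g : measurable_fun Omega f -> measurable_fun Omega g ->
  {ae leb, forall x, Omega x -> f x = g x} ->
  \int[leb]_(x in Omega) f x = \int[leb]_(x in Omega) g x.
Proof.
move=> mf mg fg; congr fine; apply: ae_eq_integral => //.
- exact/measurable_EFinP.
- exact/measurable_EFinP.
- by apply: filterS fg => x H Ox; rewrite H.
Qed.

Lemma sum_mul_measurable F G : vsqint F -> vsqint G ->
  measurable_fun Omega (fun x => \sum_i F i x * G i x).
Proof.
move=> sF sG; have [/integrableP[/measurable_EFinP m _] _] := sum_ip_Rintegral sF sG.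
exact: m.
Qed.

(** The weight [psi] serves the localised argument of [flux_defect_sym]; with [psi] = 1 this is the
    symmetry of the energy. *)
Lemma flux_sym F G psi : vsqint F -> vsqint G -> smooth psi ->
  vip (flux B F) (fun i x => psi x * G i x) = vip (flux B G) (fun i x => psi x * F i x).
Proof.
move=> sF sG spsi.
have s1 : vsqint (fun i x => psi x * F i x) by move=> i; exact: smooth_mul_sqint.
have s2 : vsqint (fun i x => psi x * G i x) by move=> i; exact: smooth_mul_sqint.
have sf := flux_vsqint sF; have sg := flux_vsqint sG.
rewrite /vip -(sum_ip_Rintegral sf s2).2 -(sum_ip_Rintegral sg s1).2.
apply: ae_eq_Rintegral; [exact: sum_mul_measurable|exact: sum_mul_measurable|].
have [_] := cB; apply: filterS => x H Ox; have [symB _] := H Ox.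
rewrite /flux.
under eq_bigr => i _ do rewrite mulr_suml.
under [RHS]eq_bigr => i _ do rewrite mulr_suml.
rewrite exchange_big/=; apply: eq_bigr => i _; apply: eq_bigr => j _.
have -> : B x j i = B x i j by rewrite -[in LHS]symB mxE.
ring.
Qed.

Lemma flux_coercive F : vsqint F -> alpha * vip F F <= vip (flux B F) F.
Proof.
move=> sF; have sf := flux_vsqint sF.
pose D i x := flux B F i x - alpha * F i x.
have sD : vsqint D by move=> i; apply: sqintB => //; exact: sqintZ.
have DE : vip D F = vip (flux B F) F - alpha * vip F F.
  rewrite /vip mulr_sumr -sumrB; apply: eq_bigr => i _.
  by rewrite (ipBl mO (sf i) (sqintZ mO _ (sF i)) (sF i)) (ipZl mO _ (sF i) (sF i)).
rewrite -subr_ge0 -DE /vip -(sum_ip_Rintegral sD sF).2.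
have m := sum_mul_measurable sD sF.
(* The integrand is nonnegative almost everywhere only; it is replaced by its absolute value, which
   is so everywhere. *)
rewrite (@ae_eq_Rintegral _ (fun x => `|\sum_i D i x * F i x|))//.
- by apply: Rintegral_ge0.
- exact: measurableT_comp.
have [_] := cB; apply: filterS => x H Ox; have [_ /(_ (row_field F x))[Hc _]] := H Ox.
rewrite ger0_norm//; move: Hc; rewrite enorm_sqr /vdot mulr_sumr -subr_ge0 -sumrB.
move/le_trans; apply; apply: ler_sum => i _.
by rewrite -flux_mxapp !mxE /D mulrBl mulrA.
Qed.

Lemma row_field_wgrad u x : row_field (fun i => gr u i) x = wgrad Omega u x.
Proof. by apply/rowP => i; rewrite mxE. Qed.

Lemma energyE u v : H1 Omega u -> H1 Omega v ->
  energy Omega B u v = vip (flux B (fun i => gr u i)) (fun i => gr v i).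
Proof.
move=> Hu Hv.
have su : vsqint (fun i => gr u i) by move=> i; exact: gr_sqint.
have sv : vsqint (fun i => gr v i) by move=> i; exact: gr_sqint.
rewrite /vip -(sum_ip_Rintegral (flux_vsqint su) sv).2; apply: eq_Rintegral => x _.
by rewrite /vdot; apply: eq_bigr => i _; rewrite flux_mxapp row_field_wgrad.
Qed.

Lemma energy_linl a b u v w : H1 Omega u -> H1 Omega v -> H1 Omega w ->
  energy Omega B (fun x => a * u x + b * v x) w = a * energy Omega B u w + b * energy Omega B v w.
Proof.
move=> Hu Hv Hw; have [Huv E] := H1_lin a b Hu Hv.
have sg q : H1 Omega q -> vsqint (fun i => gr q i) by move=> Hq i; exact: gr_sqint.
rewrite !energyE// (vip_eqv (flux_eqv E) (fun i => eqv_refl (sg _ Hw i))).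
rewrite -vip_linl//; [|exact: (flux_vsqint (sg _ _))|exact: (flux_vsqint (sg _ _))|exact: sg].
by congr (vip _ _); apply/funext => i; apply/funext => x; rewrite flux_lin.
Qed.

Lemma energyC u v : H1 Omega u -> H1 Omega v -> energy Omega B u v = energy Omega B v u.
Proof.
move=> Hu Hv; rewrite (energyE Hu Hv) (energyE Hv Hu).
have := flux_sym (fun i => gr_sqint i Hu) (fun i => gr_sqint i Hv) (smooth_cst 1).
have E q : (fun (i : 'I_d) x => 1 * gr q i x) = (fun i => gr q i).
  by apply/funext => i; apply/funext => x; rewrite mul1r.
by rewrite !E.
Qed.

Lemma energy_linr a b u v w : H1 Omega u -> H1 Omega v -> H1 Omega w ->
  energy Omega B w (fun x => a * u x + b * v x) = a * energy Omega B w u + b * energy Omega B w v.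
Proof.
move=> Hu Hv Hw; have [Huv _] := H1_lin a b Hu Hv.
by rewrite (energyC Hw Huv) (energy_linl a b Hu Hv Hw) (energyC Hu Hw) (energyC Hv Hw).
Qed.

Lemma energy_coercive u : H1 Omega u -> alpha * gradsq u <= energy Omega B u u.
Proof. by move=> Hu; rewrite (energyE Hu Hu); apply: flux_coercive => i; exact: gr_sqint. Qed.

Lemma energy_sqr_le u v : H1 Omega u -> H1 Omega v ->
  energy Omega B u v ^+ 2 <= d%:R * beta ^+ 2 * gradsq u * gradsq v.
Proof.
move=> Hu Hv; rewrite (energyE Hu Hv).
have su : vsqint (fun i => gr u i) by move=> i; exact: gr_sqint.
have sv : vsqint (fun i => gr v i) by move=> i; exact: gr_sqint.
apply: le_trans (vip_cauchy_schwarz (flux_vsqint su) sv) _.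
by apply: ler_wpM2r; [exact: vip_ge0|exact: flux_vip_le].
Qed.

(** The square of the energy is at most K q^2 with q the squared gradient; since K <= (K + 1)^2, the
    constant K + 1 spares a square root. *)
Lemma energy_le u : H1 Omega u -> energy Omega B u u <= (d%:R * beta ^+ 2 + 1) * gradsq u.
Proof.
move=> Hu; have := energy_sqr_le Hu Hu.
have K0 : 0 <= d%:R * beta ^+ 2 by rewrite mulr_ge0 ?sqr_ge0.
have g0 := gradsq_ge0 u.
move: (energy _ _ _ _) (gradsq u) (d%:R * beta ^+ 2) K0 g0 => e q K K0 g0 H.
rewrite leNgt; apply/negP => L.
have h := mulr_ge0 K0 g0; have h2 := mulr_ge0 g0 g0; have h3 := mulr_ge0 K0 h2.
have h4 := mulr_ge0 K0 h3.
have P0 : 0 <= (K + 1) * q by lra.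
have : ((K + 1) * q) ^+ 2 < e ^+ 2 by rewrite ltrXn2r ?nnegrE// (le_trans P0 (ltW L)).
move=> L2; lra.
Qed.

End coefficients.

Lemma test_bd z x : test z -> bd Omega x -> z x = 0.
Proof.
move=> tz [_ nx]; apply: (test_out tz) => Ox; apply: nx.
by move/interior_id : oO => ->.
Qed.

Lemma h1_cvg_H1norm (s : nat -> 'rV[R]_d -> R) u : h1_cvg s u ->
  H1norm Omega (u \- s n) @[n --> \oo] --> (0 : R).
Proof.
move=> [Hs Hu Hc]; apply/cvgrPdist_le => e e0; have [|N HN] := Hc (e ^+ 2).
  by rewrite exprn_gt0.
exists N => // n /= Nn; rewrite sub0r normrN ger0_norm ?sqrtr_ge0//.
rewrite (H1normE (H1_sub Hu (Hs n)).1).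
by apply: sqrtr_le; [exact: ltW|exact: HN].
Qed.

Lemma h1_cvg_add (s t : nat -> 'rV[R]_d -> R) u v : h1_cvg s u -> h1_cvg t v ->
  h1_cvg (fun n x => s n x + t n x) (fun x => u x + v x).
Proof.
move=> [Hs Hu Hsu] [Ht Hv Htv]; split => [n||e e0].
- exact: (H1_add (Hs n) (Ht n)).1.
- exact: (H1_add Hu Hv).1.
have e4 : 0 < e / 4 by lra.
have [N HN] := Hsu _ e4; have [M HM] := Htv _ e4; exists (maxn N M) => n.
rewrite geq_max => /andP[/HN h1 /HM h2].
have := h1sq_lin_le 1 1 (H1_sub Hu (Hs n)).1 (H1_sub Hv (Ht n)).1.
rewrite (_ : (fun x => 1 * (u x - s n x) + 1 * (v x - t n x)) = (fun x => u x + v x - (s n x + t n x)));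
  last by apply/funext => x; ring.
move: (h1sq _) (h1sq _) (h1sq _) h1 h2 => a b c; lra.
Qed.

(** Test functions vanish on the boundary, so adding them to the approximants of w leaves the
    boundary integrals unchanged. *)
Lemma trace_add_H10 w g v : is_trace Omega w g -> H10 Omega v ->
  is_trace Omega (fun x => w x + v x) g.
Proof.
move=> [Hw mg [s [ss Hs Hg]]] Hv; have [z [tz Hz]] := H10_seq Hv.
have cs := h1_cvg_of_h1norm (fun n => (smooth_H1 (ss n)).1) Hw Hs.
have csz := h1_cvg_add cs Hz.
split => //; first by case: csz.
exists (fun n x => s n x + z n x); split.
- by move=> n; apply: smoothD => //; exact: test_smooth.
- exact: h1_cvg_H1norm csz.
apply: cvg_trans Hg; apply: near_eq_cvg; apply: nearW => n.
apply: eq_integral => x; rewrite inE => bx.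
by rewrite (test_bd (tz n) bx) addr0.
Qed.

Lemma trace_H10 v : H10 Omega v -> is_trace Omega v (fun=> 0).
Proof.
move=> Hv; rewrite (_ : v = (fun x => (fun=> 0) x + v x)); last by apply/funext => x; rewrite add0r.
apply: trace_add_H10 => //.
have s0 : smooth (fun _ : 'rV[R]_d => 0 : R) by exact: (smooth_cst 0).
have H0 := (smooth_H1 s0).1.
split => //.
exists (fun=> fun=> 0); split => //.
  apply: h1_cvg_H1norm; split => // e e0; exists 0%N => n _.
  have E : (fun x : 'rV[R]_d => (0 : R) - 0) = (fun x => 0 * 0 + 0 * 0).
    by apply/funext => x; rewrite !mulr0 addr0 subr0.
  rewrite E; apply: le_trans (h1sq_lin_le 0 0 H0 H0) _.
  by rewrite expr0n mulr0 !mul0r addr0 ltW.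
rewrite (_ : (fun n => _) = fun=> 0%E); first exact: cvg_cst.
by apply/funext => n; apply: integral0_eq => x _; rewrite subrr expr0n.
Qed.

Lemma bounded_functional_lin (V : set ('rV[R]_d -> R)) l a b u v :
  (forall a b u v, V u -> V v -> V (fun x => a * u x + b * v x)) ->
  bounded_functional Omega V l -> V u -> V v ->
  l (fun x => a * u x + b * v x) = a * l u + b * l v.
Proof.
move=> Vl [ll _] Vu Vv.
have V0 : V (fun=> 0).
  have := Vl 0 0 u u Vu Vu; congr V; apply/funext => x; rewrite !mul0r addr0//.
have l0 : l (fun=> 0) = 0.
  have := ll 1 _ _ V0 V0; rewrite (_ : _ \+ _ = fun=> 0).
    by rewrite mul1r => E; apply: (addrI (l (fun=> 0))); rewrite addr0.
  by apply/funext => x /=; rewrite mulr0 addr0.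
have lZ c q : V q -> V (fun x => c * q x) /\ l (fun x => c * q x) = c * l q.
  move=> Vq; have E : (fun x => c * q x) = (fun x => c * q x + 0 * 0).
    by apply/funext => x; rewrite mul0r addr0.
  split; first by rewrite E; exact: (Vl c 0 q (fun=> 0)).
  have := ll c _ _ Vq V0; rewrite l0 addr0 => <-; congr l.
  by apply/funext => x /=; rewrite addr0.
by have [Vb <-] := lZ b v Vv; rewrite -(ll a u (fun x => b * v x) Vu Vb).
Qed.

(** The boundary datum is lifted by w, and the correction v in H^1_0 is the one that [riesz]
    provides for the energy form and the functional [l] minus the energy of w. *)
Lemma weak_solution_exists (alpha beta : R) B l g w : (0 < d)%N -> 0 < alpha ->
  coef_class alpha beta Omega B -> Hm1 Omega l -> is_trace Omega w g ->
  exists u, weak_solution Omega B l g u.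
Proof.
move=> d0 a0 cB bl tw; have Hw : H1 Omega w by case: tw.
have [C C0 HC] := poincare_H10 d0.
have [_ [D HD]] := bl.
have L v (Hv : H10 Omega v) := H10_H1 Hv.
have V0 : H10 Omega (fun=> 0) by exact: (test_H10 (test0 Omega)).
pose F v := l v - energy Omega B w v.
(* F^2 is at most twice l^2 plus twice the squared energy of w against v. Poincaré bounds the first
   by the gradient of v, whence 1 + C, and coercivity converts the gradient into the energy, whence
   the division by [alpha]. *)
pose K := (2 * D ^+ 2 * (1 + C) + 2 * (d%:R * beta ^+ 2 * gradsq w)) / alpha.
have D20 := sqr_ge0 D.
have arith (y2 t2 D2 r p q C' : R) : 0 <= D2 -> y2 <= D2 * (p + q) -> t2 <= r * q -> p <= C' * q ->
    2 * y2 + 2 * t2 <= (2 * D2 * (1 + C') + 2 * r) * q.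
  clear; move=> D20 h1 h2 h3; have := ler_wpM2l D20 h3; lra.
have g0 : 0 <= d%:R * beta ^+ 2 * gradsq w by rewrite mulr_ge0 ?gradsq_ge0// mulr_ge0 ?sqr_ge0.
have K1 : 0 <= 2 * D ^+ 2 * (1 + C) + 2 * (d%:R * beta ^+ 2 * gradsq w).
  apply: addr_ge0; last exact: mulr_ge0.
  by apply: mulr_ge0; [exact: mulr_ge0|exact: addr_ge0].
have Ebd v : H10 Omega v -> F v ^+ 2 <= K * energy Omega B v v.
  move=> Hv; have lv := HD v Hv; rewrite (H1normE (L v Hv)) in lv.
  have l2 : l v ^+ 2 <= D ^+ 2 * h1sq v.
    rewrite -(sqr_sqrtr (h1sq_ge0 v)) -exprMn -real_normK ?num_real//.
    by rewrite lerXn2r ?nnegrE// (le_trans _ lv).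
  have e2 := energy_sqr_le cB Hw (L v Hv).
  have gc := energy_coercive cB (L v Hv).
  have pv := HC v Hv; have gv0 := gradsq_ge0 v.
  apply: (@le_trans _ _ (2 * l v ^+ 2 + 2 * energy Omega B w v ^+ 2)).
    by rewrite /F -(sqrrN (energy _ _ _ _)); exact: sqr2_le.
  apply: (@le_trans _ _ ((2 * D ^+ 2 * (1 + C) + 2 * (d%:R * beta ^+ 2 * gradsq w)) * gradsq v)).
    exact: (arith _ _ _ _ _ _ _ D20 l2 e2 pv).
  rewrite /K -[X in _ <= X]mulrA; apply: ler_wpM2l => //; rewrite mulrC ler_pdivlMr// mulrC; exact: gc.
have E1 u v : (fun x => 1 * u x + -1 * v x) = (fun x => u x - v x :> R).
  by apply/funext => x; rewrite mul1r mulN1r.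
pose M := d%:R * beta ^+ 2 + 1.
have M0 : 0 < M by rewrite ltr_wpDl// mulr_ge0 ?sqr_ge0.
have [||||||||s Hs cs|v [Hv HvF]] := @riesz R _ (fun a u b v x => a * u x + b * v x) (H10 Omega) (energy Omega B) F K (fun=> 0).
- exact: V0.
- by move=> a u b v; exact: H10_lin.
- by move=> u v Hu Hv; exact: (energyC cB (L u Hu) (L v Hv)).
- by move=> a u b v q Hu Hv Hq; exact: (energy_linl cB a b (L u Hu) (L v Hv) (L q Hq)).
- move=> u Hu; apply: le_trans (energy_coercive cB (L u Hu)).
  by rewrite mulr_ge0 ?gradsq_ge0// ltW.
- move=> a u b v Hu Hv; rewrite /F (bounded_functional_lin a b (H10_lin) bl Hu Hv).
  rewrite (energy_linr cB a b (L u Hu) (L v Hv) Hw).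
  by move: (energy Omega B w u) (energy Omega B w v) (l u) (l v) => p q r t; ring.
- exact: Ebd.
- by rewrite divr_ge0// ltW.
(* Coercivity turns Cauchy for the energy into Cauchy for the gradients, and the upper bound M
   brings the convergence back. *)
- have [|q [Hq cq]] := H10_complete d0 Hs.
    move=> e e0; have [|N HN] := cs (alpha * e); first exact: mulr_gt0.
    exists N => m n Nm Nn; have := HN m n Nm Nn; rewrite E1 => H.
    have Hmn := (H1_sub (L _ (Hs m)) (L _ (Hs n))).1.
    rewrite -(ler_pM2l a0); exact: le_trans (energy_coercive cB Hmn) H.
  exists q; split => // e e0; have [|N HN] := cq (e / M); first exact: divr_gt0.
  exists N => n Nn; rewrite E1.
  have Hmn := (H1_sub (L _ (Hs n)) (L _ Hq)).1.
  apply: le_trans (energy_le cB Hmn) _.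
  by rewrite -ler_pdivlMl// mulrC; exact: HN.
exists (fun x => w x + v x); split; first exact: trace_add_H10.
move=> q Hq; have := energy_linl cB 1 1 Hw (L v Hv) (L q Hq).
rewrite (_ : (fun x => 1 * w x + 1 * v x) = (fun x => w x + v x)); last by apply/funext => x; ring.
by move=> ->; rewrite (HvF q Hq) /F !mul1r addrC subrK.
Qed.

(** * Convergence of the flux defects *)

Lemma vipBr F G H : vsqint F -> vsqint G -> vsqint H ->
  vip F (fun i x => G i x - H i x) = vip F G - vip F H.
Proof.
by move=> sF sG sH; rewrite /vip -sumrB; apply: eq_bigr => i _; rewrite ipBr.
Qed.

Lemma vipBl F G H : vsqint F -> vsqint G -> vsqint H ->
  vip (fun i x => F i x - G i x) H = vip F H - vip G H.
Proof.
by move=> sF sG sH; rewrite /vip -sumrB; apply: eq_bigr => i _; rewrite ipBl.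
Qed.

Lemma vipDr F G H : vsqint F -> vsqint G -> vsqint H ->
  vip F (fun i x => G i x + H i x) = vip F G + vip F H.
Proof.
by move=> sF sG sH; rewrite /vip -big_split; apply: eq_bigr => i _; rewrite ipDr.
Qed.

Lemma vsqintB F G : vsqint F -> vsqint G -> vsqint (fun i x => F i x - G i x).
Proof. by move=> sF sG i; exact: sqintB. Qed.

Lemma vsqintM w F : smooth w -> vsqint F -> vsqint (fun i x => w x * F i x).
Proof. by move=> sw sF i; exact: smooth_mul_sqint. Qed.

Lemma vip_mulB w F G H : smooth w -> vsqint F -> vsqint G -> vsqint H ->
  vip F (fun i x => w x * (G i x - H i x)) =
  vip F (fun i x => w x * G i x) - vip F (fun i x => w x * H i x).
Proof.
move=> sw sF sG sH.
rewrite -(vipBr sF (vsqintM sw sG) (vsqintM sw sH)); congr (vip F _).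
by apply/funext => i; apply/funext => x; rewrite mulrBr.
Qed.

Lemma vipB_le F G : vsqint F -> vsqint G ->
  vip (fun i x => F i x - G i x) (fun i x => F i x - G i x) <= 2 * vip F F + 2 * vip G G.
Proof.
move=> sF sG; rewrite /vip !mulr_sumr -big_split; apply: ler_sum => i _ /=.
have := ip_lin_le 1 (-1) (sF i) (sG i); rewrite sqrrN expr1n mulr1.
by congr (_ <= _); apply: eq_ip => x; rewrite mul1r mulN1r.
Qed.

Lemma eqv_smooth_mul w f g : smooth w -> eqv f g ->
  eqv (fun x => w x * f x) (fun x => w x * g x).
Proof.
move=> sw [sf sg E]; split => [||h sh]; [exact: smooth_mul_sqint..|].
have M q : ip (fun x => w x * q x) h = ip q (fun x => w x * h x).
  by apply: eq_Rintegral => x _; ring.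
by rewrite !M; apply: E; exact: smooth_mul_sqint.
Qed.

Definition bounded_family (F : R -> 'I_d -> 'rV[R]_d -> R) : Prop :=
  (forall e, 0 < e -> vsqint (F e)) /\
  exists2 M, 0 <= M & \forall e \near 0^'+, vip (F e) (F e) <= M.

Lemma vip_cvg0 (F G : R -> 'I_d -> 'rV[R]_d -> R) : bounded_family F ->
  (forall e, 0 < e -> vsqint (G e)) ->
  vip (G e) (G e) @[e --> 0^'+] --> (0 : R) ->
  vip (F e) (G e) @[e --> 0^'+] --> (0 : R).
Proof.
move=> [sF [M M0 HM]] sG cG; apply/cvgrPdist_le => del del0.
have d1 : 0 < del ^+ 2 / (M + 1) by rewrite divr_gt0 ?exprn_gt0// ltr_wpDl.
move/cvgrPdist_le : cG => /(_ _ d1) cG.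
apply: filterS3 HM cG (nbhs_right_gt (0 : R)) => e hM hG e0.
rewrite sub0r normrN in hG; rewrite sub0r normrN.
have hG' := le_trans (ler_norm _) hG.
rewrite -(@ler_pXn2r _ 2) ?nnegrE ?(ltW del0)// real_normK ?num_real//.
apply: le_trans (vip_cauchy_schwarz (sF e e0) (sG e e0)) _.
apply: le_trans (ler_pM (vip_ge0 _) (vip_ge0 _) hM hG') _.
rewrite mulrCA ger_pMr ?exprn_gt0// ler_pdivrMr ?ltr_wpDl// mul1r; lra.
Qed.

Lemma vip_cvg0_approx (F : R -> 'I_d -> 'rV[R]_d -> R) G : bounded_family F -> vsqint G ->
  (forall eta : R, 0 < eta -> exists H, [/\ vsqint H,
     vip (fun i x => G i x - H i x) (fun i x => G i x - H i x) <= eta &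
     vip (F e) H @[e --> 0^'+] --> (0 : R)]) ->
  vip (F e) G @[e --> 0^'+] --> (0 : R).
Proof.
move=> [sF [M M0 HM]] sG HG; apply/cvgrPdist_le => del del0.
have d2 : 0 < del / 2 by lra.
have eta0 : 0 < (del / 2) ^+ 2 / (M + 1) by rewrite divr_gt0 ?exprn_gt0// ltr_wpDl.
have [H [sH GH cH]] := HG _ eta0.
move/cvgrPdist_le : cH => /(_ _ d2) cH.
apply: filterS3 HM cH (nbhs_right_gt (0 : R)) => e hM hH e0.
rewrite sub0r normrN in hH; rewrite sub0r normrN.
have -> : vip (F e) G = vip (F e) H + vip (F e) (fun i x => G i x - H i x).
  by rewrite (vipBr (sF e e0) sG sH) addrC subrK.
have k : `|vip (F e) (fun i x => G i x - H i x)| <= del / 2.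
  rewrite -(@ler_pXn2r _ 2) ?nnegrE ?(ltW d2)// real_normK ?num_real//.
  apply: le_trans (vip_cauchy_schwarz (sF e e0) (vsqintB sG sH)) _.
  apply: le_trans (ler_pM (vip_ge0 _) (vip_ge0 _) hM GH) _.
  rewrite mulrCA ger_pMr ?exprn_gt0// ler_pdivrMr ?ltr_wpDl// mul1r; lra.
apply: le_trans (ler_normD _ _) _.
by rewrite (_ : del = del / 2 + del / 2); [exact: lerD|lra].
Qed.

(** [c] is the gradient of a test function in [flux_defect_test_partial] and a basis vector in
    [flux_defect_weak]; only the scalar factor runs through L^2, and boundedness of the family makes
    the property closed. *)
Lemma vip_cvg0_density (F : R -> 'I_d -> 'rV[R]_d -> R) (c : 'I_d -> 'rV[R]_d -> R) :
  bounded_family F -> (forall i, smooth (c i)) ->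
  (forall chi a, test chi -> test a ->
     vip (F e) (fun i x => c i x * (chi x * a x)) @[e --> 0^'+] --> (0 : R)) ->
  forall h, sqint h -> vip (F e) (fun i x => c i x * h x) @[e --> 0^'+] --> (0 : R).
Proof.
move=> bF sc Hc.
have sch h : sqint h -> vsqint (fun i x => c i x * h x).
  by move=> sh i; exact: smooth_mul_sqint.
pose V := [set h | sqint h /\ vip (F e) (fun i x => c i x * h x) @[e --> 0^'+] --> (0 : R)].
have /choice[K HK] i := smooth_bounded (sc i).
move=> h sh; suff : V h by case.
apply: (density_ind oO bounded_measure_lty _ _ _ _ sh).
- by move=> f [].
- move=> a b f g [sf cf] [sg cg]; split; first exact: sqint_lin.
  have : a * vip (F e) (fun i x => c i x * f x) + b * vip (F e) (fun i x => c i x * g x)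
      @[e --> 0^'+] --> a * (0 : R) + b * 0.
    by apply: cvgD; apply: cvgM => //; exact: cvg_cst.
  rewrite !mulr0 addr0; apply: cvg_trans; apply: near_eq_cvg; near=> e.
  have e0 : 0 < e by near: e; exact: nbhs_right_gt.
  rewrite -(vip_linr a b (sch f sf) (sch g sg) (bF.1 e e0)); congr (vip _ _).
  by apply/funext => i; apply/funext => x; ring.
- move=> f sf Hf; split => //; apply: vip_cvg0_approx => //; first exact: sch.
  pose S := \sum_i K i ^+ 2; have S0 : 0 <= S by apply: sumr_ge0 => i _; exact: sqr_ge0.
  move=> eta eta0; have [|g [[sg cg] fg]] := Hf (eta / (S + 1)).
    by rewrite divr_gt0// ltr_wpDl.
  exists (fun i x => c i x * g x); split => //; first exact: sch.
  have sfg := sqintB mO sf sg.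
  apply: (@le_trans _ _ (S * ip (fun x => f x - g x) (fun x => f x - g x))).
    rewrite /S mulr_suml; apply: ler_sum => i _.
    have := ip_mul_le (sc i) (HK i) sfg.
    by congr (_ <= _); apply: eq_ip => x; rewrite mulrBr.
  apply: le_trans (ler_wpM2l S0 fg) _.
  by rewrite mulrCA ger_pMr// ler_pdivrMr ?ltr_wpDl// mul1r lerDl.
- move=> chi a tc ta; split; last exact: Hc.
  by apply: test_sqint; exact: (testMr tc (test_smooth ta)).
Unshelve. all: by end_near. Qed.

Section homogenisation.
Variables (alpha beta : R) (A : R -> 'rV[R]_d -> 'M[R]_d) (A0 : 'rV[R]_d -> 'M[R]_d).
Hypothesis d0 : (0 < d)%N.
Hypothesis alpha0 : 0 < alpha.
Hypothesis cA : forall e, 0 < e -> coef_class alpha beta Omega (A e).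
Hypothesis cA0 : coef_class alpha beta Omega A0.
Hypothesis cvA : G_cvg Omega A A0.

(** What the argument keeps of two problems with the same data: [g_pair_closure] and
    [g_pair_closure0] allow cutting off, and [g_pair_energy] says that the flux defect is divergence
    free. *)
Record g_pair (u : R -> 'rV[R]_d -> R) u0 : Prop := GPair {
  g_pair_closure : forall e, 0 < e -> smooth_closure (u e);
  g_pair_closure0 : smooth_closure u0;
  g_pair_cvg : H1_weak_cvg Omega u u0;
  g_pair_energy : forall z e, H10 Omega z -> 0 < e ->
    energy Omega (A e) (u e) z = energy Omega A0 u0 z }.

Definition flux_defect (u : R -> 'rV[R]_d -> R) u0 e i x : R :=
  flux (A e) (grad (u e)) i x - flux A0 (grad u0) i x.

Lemma grad_vsqint u : H1 Omega u -> vsqint (grad u).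
Proof. by move=> Hu i; exact: gr_sqint. Qed.

Section one_pair.
Variables (u : R -> 'rV[R]_d -> R) (u0 : 'rV[R]_d -> R).
Hypothesis gu : g_pair u u0.

Let Hu e : 0 < e -> H1 Omega (u e).
Proof. by move=> /(g_pair_closure gu)[]. Qed.

Let Hu0 : H1 Omega u0. Proof. by case: (g_pair_closure0 gu). Qed.

Lemma g_pair_flux_vsqint e : 0 < e -> vsqint (flux (A e) (grad (u e))).
Proof. by move=> e0; apply: (flux_vsqint (cA e0)); apply: grad_vsqint; exact: Hu. Qed.

Lemma g_pair_flux0_vsqint : vsqint (flux A0 (grad u0)).
Proof. by apply: (flux_vsqint cA0); exact: grad_vsqint. Qed.

Lemma flux_defect_bounded : bounded_family (flux_defect u u0).
Proof.
split=> [e e0|]; first exact: (vsqintB (g_pair_flux_vsqint e0) g_pair_flux0_vsqint).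
have [C C0 HC] := weak_cvg_bounded Hu (g_pair_cvg gu).
have K0 : 0 <= d%:R * beta ^+ 2 by rewrite mulr_ge0 ?sqr_ge0.
exists (2 * (d%:R * beta ^+ 2 * C) + 2 * vip (flux A0 (grad u0)) (flux A0 (grad u0))).
  by apply: addr_ge0; apply: mulr_ge0 => //; [exact: mulr_ge0|exact: vip_ge0].
apply: filterS2 HC (nbhs_right_gt (0 : R)) => e hC e0.
apply: le_trans (vipB_le (g_pair_flux_vsqint e0) g_pair_flux0_vsqint) _.
rewrite lerD2r ler_wpM2l//.
apply: le_trans (flux_vip_le (cA e0) (grad_vsqint (Hu e0))) _.
rewrite ler_wpM2l//; apply: le_trans hC.
by rewrite lerDr ip_ge0.
Qed.

Lemma flux_defect_vsqint e : 0 < e -> vsqint (flux_defect u u0 e).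
Proof. by move=> e0; exact: flux_defect_bounded.1. Qed.

Lemma flux_defect_H10 e z : 0 < e -> H10 Omega z -> vip (flux_defect u u0 e) (grad z) = 0.
Proof.
move=> e0 Hz; have Hz1 := H10_H1 Hz.
rewrite (vipBl (g_pair_flux_vsqint e0) g_pair_flux0_vsqint (grad_vsqint Hz1)).
rewrite -(energyE (cA e0) (Hu e0) Hz1) -(energyE cA0 Hu0 Hz1).
by rewrite (g_pair_energy gu Hz e0) subrr.
Qed.

(** Tests the divergence-free defect with the product of [a] and [y]; the Leibniz rule moves the
    derivative from one factor to the other. *)
Lemma flux_defect_mul e a y : 0 < e -> smooth a -> H1 Omega y ->
  H10 Omega (fun x => a x * y x) ->
  vip (flux_defect u u0 e) (fun i x => a x * grad y i x) =
  - vip (flux_defect u u0 e) (fun i x => partial i a x * y x).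
Proof.
move=> e0 sa Hy Hay; have [_ E] := smooth_mul_H1 sa Hy.
have sF := flux_defect_vsqint e0.
have s1 : vsqint (fun i x => a x * grad y i x) := vsqintM sa (grad_vsqint Hy).
have s2 : vsqint (fun i x => partial i a x * y x).
  by move=> i; exact: (smooth_mul_sqint (smooth_partial i sa) (H1_sqint Hy)).
have := flux_defect_H10 e0 Hay.
rewrite (vip_eqv (fun i => eqv_refl (sF i)) E) (vipDr sF s1 s2).
by move/eqP; rewrite addr_eq0 => /eqP.
Qed.

Lemma flux_defect_anti e a c : 0 < e -> test a -> smooth c ->
  vip (flux_defect u u0 e) (fun i x => a x * grad c i x) =
  - vip (flux_defect u u0 e) (fun i x => c x * grad a i x).
Proof.
move=> e0 ta sc; have sa := test_smooth ta.
have [Hc _] := smooth_H1 sc; have [_ Ea] := smooth_H1 sa.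
rewrite (flux_defect_mul e0 sa Hc (test_H10 (testMr ta sc))); congr (- _).
apply: vip_eqv => i; first exact: (eqv_refl (flux_defect_vsqint e0 i)).
apply: eqv_sym; have := eqv_smooth_mul sc (Ea i); congr eqv.
by apply/funext => x; exact: mulrC.
Qed.

End one_pair.

Section two_pairs.
Variables (u v : R -> 'rV[R]_d -> R) (u0 v0 : 'rV[R]_d -> R).
Hypothesis gu : g_pair u u0.
Hypothesis gv : g_pair v v0.

Let Hu e : 0 < e -> H1 Omega (u e).
Proof. by move=> /(g_pair_closure gu)[]. Qed.

Let Hu0 : H1 Omega u0. Proof. by case: (g_pair_closure0 gu). Qed.

Let Hv e : 0 < e -> H1 Omega (v e).
Proof. by move=> /(g_pair_closure gv)[]. Qed.

Let Hv0 : H1 Omega v0. Proof. by case: (g_pair_closure0 gv). Qed.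

(** The gradient is moved onto [psi] by [flux_defect_mul]. There a bounded family meets [(v e - v0)]
    times a derivative of [psi], which tends to 0 strongly. *)
Lemma flux_defect_div_curl psi : test psi ->
  vip (flux_defect u u0 e) (fun i x => psi x * (grad (v e) i x - grad v0 i x))
    @[e --> 0^'+] --> (0 : R).
Proof.
move=> tpsi; have spsi := test_smooth tpsi.
pose y e x := v e x - v0 x.
have cy : vip (fun i x => partial i psi x * y e x) (fun i x => partial i psi x * y e x)
    @[e --> 0^'+] --> (0 : R).
  rewrite [X in _ --> X](_ : 0 = \sum_(k < d) 0 :> R); last by rewrite big1.
  apply: cvg_big; first exact: add_continuous.
  move=> i _; apply: (weak_cvg_strong_loc (g_pair_closure gv) (g_pair_closure0 gv) (g_pair_cvg gv)).
  exact: test_partial.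
have c0 : vip (flux_defect u u0 e) (fun i x => partial i psi x * y e x) @[e --> 0^'+] --> (0 : R).
  apply: (vip_cvg0 (flux_defect_bounded gu)) cy => e e0 i.
  apply: (smooth_mul_sqint (smooth_partial i spsi)).
  exact: (H1_sqint (H1_sub (Hv e0) Hv0).1).
have : - vip (flux_defect u u0 e) (fun i x => partial i psi x * y e x) @[e --> 0^'+] --> - (0 : R).
  exact: cvgN.
rewrite oppr0; apply: cvg_trans; apply: near_eq_cvg; near=> e.
have e0 : 0 < e by near: e; exact: nbhs_right_gt.
have [Hy Ey] := H1_sub (Hv e0) Hv0.
have Hpy : H10 Omega (fun x => psi x * y e x).
  exact: (test_mul_H10 tpsi (smooth_closure_sub (g_pair_closure gv e0) (g_pair_closure0 gv))).
rewrite -(flux_defect_mul gu e0 spsi Hy Hpy).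
apply: vip_eqv => i; first exact: (eqv_refl (flux_defect_vsqint gu e0 i)).
exact: (eqv_smooth_mul spsi (Ey i)).
Unshelve. all: by end_near. Qed.

(** The defect may be replaced by the full flux: the flux of [u0] is fixed, and against it the weak
    convergence of the gradients suffices. *)
Lemma g_pair_flux_div_curl psi : test psi ->
  vip (flux (A e) (grad (u e))) (fun i x => psi x * (grad (v e) i x - grad v0 i x))
    @[e --> 0^'+] --> (0 : R).
Proof.
move=> tpsi; have spsi := test_smooth tpsi.
have sP := g_pair_flux0_vsqint gu.
have c0 : \sum_i (ip (grad (v e) i) (fun x => psi x * flux A0 (grad u0) i x) -
    ip (grad v0 i) (fun x => psi x * flux A0 (grad u0) i x)) @[e --> 0^'+] --> (0 : R).
  rewrite [X in _ --> X](_ : 0 = \sum_(k < d) 0 :> R); last by rewrite big1.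
  apply: cvg_big; first exact: add_continuous.
  move=> i _; have s := smooth_mul_sqint spsi (sP i).
  rewrite [X in _ --> X](_ : 0 = ip (grad v0 i) (fun x => psi x * flux A0 (grad u0) i x) -
    ip (grad v0 i) (fun x => psi x * flux A0 (grad u0) i x)); last by rewrite subrr.
  by apply: cvgB; [exact: (g_pair_cvg gv (gr_functional i s))|exact: cvg_cst].
have : vip (flux_defect u u0 e) (fun i x => psi x * (grad (v e) i x - grad v0 i x)) +
    \sum_i (ip (grad (v e) i) (fun x => psi x * flux A0 (grad u0) i x) -
    ip (grad v0 i) (fun x => psi x * flux A0 (grad u0) i x)) @[e --> 0^'+] --> (0 : R) + 0.
  by apply: cvgD => //; exact: flux_defect_div_curl.
rewrite addr0; apply: cvg_trans; apply: near_eq_cvg; near=> e.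
have e0 : 0 < e by near: e; exact: nbhs_right_gt.
have sg : vsqint (fun i x => grad (v e) i x - grad v0 i x).
  exact: (vsqintB (grad_vsqint (Hv e0)) (grad_vsqint Hv0)).
have sV : vsqint (fun i x => psi x * (grad (v e) i x - grad v0 i x)) := vsqintM spsi sg.
rewrite (vipBl (g_pair_flux_vsqint gu e0) sP sV).
have -> : \sum_i (ip (grad (v e) i) (fun x => psi x * flux A0 (grad u0) i x) -
    ip (grad v0 i) (fun x => psi x * flux A0 (grad u0) i x)) =
    vip (flux A0 (grad u0)) (fun i x => psi x * (grad (v e) i x - grad v0 i x)).
  apply: eq_bigr => i _; have s := smooth_mul_sqint spsi (sP i).
  rewrite -(ipBl mO (grad_vsqint (Hv e0) i) (grad_vsqint Hv0 i) s).
  by apply: eq_Rintegral => x _; ring.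
by rewrite subrK.
Unshelve. all: by end_near. Qed.

End two_pairs.

Lemma flux_defect_sym (u v : R -> 'rV[R]_d -> R) u0 v0 psi : g_pair u u0 -> g_pair v v0 -> test psi ->
  vip (flux_defect u u0 e) (fun i x => psi x * grad v0 i x) -
  vip (flux_defect v v0 e) (fun i x => psi x * grad u0 i x) @[e --> 0^'+] --> (0 : R).
Proof.
move=> gu gv tpsi; have spsi := test_smooth tpsi.
have [Hu0 _] := g_pair_closure0 gu; have [Hv0 _] := g_pair_closure0 gv.
have : vip (flux (A e) (grad (v e))) (fun i x => psi x * (grad (u e) i x - grad u0 i x)) -
    vip (flux (A e) (grad (u e))) (fun i x => psi x * (grad (v e) i x - grad v0 i x))
    @[e --> 0^'+] --> (0 : R) - 0.
  by apply: cvgB; [exact: (g_pair_flux_div_curl gv gu tpsi)|exact: (g_pair_flux_div_curl gu gv tpsi)].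
rewrite subr0; apply: cvg_trans; apply: near_eq_cvg; near=> e.
have e0 : 0 < e by near: e; exact: nbhs_right_gt.
have [Hu _] := g_pair_closure gu e0; have [Hv _] := g_pair_closure gv e0.
have [su sv su0 sv0] := And4 (grad_vsqint Hu) (grad_vsqint Hv) (grad_vsqint Hu0) (grad_vsqint Hv0).
have sPu := g_pair_flux_vsqint gu e0; have sPv := g_pair_flux_vsqint gv e0.
have sPu0 := g_pair_flux0_vsqint gu; have sPv0 := g_pair_flux0_vsqint gv.
rewrite (vip_mulB spsi sPv su su0) (vip_mulB spsi sPu sv sv0).
rewrite (vipBl sPu sPu0 (vsqintM spsi sv0)) (vipBl sPv sPv0 (vsqintM spsi su0)).
(* Symmetry of [A e] cancels the terms that pair both gradients at [e], symmetry of [A0] those that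
   pair both limit gradients; the mixed terms are the same on both sides. *)
rewrite (flux_sym (cA e0) su sv spsi) (flux_sym cA0 su0 sv0 spsi).
move: (vip _ _) (vip _ _) (vip _ _) (vip _ _) => p q r t; ring.
Unshelve. all: by end_near. Qed.

Local Notation r := flux_defect.

(** The one place where G-convergence is applied. *)
Lemma g_pair_intro l g (u : R -> 'rV[R]_d -> R) u0 : Hm1 Omega l ->
  (forall e, 0 < e -> weak_solution Omega (A e) l g (u e)) ->
  weak_solution Omega A0 l g u0 -> g_pair u u0.
Proof.
move=> bl su su0; split.
- by move=> e /su[tu _]; exact: (trace_smooth_closure tu).
- by case: su0 => tu _; exact: (trace_smooth_closure tu).
- by apply: (cvA bl _ su su0); exists u0; case: su0.
- by move=> z e Hz e0; rewrite (su e e0).2// su0.2.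
Qed.

Lemma energy_Hm1 u : H1 Omega u -> Hm1 Omega (fun z => energy Omega A0 u z).
Proof.
move=> Hu; split.
  move=> a v w Hv Hw; have := energy_linr cA0 a 1 (H10_H1 Hv) (H10_H1 Hw) Hu.
  rewrite mul1r => <-; congr energy.
  by apply/funext => x; rewrite mul1r.
exists (Num.sqrt (d%:R * beta ^+ 2 * gradsq u)) => v Hv; have Hv1 := H10_H1 Hv.
have K0 : 0 <= d%:R * beta ^+ 2 * gradsq u by rewrite mulr_ge0 ?gradsq_ge0// mulr_ge0 ?sqr_ge0.
rewrite (H1normE Hv1) -sqrtrM// -sqrtr_sqr; apply: ler_wsqrtr.
apply: le_trans (energy_sqr_le cA0 Hu Hv1) _.
by apply: (ler_wpM2l K0); rewrite /h1sq lerDr; exact: ip_ge0.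
Qed.

Lemma test_g_pair b : test b -> exists v : R -> 'rV[R]_d -> R, g_pair v b.
Proof.
move=> tb; have Hb := test_H10 tb.
have bl := energy_Hm1 (H10_H1 Hb); have tr := trace_H10 Hb.
(* [choice] asks for a value at every real [e]; for [e <= 0] the function [b] is a dummy. *)
have /choice[v Hv] e : exists v, 0 < e -> weak_solution Omega (A e) (fun z => energy Omega A0 b z) (fun=> 0) v.
  have [e0|ne] := pselect (0 < e); last by exists b.
  have [v Hv] := weak_solution_exists d0 alpha0 (cA e0) bl tr.
  by exists v.
by exists v; apply: (g_pair_intro bl Hv); split.
Qed.

Lemma flux_defect_test3 a b c (v : R -> 'rV[R]_d -> R) : test a -> test b -> test c -> g_pair v b ->
  vip (r v b e) (fun i x => a x * grad c i x) @[e --> 0^'+] --> (0 : R).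
Proof.
move=> ta tb tc gb; have [va ga] := test_g_pair ta; have [vc gc] := test_g_pair tc.
(* T(a; b, c) ~ T(a; c, b) = - T(b; c, a) ~ - T(b; a, c) = T(c; a, b)
   ~ T(c; b, a) = - T(a; b, c) *)
have h1 := flux_defect_sym gb gc ta.
have h2 := flux_defect_sym gc ga tb.
have h3 := flux_defect_sym ga gb tc.
have K := cvgD (cvgB h1 h2) h3.
(* By the antisymmetries the combination in parentheses equals 2 T(a; b, c), whence the factor
   1/2. *)
have K2 : 2^-1 * (vip (r v b e) (fun i x => a x * grad c i x) -
       vip (r vc c e) (fun i x => a x * grad b i x) -
       (vip (r vc c e) (fun i x => b x * grad a i x) -
        vip (r va a e) (fun i x => b x * grad c i x)) +
       (vip (r va a e) (fun i x => c x * grad b i x) -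
        vip (r v b e) (fun i x => c x * grad a i x))) @[e --> 0^'+] --> 2^-1 * (0 - 0 + 0 : R).
  by apply: cvgM; [exact: cvg_cst|exact: K].
move: K2; rewrite subr0 addr0 mulr0; apply: cvg_trans; apply: near_eq_cvg; near=> e.
have e0 : 0 < e by near: e; exact: nbhs_right_gt.
have k1 := flux_defect_anti gc e0 ta (test_smooth tb).
have k2 := flux_defect_anti ga e0 tb (test_smooth tc).
have k3 := flux_defect_anti gb e0 tc (test_smooth ta).
rewrite k1 k2 k3; clear.
move: (vip _ _) (vip _ _) (vip _ _) => p q s; field.
Unshelve. all: by end_near. Qed.

Implicit Types (a c : 'rV[R]_d -> R).

Lemma vip_delta F i h : vip F (fun j x => (j == i)%:R * h x) = ip (F i) h.
Proof.
rewrite /vip (bigD1 i)//= big1 => [|j /negPf ji].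
  by rewrite addr0; apply: eq_ip => // x; rewrite eqxx mul1r.
rewrite ji (_ : (fun x => _) = fun=> 0); last by apply/funext => x; rewrite mul0r.
by rewrite ipC ip0l.
Qed.

(** If h is a product of two test functions this is T(h; c, a); the general h follows by density. It
    is applied to functions h that are smooth without vanishing near the boundary. *)
Lemma flux_defect_test_partial (v : R -> 'rV[R]_d -> R) a c h : g_pair v c -> test a -> test c -> sqint h ->
  vip (r v c e) (fun i x => partial i a x * h x) @[e --> 0^'+] --> (0 : R).
Proof.
move=> gv ta tc; have sa := test_smooth ta.
apply: (vip_cvg0_density (flux_defect_bounded gv) (fun i => smooth_partial i sa)).
move=> chi b tchi tb; have tcb := testMr tchi (test_smooth tb).
have := flux_defect_test3 tcb tc ta gv.
apply: cvg_trans; apply: near_eq_cvg; near=> e.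
have e0 : 0 < e by near: e; exact: nbhs_right_gt.
have [_ E] := smooth_H1 sa.
apply: vip_eqv => i; first exact: (eqv_refl (flux_defect_vsqint gv e0 i)).
have := eqv_smooth_mul (test_smooth tcb) (E i); congr (eqv _ _).
by apply/funext => x; exact: mulrC.
Unshelve. all: by end_near. Qed.

(** [u0] is replaced by a smooth w, and [flux_defect_mul] turns the claim into
    [flux_defect_test_partial] with h = w. *)
Lemma flux_defect_test_closure (v : R -> 'rV[R]_d -> R) a c u0 : g_pair v c -> test a -> test c ->
  smooth_closure u0 ->
  vip (r v c e) (fun i x => a x * grad u0 i x) @[e --> 0^'+] --> (0 : R).
Proof.
move=> gv ta tc [Hu0 Au0]; have sa := test_smooth ta.
apply: (vip_cvg0_approx (flux_defect_bounded gv)).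
  exact: (vsqintM sa (grad_vsqint Hu0)).
have [K HK] := smooth_bounded sa => eta eta0.
have [|w [sw Hw]] := Au0 (eta / (K ^+ 2 + 1)); first by rewrite divr_gt0// ltr_wpDl ?sqr_ge0.
have [Hw1 _] := smooth_H1 sw.
exists (fun i x => a x * grad w i x); split.
- exact: (vsqintM sa (grad_vsqint Hw1)).
- apply: (@le_trans _ _ (K ^+ 2 * gradsq (fun x => u0 x - w x))).
    rewrite (gradsq_sub Hu0 Hw1) mulr_sumr; apply: ler_sum => i _.
    have := ip_mul_le sa HK (sqintB mO (grad_vsqint Hu0 i) (grad_vsqint Hw1 i)).
    by congr (_ <= _); apply: eq_ip => x; rewrite mulrBr.
  have gw : gradsq (fun x => u0 x - w x) <= eta / (K ^+ 2 + 1).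
    by apply: le_trans Hw; rewrite lerDr; exact: ip_ge0.
  apply: le_trans (ler_wpM2l (sqr_ge0 K) gw) _.
  by rewrite mulrCA ger_pMr// ler_pdivrMr ?ltr_wpDl ?sqr_ge0// mul1r lerDl.
have : - vip (r v c e) (fun i x => partial i a x * w x) @[e --> 0^'+] --> - (0 : R).
  by apply: cvgN; exact: (flux_defect_test_partial gv ta tc (smooth_sqint sw)).
rewrite oppr0; apply: cvg_trans; apply: near_eq_cvg; near=> e.
have e0 : 0 < e by near: e; exact: nbhs_right_gt.
rewrite (flux_defect_mul gv e0 sa Hw1)//.
exact: (test_H10 (testMr ta sw)).
Unshelve. all: by end_near. Qed.

(** Symmetry trades the defect of the arbitrary family for that of a family tending to the test
    function c, which the preceding lemma handles. *)
Lemma flux_defect_test2 (u : R -> 'rV[R]_d -> R) u0 a c : g_pair u u0 -> test a -> test c ->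
  vip (r u u0 e) (fun i x => a x * grad c i x) @[e --> 0^'+] --> (0 : R).
Proof.
move=> gu ta tc; have [v gv] := test_g_pair tc.
have h1 := flux_defect_sym gu gv ta.
have h2 := flux_defect_test_closure gv ta tc (g_pair_closure0 gu).
have : vip (r u u0 e) (fun i x => a x * grad c i x) - vip (r v c e) (fun i x => a x * grad u0 i x) +
   vip (r v c e) (fun i x => a x * grad u0 i x) @[e --> 0^'+] --> (0 : R) + 0.
  exact: cvgD.
by rewrite addr0; under eq_fun do rewrite subrK.
Qed.

Lemma flux_defect_weak (u : R -> 'rV[R]_d -> R) u0 i h : g_pair u u0 -> sqint h ->
  ip (r u u0 e i) h @[e --> 0^'+] --> (0 : R).
Proof.
move=> gu sh; under eq_fun do rewrite -vip_delta.
apply: (vip_cvg0_density (flux_defect_bounded gu)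
  (fun j => smooth_cst ((j == i)%:R : R)) _ sh).
(* chi a e_i = a grad (chi x_i) - a x_i grad chi *)
move=> chi a tchi ta; have schi := test_smooth tchi; have sa := test_smooth ta.
have sx : smooth (fun x : 'rV[R]_d => x ord0 i) by exact: smooth_coord.
have tq := testMr tchi sx; have tax := testMr ta sx.
have : vip (r u u0 e) (fun j x => a x * grad (fun x => chi x * x ord0 i) j x) -
    vip (r u u0 e) (fun j x => a x * x ord0 i * grad chi j x) @[e --> 0^'+] --> (0 : R) - 0.
  by apply: cvgB; [exact: (flux_defect_test2 gu ta tq)|exact: (flux_defect_test2 gu tax tchi)].
rewrite subr0; apply: cvg_trans; apply: near_eq_cvg; near=> e.
have e0 : 0 < e by near: e; exact: nbhs_right_gt.
have sF := flux_defect_vsqint gu e0.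
have [_ Eq] := smooth_H1 (test_smooth tq); have [_ Ec] := smooth_H1 schi.
rewrite (vip_eqv (fun j => eqv_refl (sF j)) (fun j => eqv_smooth_mul sa (Eq j))).
rewrite (vip_eqv (fun j => eqv_refl (sF j)) (fun j => eqv_smooth_mul (test_smooth tax) (Ec j))).
have s1 : vsqint (fun j x => a x * partial j (fun x => chi x * x ord0 i) x).
  move=> j; apply: (smooth_mul_sqint sa); apply: smooth_sqint.
  exact: smooth_partial (test_smooth tq).
have s2 : vsqint (fun j x => a x * x ord0 i * partial j chi x).
  move=> j; apply: (smooth_mul_sqint (test_smooth tax)); apply: smooth_sqint.
  exact: smooth_partial schi.
rewrite -(vipBr sF s1 s2); congr (vip _ _); apply/funext => j; apply/funext => x.
by rewrite partialM// partial_coord; ring.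
Unshelve. all: by end_near. Qed.

Lemma flux_defect_vweak (u : R -> 'rV[R]_d -> R) u0 G : g_pair u u0 -> vsqint G ->
  vip (r u u0 e) G @[e --> 0^'+] --> (0 : R).
Proof.
move=> gu sG; rewrite [X in _ --> X](_ : 0 = \sum_(k < d) 0 :> R); last by rewrite big1.
by apply: cvg_big; [exact: add_continuous|move=> i _; exact: flux_defect_weak].
Qed.

(** [dtn] uses the same lifting of [phi] for [A e] and for [A0], so the difference of the two
    energies is exactly the flux defect tested with the gradient of that lifting. *)
Lemma dtn_cvg g phi : Hhalf Omega g -> Hhalf Omega phi ->
  dtn Omega (A e) g phi - dtn Omega A0 g phi @[e --> 0^'+] --> (0 : R).
Proof.
move=> [w tw] [w' tw'].
have HW : H1 Omega (lifting Omega phi).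
  by rewrite /lifting; case: xgetP => [W _ []//|/(_ w')]; case.
have l0 : Hm1 Omega (fun=> 0 : R).
  split=> [a p q _ _|]; first by rewrite mulr0 addr0.
  by exists 0 => u _; rewrite normr0 mul0r.
have sol B : coef_class alpha beta Omega B ->
    weak_solution Omega B (fun=> 0) g (dirichlet_solution Omega B g).
  move=> cB; rewrite /dirichlet_solution; case: xgetP => [//|N].
  by have [u /N] := weak_solution_exists d0 alpha0 cB l0 tw.
have gp : g_pair (fun e => dirichlet_solution Omega (A e) g) (dirichlet_solution Omega A0 g).
  by apply: (g_pair_intro l0 (fun e e0 => sol _ (cA e0)) (sol _ cA0)).
have := flux_defect_vweak gp (grad_vsqint HW).
apply: cvg_trans; apply: near_eq_cvg; near=> e.
have e0 : 0 < e by near: e; exact: nbhs_right_gt.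
have H0 := (g_pair_closure0 gp).1; have He := (g_pair_closure gp e0).1.
rewrite /dtn (energyE (cA e0) He HW) (energyE cA0 H0 HW).
exact: (vipBl (g_pair_flux_vsqint gp e0) (g_pair_flux0_vsqint gp) (grad_vsqint HW)).
Unshelve. all: by end_near. Qed.

End homogenisation.

End sobolev.

(** * From the entries of the measurement vector to its weighted norm *)

Lemma weighted_norm_cvg0 (R : realType) n (C : 'M[R]_n) (T : Type) (F : set_system T)
    {FF : Filter F} (m : T -> 'rV[R]_n) :
  (forall k, m e ord0 k @[e --> F] --> (0 : R)) ->
  weighted_norm C (m e) @[e --> F] --> (0 : R).
Proof.
move=> cm; suff c : (m e *m invmx C *m (m e)^T) ord0 ord0 @[e --> F] --> (0 : R).
  have := cvg_comp _ _ c (@sqrt_continuous R 0); rewrite sqrtr0; exact.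
rewrite (_ : (fun e => _) = fun e => \sum_j (\sum_i m e ord0 i * invmx C i j) * m e ord0 j); last first.
  by apply/funext => e; rewrite !mxE; apply: eq_bigr => j _; rewrite !mxE.
rewrite [X in _ --> X](_ : 0 = \sum_(j < n) (\sum_(i < n) 0 * invmx C i j) * 0 :> R); last first.
  by rewrite big1// => j _; rewrite mulr0.
apply: cvg_big; first exact: add_continuous.
move=> j _; apply: cvgM; last exact: cm.
apply: cvg_big; first exact: add_continuous.
by move=> i _; apply: cvgM; [exact: cm|exact: cvg_cst].
Qed.

Theorem theorem5 (R : realType) (d : nat) (d_ge2 : (2 <= d)%N)
  (Omega : set 'rV[R]_d)
  (Omega_open : open Omega) (Omega_bounded : bounded_set Omega)
  (Omega_connected : connected Omega)
  (Omega_lipschitz : lipschitz_boundary Omega)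
  (alpha beta : R) (alpha_gt0 : 0 < alpha) (alpha_lt_beta : alpha < beta)
  (Sigma : Type) (sigma : Sigma)
  (A : Sigma -> R -> 'rV[R]_d -> 'M[R]_d) (A0 : Sigma -> 'rV[R]_d -> 'M[R]_d)
  (A_coef : forall eps : R, 0 < eps -> coef_class alpha beta Omega (A sigma eps))
  (A0_coef : coef_class alpha beta Omega (A0 sigma))
  (A_G_cvg : G_cvg Omega (A sigma) (A0 sigma))
  (J L : nat)
  (Gamma : 'I_J -> set 'rV[R]_d)
  (Gamma_bd : forall j, Gamma j `<=` bd Omega)
  (Gamma_disj : forall i j, i != j -> Gamma i `&` Gamma j = set0)
  (phi : 'I_J -> 'rV[R]_d -> R)
  (phi_Hhalf : forall j, Hhalf Omega (phi j))
  (phi_supp : forall j, bsupp Omega (phi j) `<=` Gamma j)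
  (g : 'I_L -> 'rV[R]_d -> R)
  (g_Hhalf : forall l, Hhalf Omega (g l))
  (Ce : 'M[R]_(J * L)) (Ce_sym : Ce^T = Ce) (Ce_pos : pos_def Ce) :
  let m (eps : R) : 'rV[R]_(J * L) :=
    mxvec (\matrix_(j < J, l < L)
      (dtn Omega (A sigma eps) (g l) \- dtn Omega (A0 sigma) (g l)) (phi j)) in
  weighted_norm Ce (m eps) @[eps --> 0^'+] --> (0 : R).
Proof.
move=> m; apply: weighted_norm_cvg0 => k; rewrite /m; case/mxvec_indexP: k => j l.
under eq_fun do rewrite mxvecE mxE /=.
exact: (dtn_cvg Omega_open Omega_bounded (ltnW d_ge2) alpha_gt0 A_coef A0_coef A_G_cvg
  (g_Hhalf l) (phi_Hhalf j)).
Qed.
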